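(* Let $\Omega=[0,2\pi]^2$, let $p\ge 1$ be an integer, let $s>1$, and let $u$ be the $2\pi$-periodic (in $x$ and $y$) solution on $\Omega\times[0,T]$ of the generalized Rosenau-KdV equation $$u_t+\Delta^2u_t+\Delta u_x+(1+u^p)(u_x+u_y)=0,\qquad u(x,y,0)=u_0(x,y),$$ and assume $u\in C^{2}\big(0,T;H_p^{s+4}(\Omega)\big)$. Let $\bm U^1$ be the first step of the LCN-MP scheme (defined in the context) with $N_1=N_2=N$ and time step $\tau$, started from $\bm U^0=\bm u^0$, and let $\bm u^1\in\mathbb V_h$ be the vector of grid values of $u(\cdot,\cdot,t_1)$. Then there exists $\tau_0>0$ such that for $0<\tau\le\tau_0$, $$\|\bm u^1-\bm U^1\|_h+\|\Delta_h(\bm u^1-\bm U^1)\|_h\le C(N^{-s}+\tau^2),\qquad \|\bm u^1-\bm U^1\|_{h,\infty}\le C(N^{-s}+\tau^2),$$ where $C>0$ is independent of $N$ and $\tau$.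
   Context: Grid: $N$ even, $h=2\pi/N$, $x_j=jh$, $y_j=jh$, $0\le j\le N-1$, $t_n=n\tau$, $\tau=T/M$. $\mathbb V_h$ is the space of grid functions $U_{j_1,j_2}$ ($0\le j_1,j_2\le N-1$), extended periodically, identified with vectors $\bm U=(U_{0,0},U_{1,0},\dots,U_{N-1,0},U_{0,1},\dots,U_{N-1,N-1})^T$ (index $j_1$ runs fastest); for a function $v$, $\bm v$ denotes its vector of grid values. $\langle\bm U,\bm V\rangle_h=h^2\sum_{j_1,j_2}U_{j_1,j_2}V_{j_1,j_2}$, $\|\bm U\|_h^2=\langle \bm U,\bm U\rangle_h$, $\|\bm U\|_{h,\infty}=\max|U_{j_1,j_2}|$, $\Delta_hU_{j_1,j_2}=(U_{j_1+1,j_2}-2U_{j_1,j_2}+U_{j_1-1,j_2})/h^2+(U_{j_1,j_2+1}-2U_{j_1,j_2}+U_{j_1,j_2-1})/h^2$. Spectral differentiation matrices: with $g_k(x)=\frac1N\sum_{l=-N/2}^{N/2}\frac1{a_l}e^{\mathrm i l(x-x_k)}$, $a_l=1$ for $|l|<N/2$, $a_{\pm N/2}=2$, let $\bm D_s^x=\bm D_s^y$ be the $N\times N$ matrices with entries $g_k^{(s)}(x_j)$, $0\le j,k\le N-1$. Set $\mathbb A=\bm I_N\otimes\bm D_2^x+\bm D_2^y\otimes\bm I_N$, $\mathbb B=\bm I_N\otimes\bm D_3^x+\bm D_2^y\otimes\bm D_1^x$, $\mathbb L_h=\bm I_N\otimes\bm D_1^x+\bm D_1^y\otimes\bm I_N$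 ($\otimes$ the Kronecker product), and for $\bm W\in\mathbb V_h$, $\mathbb D(\bm W)=\mathbb B+\mathbb L_h+\frac1{p+2}\big(\mathrm{diag}(\bm W^p)\mathbb L_h+\mathbb L_h\,\mathrm{diag}(\bm W^p)\big)$, $\bm W^p$ the componentwise power. LCN-MP scheme: $\bm U^0$ given; $\bm U^1$ solves $(\bm I+\mathbb A^2)\frac{\bm U^1-\bm U^0}{\tau}+\mathbb D(\bm U^0)\frac{\bm U^1+\bm U^0}{2}=0$; for $n=1,\dots,M-1$, $\bm U^{n+1}$ solves $(\bm I+\mathbb A^2)\frac{\bm U^{n+1}-\bm U^n}{\tau}+\mathbb D\big(\tfrac{3\bm U^n-\bm U^{n-1}}{2}\big)\frac{\bm U^{n+1}+\bm U^n}{2}=0$. $H_p^s(\Omega)$ is the closure in $H^s(\Omega)$ of smooth $2\pi$-periodic functions. *)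

(* Defs.v *)
From Stdlib Require Import Reals Lra Lia.
From Coquelicot Require Import Coquelicot.
Open Scope R_scope.

Definition periodic2 (f : R -> R -> R) : Prop :=
  forall x y, f (x + 2 * PI) y = f x y /\ f x (y + 2 * PI) = f x y.

Definition cont2 (f : R -> R -> R) : Prop :=
  forall x y, continuous (fun q : R * R => f (fst q) (snd q)) (x, y).

(* real and imaginary parts (up to sign) of the Fourier coefficient
   \hat f(k1,k2) = (2 pi)^{-2} \int_Omega f(x,y) e^{-i(k1 x + k2 y)} dx dy *)
Definition fcoef_re (f : R -> R -> R) (k1 k2 : R) : R :=
  / (4 * PI ^ 2) *
  RInt (fun x => RInt (fun y => f x y * cos (k1 * x + k2 * y)) 0 (2 * PI)) 0 (2 * PI).
Definition fcoef_im (f : R -> R -> R) (k1 k2 : R) : R :=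
  / (4 * PI ^ 2) *
  RInt (fun x => RInt (fun y => f x y * sin (k1 * x + k2 * y)) 0 (2 * PI)) 0 (2 * PI).

(* integer k = m - n for m = 0 .. 2n *)
Definition zidx (n m : nat) : R := INR m - INR n.

Definition Hsum (r : R) (f : R -> R -> R) (n : nat) : R :=
  sum_n (fun m1 => sum_n (fun m2 =>
     let k1 := zidx n m1 in let k2 := zidx n m2 in
     Rpower (1 + k1 ^ 2 + k2 ^ 2) r *
       (fcoef_re f k1 k2 ^ 2 + fcoef_im f k1 k2 ^ 2)) (2 * n)) (2 * n).

(* ||f||_{H^r} <= e  (the H^r norm squared is the (monotone) limit of Hsum) *)
Definition Hle (r : R) (f : R -> R -> R) (e : R) : Prop :=
  forall n, Hsum r f n <= e ^ 2.

(* f in H_p^r(Omega), represented by its continuous periodic representative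
   (for r > 1 every element of H_p^r has one, by Sobolev embedding) *)
Definition InHp (r : R) (f : R -> R -> R) : Prop :=
  periodic2 f /\ cont2 f /\ exists B, forall n, Hsum r f n <= B.

Definition fsub (f g : R -> R -> R) : R -> R -> R := fun x y => f x y - g x y.
Definition fscal (a : R) (f : R -> R -> R) : R -> R -> R := fun x y => a * f x y.

Definition ContH (r T : R) (w : R -> R -> R -> R) : Prop :=
  forall t, 0 <= t <= T -> forall eps, 0 < eps -> exists del, 0 < del /\
    forall t', 0 <= t' <= T -> Rabs (t' - t) < del -> Hle r (fsub (w t') (w t)) eps.

Definition DerivH (r T : R) (w w' : R -> R -> R -> R) : Prop :=
  forall t, 0 <= t <= T -> forall eps, 0 < eps -> exists del, 0 < del /\
    forall hh, hh <> 0 -> Rabs hh < del -> 0 <= t + hh <= T ->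
      Hle r (fsub (fscal (/ hh) (fsub (w (t + hh)) (w t))) (w' t)) eps.

Definition C2H (r T : R) (u : R -> R -> R -> R) : Prop :=
  let w := fun t x y => u x y t in
  exists w1 w2 : R -> R -> R -> R,
    (forall t, 0 <= t <= T -> InHp r (w t) /\ InHp r (w1 t) /\ InHp r (w2 t)) /\
    ContH r T w /\ ContH r T w1 /\ ContH r T w2 /\
    DerivH r T w w1 /\ DerivH r T w1 w2.

Definition dx (u : R -> R -> R -> R) : R -> R -> R -> R :=
  fun x y t => Derive (fun z => u z y t) x.
Definition dy (u : R -> R -> R -> R) : R -> R -> R -> R :=
  fun x y t => Derive (fun z => u x z t) y.
Definition dt (u : R -> R -> R -> R) : R -> R -> R -> R :=
  fun x y t => Derive (fun z => u x y z) t.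
Definition lap (u : R -> R -> R -> R) : R -> R -> R -> R :=
  fun x y t => dx (dx u) x y t + dy (dy u) x y t.

Definition RosenauKdV (p : nat) (T : R) (u : R -> R -> R -> R) : Prop :=
  forall x y t, 0 < t < T ->
    dt u x y t + lap (lap (dt u)) x y t + lap (dx u) x y t
    + (1 + u x y t ^ p) * (dx u x y t + dy u x y t) = 0.

Definition hstep (N : nat) : R := 2 * PI / INR N.
Definition xg (N j : nat) : R := INR j * hstep N.

(* grid functions U_{j1,j2}, 0 <= j1,j2 <= N-1 (values outside are irrelevant);
   the vector ordering (j1 fastest) is encoded in the Kronecker products below *)
Definition grid := nat -> nat -> R.

(* a_l = 2 for |l| = N/2, 1 otherwise; l = m - N/2 with m = 0..N *)
Definition a_coef (N m : nat) : R := if (Nat.eqb m 0 || Nat.eqb m N)%bool then 2 else 1.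

(* g_k(x) = 1/N sum_{l=-N/2}^{N/2} (1/a_l) e^{i l (x - x_k)}; this sum is real
   (the terms for l and -l are conjugate), so it equals the sum of the real parts *)
Definition gk (N k : nat) (x : R) : R :=
  / INR N * sum_n (fun m => / a_coef N m *
     cos ((INR m - INR N / 2) * (x - xg N k))) N.

Definition Dmat (N s : nat) (j k : nat) : R := Derive_n (gk N k) s (xg N j).

Definition Idm (j k : nat) : R := if Nat.eqb j k then 1 else 0.

(* Kronecker product (A (x) B) acting on the vector of U (index j1 + N j2):
   ((A (x) B) U)_{j1,j2} = sum_{k1,k2} A_{j2 k2} B_{j1 k1} U_{k1,k2} *)
Definition kron (N : nat) (A B : nat -> nat -> R) (U : grid) : grid :=
  fun j1 j2 => sum_n (fun k2 => sum_n (fun k1 =>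
                  A j2 k2 * B j1 k1 * U k1 k2) (N - 1)) (N - 1).

Definition gadd (U V : grid) : grid := fun j1 j2 => U j1 j2 + V j1 j2.
Definition gsub (U V : grid) : grid := fun j1 j2 => U j1 j2 - V j1 j2.
Definition gscal (a : R) (U : grid) : grid := fun j1 j2 => a * U j1 j2.
Definition gmul (U V : grid) : grid := fun j1 j2 => U j1 j2 * V j1 j2.
Definition gpow (U : grid) (p : nat) : grid := fun j1 j2 => U j1 j2 ^ p.

Definition opA (N : nat) (U : grid) : grid :=
  gadd (kron N Idm (Dmat N 2) U) (kron N (Dmat N 2) Idm U).
Definition opB (N : nat) (U : grid) : grid :=
  gadd (kron N Idm (Dmat N 3) U) (kron N (Dmat N 2) (Dmat N 1) U).
Definition opL (N : nat) (U : grid) : grid :=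
  gadd (kron N Idm (Dmat N 1) U) (kron N (Dmat N 1) Idm U).
Definition opD (N p : nat) (W U : grid) : grid :=
  gadd (gadd (opB N U) (opL N U))
       (gscal (/ (INR p + 2))
          (gadd (gmul (gpow W p) (opL N U)) (opL N (gmul (gpow W p) U)))).
Definition opIA2 (N : nat) (U : grid) : grid := gadd U (opA N (opA N U)).

Definition LCNMP_step1 (N p : nat) (tau : R) (U0 U1 : grid) : Prop :=
  forall j1 j2, (j1 < N)%nat -> (j2 < N)%nat ->
    gadd (opIA2 N (gscal (/ tau) (gsub U1 U0)))
         (opD N p U0 (gscal (/ 2) (gadd U1 U0))) j1 j2 = 0.

Definition gridval (N : nat) (f : R -> R -> R) : grid :=
  fun j1 j2 => f (xg N j1) (xg N j2).

Definition hnorm (N : nat) (U : grid) : R :=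
  sqrt (hstep N ^ 2 * sum_n (fun j2 => sum_n (fun j1 => U j1 j2 ^ 2) (N - 1)) (N - 1)).

Fixpoint maxupto (f : nat -> R) (n : nat) : R :=
  match n with
  | O => f O
  | S n' => Rmax (maxupto f n') (f n)
  end.
Definition hinfnorm (N : nat) (U : grid) : R :=
  maxupto (fun j2 => maxupto (fun j1 => Rabs (U j1 j2)) (N - 1)) (N - 1).

Definition lap_h (N : nat) (U : grid) : grid :=
  fun j1 j2 =>
    (U ((j1 + 1) mod N)%nat j2 - 2 * U j1 j2 + U ((j1 + N - 1) mod N)%nat j2) / hstep N ^ 2
  + (U j1 ((j2 + 1) mod N)%nat - 2 * U j1 j2 + U j1 ((j2 + N - 1) mod N)%nat) / hstep N ^ 2.

(* Main.v *)
(** Write [e = u1 - U1] and [eta = (u1 - u0) / tau]. Linearity of the scheme gives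
    [(I + A^2) e / tau + D(U0) e / 2 = r] with [r = (I + A^2) eta + D(U0) (u0 + tau eta / 2)].
    Since [A] is symmetric and [D(U0)] antisymmetric, pairing with [e] bounds [e] and [A e] in the
    discrete L2 norm by [tau] times that of [r], and [r = O(N^-s + tau)] suffices.

    The equation at time 0 cancels the leading part of [r]. For the spatial part, split each function
    as [f = q + (f - q)], [q] its Fourier partial sum of degree [K]. All spectral derivatives are exact
    on [q], and also on [q^p q'] when [(p+1) K < N/2], so no algebra property of [H^s] is needed. The
    tail [f - q] is estimated on the grid by cutting the frequencies into blocks of side [N]: on one
    block the grid norm is controlled by Parseval, and the blocks are summed by Cauchy-Schwarz, which
    avoids the loss of a factor [N] of a pointwise bound. The discrete Laplacian and the maximum norm
    are controlled by [e] and [A e] through the discrete Fourier transform.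

    Everything is real: a Fourier series is a sum of [a_k cos (k.x) + b_k sin (k.x)] over all of Z^2,
    with [a], [b] the real and (minus) imaginary parts of the coefficients. *)
Require Import Defs.
From Stdlib Require Import Reals Lra Lia ZArith Znumtheory List FunctionalExtensionality.
From Coquelicot Require Import Coquelicot.
Import ListNotations.
Open Scope R_scope.

(** * Finite sums over lists *)

(** The coefficient of the first step is frozen at the exact grid values of [u0], so the
    nonlinearity enters the error equation only through [r]; the factor [tau] of the energy bound
    turns [O(N^-s + tau)] into [O(N^-s + tau^2)] because [tau <= T]. The delicate point is that [r]
    applies differentiation matrices of total order up to 4 to grid values, and each order costs a
    factor up to [N/2]. Hence two tail rates for a function of [H^{s+4}]: its own tail is
    [O(N^-(s+4))] and absorbs [N^4], while the tails of its derivatives are [O(N^-s)]. The degree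
    [K] is about [N / (2(p+1))], a fixed fraction of [N], so truncating that low costs only a
    constant. The same tail estimates must apply to the remainder in time. It is therefore kept as a
    Fourier series, with the coefficients of [(u1 - u0 - tau u_t(0)) / tau^2] bounded in [H^{s+4}]
    uniformly in [tau]; a pointwise Taylor bound would not survive [A^2]. The equation is given for
    [0 < t < T] only, so at time 0 it is obtained as a limit. *)

Fixpoint sumL {A : Type} (l : list A) (f : A -> R) : R :=
  match l with
  | nil => 0
  | x :: l' => f x + sumL l' f
  end.

Section Sums.
Context {A : Type}.
Implicit Types (l : list A) (f g : A -> R).

Lemma sumL_ext l f g : (forall x, In x l -> f x = g x) -> sumL l f = sumL l g.
Proof.
  induction l as [|x l IH]; simpl; intros H; auto.
  rewrite (H x) by auto. f_equal. apply IH; auto.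
Qed.

Lemma sumL_plus l f g : sumL l (fun x => f x + g x) = sumL l f + sumL l g.
Proof. induction l as [|x l IH]; simpl; [ring|]. rewrite IH; ring. Qed.

Lemma sumL_scal l c f : sumL l (fun x => c * f x) = c * sumL l f.
Proof. induction l as [|x l IH]; simpl; [ring|]. rewrite IH; ring. Qed.

Lemma sumL_scal_r l c f : sumL l (fun x => f x * c) = sumL l f * c.
Proof. induction l as [|x l IH]; simpl; [ring|]. rewrite IH; ring. Qed.

Lemma sumL_const l c : sumL l (fun _ => c) = INR (length l) * c.
Proof.
  induction l as [|x l IH]; cbn [sumL length]; [simpl; ring|].
  rewrite IH, S_INR; ring.
Qed.

Lemma sumL_zero l f : (forall x, In x l -> f x = 0) -> sumL l f = 0.
Proof.
  intros H. rewrite (sumL_ext l f (fun _ => 0)); auto. rewrite sumL_const; ring.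
Qed.

Lemma sumL_le l f g : (forall x, In x l -> f x <= g x) -> sumL l f <= sumL l g.
Proof.
  induction l as [|x l IH]; simpl; intros H; [lra|].
  assert (f x <= g x) by auto. assert (sumL l f <= sumL l g) by (apply IH; auto). lra.
Qed.

Lemma sumL_nonneg l f : (forall x, In x l -> 0 <= f x) -> 0 <= sumL l f.
Proof.
  intros H. rewrite <- (sumL_zero l (fun _ => 0)) by auto. apply sumL_le; auto.
Qed.

Lemma sumL_abs l f : Rabs (sumL l f) <= sumL l (fun x => Rabs (f x)).
Proof.
  induction l as [|x l IH]; simpl; [rewrite Rabs_R0; lra|].
  eapply Rle_trans; [apply Rabs_triang|]. lra.
Qed.

Lemma sumL_app l l' f : sumL (l ++ l') f = sumL l f + sumL l' f.
Proof. induction l as [|x l IH]; simpl; [ring|]. rewrite IH; ring. Qed.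

End Sums.

Lemma sumL_map {A B : Type} (g : B -> A) (l : list B) (f : A -> R) : sumL (map g l) f = sumL l (fun x => f (g x)).
Proof. induction l as [|x l IH]; simpl; congruence. Qed.

Lemma sumL_swap {A B : Type} (l : list A) (l' : list B) (f : A -> B -> R) :
  sumL l (fun x => sumL l' (fun y => f x y)) = sumL l' (fun y => sumL l (fun x => f x y)).
Proof.
  induction l as [|x l IH]; simpl.
  - symmetry; apply sumL_zero; auto.
  - rewrite IH, sumL_plus; auto.
Qed.

Lemma sumL_prod {A B : Type} (l : list A) (l' : list B) (f : A * B -> R) :
  sumL (list_prod l l') f = sumL l (fun x => sumL l' (fun y => f (x, y))).
Proof.
  induction l as [|x l IH]; simpl; auto.
  rewrite sumL_app, sumL_map, IH; auto.
Qed.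

Section Supports.
Context {A : Type}.
Implicit Types (l : list A) (f g : A -> R).

Lemma sumL_mid l1 l2 x f : sumL (l1 ++ x :: l2) f = f x + sumL (l1 ++ l2) f.
Proof. rewrite !sumL_app; simpl; ring. Qed.

(** Lists play the role of finite sets: neither the order of the points nor the points where [f]
    vanishes matter. This is the tool for changing index sets. *)
Lemma sumL_support l l' f :
  NoDup l -> NoDup l' -> (forall x, f x <> 0 -> (In x l <-> In x l')) ->
  sumL l f = sumL l' f.
Proof.
  revert l'; induction l as [|x l IH]; simpl; intros l' H1 H2 H.
  - symmetry; apply sumL_zero. intros x Hx.
    destruct (Req_dec (f x) 0) as [|Hn]; auto. apply H in Hn. tauto.
  - inversion H1; subst.
    destruct (Req_dec (f x) 0) as [H0|Hn].
    + rewrite H0, Rplus_0_l. apply IH; auto.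
      intros y Hy. rewrite <- (H y Hy). split; auto.
      intros [->|]; auto. contradiction.
    + destruct (in_split x l') as (l1 & l2 & ->); [apply (H x Hn); auto|].
      rewrite sumL_mid. f_equal. apply IH; auto.
      * eapply NoDup_remove_1; eauto.
      * intros y Hy. specialize (H y Hy). rewrite in_app_iff in *. simpl in H.
        apply NoDup_remove_2 in H2. rewrite in_app_iff in H2.
        split; intros Hin.
        -- assert (y <> x) by (intros ->; contradiction). intuition congruence.
        -- assert (y <> x) by (intros ->; tauto). intuition congruence.
Qed.

Lemma sumL_incl_le l l' f :
  NoDup l -> incl l l' -> (forall x, In x l' -> 0 <= f x) -> sumL l f <= sumL l' f.
Proof.
  revert l'; induction l as [|x l IH]; simpl; intros l' H1 H2 H.
  - apply sumL_nonneg; auto.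
  - inversion H1; subst.
    destruct (in_split x l') as (l1 & l2 & ->); [apply H2; left; auto|].
    rewrite sumL_mid. apply Rplus_le_compat_l. apply IH; auto.
    + intros y Hy. assert (In y (l1 ++ x :: l2)) by (apply H2; right; auto).
      rewrite in_app_iff in *; simpl in *. intuition congruence.
    + intros y Hy. apply H. rewrite in_app_iff in *; simpl; tauto.
Qed.

Lemma sumL_single l x f :
  NoDup l -> In x l -> (forall y, In y l -> y <> x -> f y = 0) -> sumL l f = f x.
Proof.
  intros H1 H2 H. destruct (in_split x l H2) as (l1 & l2 & ->).
  rewrite sumL_mid, sumL_zero; [ring|].
  intros y Hy. apply H; [rewrite in_app_iff in *; simpl; tauto|].
  intros ->. eapply NoDup_remove_2 in H1; eauto.
Qed.

Lemma sumL_term_le l x f : In x l -> (forall y, In y l -> 0 <= f y) -> f x <= sumL l f.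
Proof.
  intros H2 H. destruct (in_split x l H2) as (l1 & l2 & ->).
  rewrite sumL_mid. assert (0 <= sumL (l1 ++ l2) f); [|lra].
  apply sumL_nonneg. intros y Hy. apply H. rewrite in_app_iff in *; simpl; tauto.
Qed.

Lemma sumL_CS l f g :
  (sumL l (fun x => f x * g x)) ^ 2 <= sumL l (fun x => f x ^ 2) * sumL l (fun x => g x ^ 2).
Proof.
  set (P := sumL l (fun x => f x ^ 2)). set (Q := sumL l (fun x => f x * g x)).
  set (S := sumL l (fun x => g x ^ 2)).
  assert (HS : forall t, 0 <= P + 2 * t * Q + t ^ 2 * S).
  { intros t. unfold P, Q, S. rewrite <- !sumL_scal, <- !sumL_plus.
    apply sumL_nonneg. intros x _.
    replace (_ + _) with ((f x + t * g x) ^ 2) by ring. apply pow2_ge_0. }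
  assert (0 <= S) by (apply sumL_nonneg; intros; apply pow2_ge_0).
  destruct (Req_dec S 0) as [H0|Hn].
  - destruct (Req_dec Q 0) as [->|HQ]; [rewrite H0; lra|].
    (* For [S = 0] the quadratic is affine; at this [t] it equals -1. *)
    exfalso. specialize (HS (- (P + 1) / (2 * Q))). rewrite H0 in HS.
    replace (P + 2 * (- (P + 1) / (2 * Q)) * Q + _ ^ 2 * 0) with (-1) in HS by (field; auto). lra.
  (* The minimiser of the quadratic yields the discriminant inequality. *)
  - specialize (HS (- Q / S)).
    replace (P + _ + _) with ((P * S - Q ^ 2) / S) in HS by (field; auto).
    assert (0 < S) by lra.
    apply (Rmult_le_compat_r S) in HS; [|lra].
    replace ((P * S - Q ^ 2) / S * S) with (P * S - Q ^ 2) in HS by (field; auto). lra.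
Qed.

Definition l2 l f : R := sqrt (sumL l (fun x => f x ^ 2)).

Lemma l2_nonneg l f : 0 <= l2 l f.
Proof. apply sqrt_pos. Qed.

Lemma l2_sqr l f : l2 l f ^ 2 = sumL l (fun x => f x ^ 2).
Proof. apply pow2_sqrt. apply sumL_nonneg; intros; apply pow2_ge_0. Qed.

Lemma l2_CS l f g : Rabs (sumL l (fun x => f x * g x)) <= l2 l f * l2 l g.
Proof.
  apply Rsqr_incr_0_var.
  - rewrite <- Rsqr_abs, !Rsqr_pow2. unfold l2. rewrite <- sqrt_mult_alt.
    + rewrite pow2_sqrt; [apply sumL_CS|].
      apply Rmult_le_pos; apply sumL_nonneg; intros; apply pow2_ge_0.
    + apply sumL_nonneg; intros; apply pow2_ge_0.
  - apply Rmult_le_pos; apply l2_nonneg.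
Qed.

Lemma l2_le_of_sqr l f c : 0 <= c -> sumL l (fun x => f x ^ 2) <= c ^ 2 -> l2 l f <= c.
Proof.
  intros Hc H. unfold l2. rewrite <- (sqrt_pow2 c Hc). apply sqrt_le_1_alt; auto.
Qed.

Lemma l2_triang l f g : l2 l (fun x => f x + g x) <= l2 l f + l2 l g.
Proof.
  pose proof (l2_nonneg l f); pose proof (l2_nonneg l g).
  apply l2_le_of_sqr; [lra|].
  rewrite (sumL_ext l _ (fun x => (f x ^ 2 + g x ^ 2) + 2 * (f x * g x)))
    by (intros; ring).
  rewrite !sumL_plus, sumL_scal, <- !l2_sqr.
  pose proof (l2_CS l f g). pose proof (Rle_abs (sumL l (fun x => f x * g x))). nra.
Qed.

Lemma l2_le l f g : (forall x, In x l -> Rabs (f x) <= Rabs (g x)) -> l2 l f <= l2 l g.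
Proof.
  intros H. apply sqrt_le_1_alt. apply sumL_le. intros x Hx.
  rewrite <- (pow2_abs (f x)), <- (pow2_abs (g x)). apply pow_incr.
  split; [apply Rabs_pos | auto].
Qed.

Lemma l2_scal l c f : l2 l (fun x => c * f x) = Rabs c * l2 l f.
Proof.
  unfold l2. rewrite (sumL_ext l _ (fun x => c ^ 2 * f x ^ 2)) by (intros; ring).
  rewrite sumL_scal, sqrt_mult_alt by apply pow2_ge_0.
  rewrite <- Rsqr_pow2, sqrt_Rsqr_abs. auto.
Qed.

End Supports.

Lemma l2_sum {A B : Type} (l : list A) (K : list B) (f : B -> A -> R) :
  l2 l (fun x => sumL K (fun k => f k x)) <= sumL K (fun k => l2 l (f k)).
Proof.
  induction K as [|k K IH]; simpl.
  - apply l2_le_of_sqr; [lra|]. rewrite sumL_zero; [lra|intros; ring].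
  - eapply Rle_trans; [apply l2_triang|]. lra.
Qed.

Lemma sumL_lim {A : Type} (l : list A) (f : nat -> A -> R) (g : A -> R) :
  (forall x, In x l -> is_lim_seq (fun n => f n x) (g x)) ->
  is_lim_seq (fun n => sumL l (f n)) (sumL l g).
Proof.
  induction l as [|x l IH]; simpl; intros H.
  - apply is_lim_seq_const.
  - apply (is_lim_seq_plus' (fun n => f n x)); auto.
Qed.

Lemma sum_n_sumL (f : nat -> R) n : sum_n f n = sumL (seq 0 (S n)) f.
Proof.
  induction n as [|n IH].
  - rewrite sum_O. symmetry; apply Rplus_0_r.
  - rewrite sum_Sn, IH, (seq_S (S n)), sumL_app.
    change (sumL (seq 0 (S n)) f + f (S n) = sumL (seq 0 (S n)) f + (f (S n) + 0)). ring.
Qed.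

Lemma NoDup_map_inj {A B} (f : A -> B) l :
  (forall x y, In x l -> In y l -> f x = f y -> x = y) -> NoDup l -> NoDup (map f l).
Proof.
  induction l as [|a l IH]; simpl; intros Hf H; constructor; inversion H; subst.
  - rewrite in_map_iff. intros (x & E & Hx). apply Hf in E; auto. subst; auto.
  - apply IH; auto.
Qed.

Lemma NoDup_list_prod {A B} (l : list A) (l' : list B) :
  NoDup l -> NoDup l' -> NoDup (list_prod l l').
Proof.
  intros Hl Hl'. induction Hl as [|x l Hx Hl IH]; simpl; [constructor|].
  apply NoDup_app; auto.
  - apply NoDup_map_inj; auto. intros; congruence.
  - intros [a b] H1 H2. apply in_map_iff in H1. destruct H1 as (y & E & _).
    inversion E; subst. apply in_prod_iff in H2. tauto.
Qed.

(** * Frequency boxes and convergent weights *)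

(** Orthogonality on the grid holds for any [N] consecutive frequencies, so the starting point is a
    parameter; the same lists give the symmetric truncation boxes and the shifted blocks. *)
Definition rng (z : Z) (n : nat) : list Z := map (fun i => (z + Z.of_nat i)%Z) (seq 0 n).
Definition rng2 (z w : Z) (n : nat) : list (Z * Z) := list_prod (rng z n) (rng w n).
Definition box (n : nat) : list (Z * Z) := rng2 (- Z.of_nat n) (- Z.of_nat n) (2 * n + 1).

Lemma in_rng z n k : In k (rng z n) <-> (z <= k < z + Z.of_nat n)%Z.
Proof.
  unfold rng. rewrite in_map_iff. split.
  - intros (i & <- & Hi). apply in_seq in Hi. lia.
  - intros H. exists (Z.to_nat (k - z)). rewrite in_seq. lia.
Qed.

Lemma NoDup_rng z n : NoDup (rng z n).
Proof. apply NoDup_map_inj; [intros; lia | apply seq_NoDup]. Qed.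

Lemma NoDup_rng2 z w n : NoDup (rng2 z w n).
Proof. apply NoDup_list_prod; apply NoDup_rng. Qed.

Lemma in_rng2 z w n k : In k (rng2 z w n) <->
  (z <= fst k < z + Z.of_nat n /\ w <= snd k < w + Z.of_nat n)%Z.
Proof.
  destruct k as [k1 k2]. unfold rng2. rewrite in_prod_iff, !in_rng. simpl. tauto.
Qed.

Lemma in_box n k : In k (box n) <->
  (- Z.of_nat n <= fst k <= Z.of_nat n /\ - Z.of_nat n <= snd k <= Z.of_nat n)%Z.
Proof. unfold box. rewrite in_rng2. lia. Qed.

Lemma NoDup_box n : NoDup (box n).
Proof. apply NoDup_rng2. Qed.

Lemma box_incl n m : (n <= m)%nat -> incl (box n) (box m).
Proof. intros H k. rewrite !in_box. lia. Qed.

Definition kx (k : Z * Z) : R := IZR (fst k).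
Definition ky (k : Z * Z) : R := IZR (snd k).
Definition wgt (k : Z * Z) : R := 1 + kx k ^ 2 + ky k ^ 2.

Lemma wgt_ge1 k : 1 <= wgt k.
Proof. unfold wgt. pose proof (pow2_ge_0 (kx k)). pose proof (pow2_ge_0 (ky k)). lra. Qed.

Lemma Rpower_pos x y : 0 < Rpower x y.
Proof. apply exp_pos. Qed.

Lemma Rpower_ge1 x y : 1 <= x -> 0 <= y -> 1 <= Rpower x y.
Proof.
  intros Hx Hy. rewrite <- (Rpower_O x) by lra.
  destruct (Req_dec x 1) as [->|]; [|apply Rle_Rpower; lra].
  unfold Rpower. rewrite ln_1, !Rmult_0_r. lra.
Qed.

Lemma Rpower_le_exp x y z : 1 <= x -> y <= z -> Rpower x y <= Rpower x z.
Proof.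
  intros Hx Hy. destruct (Req_dec x 1) as [->|]; [|apply Rle_Rpower; lra].
  unfold Rpower. rewrite ln_1, !Rmult_0_r. lra.
Qed.

Lemma Rpower_neg_anti x y s : 0 < x -> x <= y -> 0 <= s -> Rpower y (- s) <= Rpower x (- s).
Proof.
  intros Hx Hxy Hs. rewrite !Rpower_Ropp. apply Rinv_le_contravar; [apply Rpower_pos|].
  apply Rle_Rpower_l; lra.
Qed.

Lemma Rpower_1_l y : Rpower 1 y = 1.
Proof. unfold Rpower. rewrite ln_1, Rmult_0_r. apply exp_0. Qed.

(** Comparison of the series with an integral: the mean value theorem for [x^(1-s)] on [[k, k+1]],
    where the derivative is smallest in modulus at the right end. *)
Lemma pseries_step s (k : nat) : 1 < s -> (1 <= k)%nat ->
  Rpower (INR (S k)) (- s) <= / (s - 1) * (Rpower (INR k) (1 - s) - Rpower (INR (S k)) (1 - s)).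
Proof.
  intros Hs Hk. assert (H1 : 1 <= INR k) by (apply (le_INR 1); auto).
  rewrite S_INR.
  destruct (MVT_cor2 (fun x => Rpower x (1 - s)) (fun x => (1 - s) * Rpower x (1 - s - 1))
              (INR k) (INR k + 1)) as (c & E & Hc); [lra| |].
  { intros c Hc. apply derivable_pt_lim_power. lra. }
  replace (1 - s - 1) with (- s) in E by ring.
  assert (Hm : Rpower (INR k + 1) (- s) <= Rpower c (- s)) by (apply Rpower_neg_anti; lra).
  apply (Rmult_le_reg_l (s - 1)); [lra|].
  rewrite <- Rmult_assoc, Rinv_r, Rmult_1_l by lra. nra.
Qed.

Lemma pseries_bound s (n : nat) : 1 < s ->
  sumL (seq 0 n) (fun k => Rpower (INR (S k)) (- s)) <= 1 + / (s - 1).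
Proof.
  intros Hs.
  (* The negative term is kept in the induction so that the steps telescope. *)
  assert (H : forall n, sumL (seq 0 (S n)) (fun k => Rpower (INR (S k)) (- s))
              <= 1 + / (s - 1) * (1 - Rpower (INR (S n)) (1 - s))).
  { intros m. induction m as [|m IH].
    - simpl. rewrite !Rpower_1_l. lra.
    - rewrite seq_S, sumL_app. cbn [sumL].
      pose proof (pseries_step s (S m) Hs ltac:(lia)). simpl (0 + _)%nat. lra. }
  assert (0 < / (s - 1)) by (apply Rinv_0_lt_compat; lra).
  destruct n as [|n]; [simpl; lra|].
  eapply Rle_trans; [apply H|].
  pose proof (Rpower_pos (INR (S n)) (1 - s)). nra.
Qed.

Lemma zseries_bound s : 1 < s -> exists C, 0 < C /\ forall n : nat,
  sumL (rng (- Z.of_nat n) (2 * n + 1)) (fun k => Rpower (1 + IZR k ^ 2) (- (s / 2))) <= C.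
Proof.
  intros Hs. set (D := 1 + / (s - 1)).
  assert (HD : 0 < D) by (unfold D; assert (0 < / (s - 1)) by (apply Rinv_0_lt_compat; lra); lra).
  exists (2 * (Rpower 2 (s / 2) * D)).
  assert (H2 : 0 < Rpower 2 (s / 2)) by apply Rpower_pos.
  split; [nra|]. intros n.
  assert (Ht : forall (i : nat) (z : R), z ^ 2 = INR i ^ 2 ->
     Rpower (1 + z ^ 2) (- (s / 2)) <= Rpower 2 (s / 2) * Rpower (INR (S i)) (- s)).
  { intros i z Ez. pose proof (pos_INR i). rewrite S_INR, Ez.
    (* The factor [2^(s/2)] comes from [(i + 1)^2 <= 2 (1 + i^2)]. *)
    apply Rle_trans with (Rpower ((INR i + 1) ^ 2 / 2) (- (s / 2))).
    { pose proof (pow2_ge_0 (INR i - 1)). apply Rpower_neg_anti; simpl in *; nra. }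
    unfold Rpower, Rdiv. rewrite ln_mult by (simpl; nra). rewrite ln_pow, ln_Rinv by lra.
    rewrite <- exp_plus. right. f_equal. simpl INR. field. }
  set (f := fun k => Rpower (1 + IZR k ^ 2) (- (s / 2))).
  (* Zero is counted in both halves, which only enlarges a sum of positive terms. *)
  apply Rle_trans with (sumL (map Z.of_nat (seq 0 (n + 1)) ++
     map (fun i => (- Z.of_nat i)%Z) (seq 0 (n + 1))) f).
  { apply sumL_incl_le.
    - apply NoDup_rng.
    - intros k. rewrite in_rng, in_app_iff, !in_map_iff. intros Hk.
      destruct (Z_le_gt_dec 0 k).
      + left. exists (Z.to_nat k). rewrite in_seq. lia.
      + right. exists (Z.to_nat (- k)). rewrite in_seq. lia.
    - intros x _. left. apply Rpower_pos. }
  rewrite sumL_app, !sumL_map.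
  assert (Hb : forall g : nat -> Z, (forall i, IZR (g i) ^ 2 = INR i ^ 2) ->
     sumL (seq 0 (n + 1)) (fun i => f (g i)) <= Rpower 2 (s / 2) * D).
  { intros g Hg. eapply Rle_trans; [apply sumL_le; intros i _; apply (Ht i); apply Hg|].
    rewrite sumL_scal. apply Rmult_le_compat_l; [lra|]. apply pseries_bound; auto. }
  pose proof (Hb Z.of_nat (fun i => f_equal (fun x => x ^ 2) (eq_sym (INR_IZR_INZ i)))).
  assert (sumL (seq 0 (n + 1)) (fun i => f (- Z.of_nat i)%Z) <= Rpower 2 (s / 2) * D).
  { apply (Hb (fun i => (- Z.of_nat i)%Z)). intros i. rewrite opp_IZR, <- INR_IZR_INZ. ring. }
  lra.
Qed.

(** Since [(1 + x^2)(1 + y^2) <= (1 + x^2 + y^2)^2], the summand is at most a product of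
    one-dimensional ones with half the exponent, and the double sum factors. *)
Lemma box_series_bound s : 1 < s -> exists C, 0 < C /\ forall n : nat,
  sumL (box n) (fun k => Rpower (wgt k) (- s)) <= C.
Proof.
  intros Hs. destruct (zseries_bound s Hs) as (D & HD & H).
  exists (D * D). split; [nra|]. intros n.
  set (f := fun k => Rpower (1 + IZR k ^ 2) (- (s / 2))).
  apply Rle_trans with (sumL (box n) (fun k => f (fst k) * f (snd k))).
  - apply sumL_le. intros k _. unfold f.
    assert (0 <= kx k ^ 2) by apply pow2_ge_0. assert (0 <= ky k ^ 2) by apply pow2_ge_0.
    fold (kx k) (ky k).
    rewrite Rpower_mult_distr by lra.
    replace (- s) with (2 * (- (s / 2))) by field. rewrite <- Rpower_mult.
    apply Rpower_neg_anti; [nra| |lra].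
    replace 2 with (INR 2) by reflexivity. unfold wgt.
    rewrite Rpower_pow by lra. nra.
  - unfold box, rng2. rewrite sumL_prod.
    rewrite (sumL_ext _ _ (fun x => f x * sumL (rng (- Z.of_nat n) (2 * n + 1)) f))
      by (intros; simpl; rewrite sumL_scal; auto).
    rewrite sumL_scal_r. specialize (H n). fold f in H.
    assert (0 <= sumL (rng (- Z.of_nat n) (2 * n + 1)) f)
      by (apply sumL_nonneg; intros; left; apply Rpower_pos).
    apply Rmult_le_compat; auto.
Qed.

(** * Fourier uniqueness for continuous periodic functions *)

Lemma cont2_plus f g : cont2 f -> cont2 g -> cont2 (fun x y => f x y + g x y).
Proof.
  intros Hf Hg x y.
  apply (continuous_plus (fun q : R * R => f (fst q) (snd q))
                         (fun q : R * R => g (fst q) (snd q))); auto.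
Qed.

Lemma cont2_mult f g : cont2 f -> cont2 g -> cont2 (fun x y => f x y * g x y).
Proof.
  intros Hf Hg x y.
  apply (continuous_mult (fun q : R * R => f (fst q) (snd q))
                         (fun q : R * R => g (fst q) (snd q))); auto.
Qed.

Lemma cont2_const c : cont2 (fun _ _ => c).
Proof. intros x y. apply continuous_const. Qed.

Lemma cont2_fst : cont2 (fun x _ => x).
Proof. intros x y. apply continuous_fst. Qed.

Lemma cont2_snd : cont2 (fun _ y => y).
Proof. intros x y. apply continuous_snd. Qed.

Lemma cont2_comp (h : R -> R) f : (forall z, continuous h z) -> cont2 f -> cont2 (fun x y => h (f x y)).
Proof.
  intros Hh Hf x y. apply (continuous_comp (fun q : R * R => f (fst q) (snd q)) h); auto.
Qed.

Lemma cont2_scal c f : cont2 f -> cont2 (fun x y => c * f x y).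
Proof. intros H. apply cont2_mult; auto. apply cont2_const. Qed.

Lemma cont2_minus f g : cont2 f -> cont2 g -> cont2 (fun x y => f x y - g x y).
Proof.
  intros Hf Hg x y.
  apply (continuous_minus (fun q : R * R => f (fst q) (snd q))
                         (fun q : R * R => g (fst q) (snd q))); auto.
Qed.

Lemma cont2_cos a b p : cont2 (fun x y => cos (a * x + b * y + p)).
Proof.
  apply (cont2_comp cos); [apply continuous_cos|].
  apply cont2_plus; [|apply cont2_const].
  apply cont2_plus; apply cont2_scal; [apply cont2_fst | apply cont2_snd].
Qed.

Lemma cont2_sin a b p : cont2 (fun x y => sin (a * x + b * y + p)).
Proof.
  apply (cont2_comp sin); [apply continuous_sin|].
  apply cont2_plus; [|apply cont2_const].
  apply cont2_plus; apply cont2_scal; [apply cont2_fst | apply cont2_snd].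
Qed.

Lemma cont2_sumL {A} (l : list A) (f : A -> R -> R -> R) :
  (forall a, cont2 (f a)) -> cont2 (fun x y => sumL l (fun a => f a x y)).
Proof.
  intros H. induction l as [|a l IH]; simpl; [apply cont2_const|].
  apply cont2_plus; auto.
Qed.

Lemma cont2_eps f : cont2 f <-> forall x y (eps : posreal), exists del : posreal,
  forall u v, Rabs (u - x) < del -> Rabs (v - y) < del -> Rabs (f u v - f x y) < eps.
Proof.
  split.
  - intros H x y eps. pose proof (proj2 (continuity_2d_pt_filterlim f x y) (H x y)) as H'.
    destruct (H' eps) as [d Hd]. exists d. auto.
  - intros H x y. apply (continuity_2d_pt_filterlim f x y). intros eps.
    destruct (H x y eps) as [d Hd]. exists d. auto.
Qed.

Lemma cont2_y f x y : cont2 f -> continuous (fun v => f x v) y.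
Proof.
  intros H. apply (continuous_comp_2 (fun _ : R => x) (fun v : R => v) f).
  - apply continuous_const.
  - apply continuous_id.
  - apply H.
Qed.

Lemma cont2_ex_RInt_y f x a b : cont2 f -> ex_RInt (fun y => f x y) a b.
Proof. intros H. apply (ex_RInt_continuous (fun y => f x y)). intros; apply cont2_y; auto. Qed.

Lemma two_PI_pos : 0 < 2 * PI.
Proof. pose proof PI_RGT_0; lra. Qed.

(** Uniform continuity of [f] on the strip [[x-1, x+1] x [0, 2 PI]] carries over to the inner
    integral; dividing [eps] by [2 PI + 1] instead of [2 PI] keeps the last inequality strict. *)
Lemma cont2_RInt f x : cont2 f -> continuous (fun u => RInt (fun y => f u y) 0 (2 * PI)) x.
Proof.
  intros H. pose proof two_PI_pos as HP.
  assert (Hpi : 0 < 2 * PI + 1) by lra.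
  apply continuity_pt_filterlim. apply continuity_pt_locally. intros eps.
  assert (He : 0 < eps / (2 * PI + 1)) by (apply Rdiv_lt_0_compat; [apply cond_pos|lra]).
  destruct (uniform_continuity_2d f (x - 1) (x + 1) 0 (2 * PI)
     ltac:(intros; apply continuity_2d_pt_filterlim, H) (mkposreal _ He)) as [d Hd].
  simpl in Hd.
  assert (Hm : 0 < Rmin d 1) by (apply Rmin_pos; [apply cond_pos|lra]).
  exists (mkposreal _ Hm). intros u Hu.
  unfold ball in Hu; simpl in Hu; unfold AbsRing_ball, abs, minus, plus, opp in Hu; simpl in Hu.
  assert (Hu' : Rabs (u - x) < Rmin d 1) by exact Hu.
  pose proof (Rmin_l d 1); pose proof (Rmin_r d 1).
  assert (Hux : Rabs (u - x) < 1) by lra. apply Rabs_def2 in Hux.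
  rewrite <- (RInt_minus (V := R_CompleteNormedModule)) by (apply cont2_ex_RInt_y; auto).
  apply Rle_lt_trans with ((2 * PI - 0) * (eps / (2 * PI + 1))).
  - apply abs_RInt_le_const; [lra| |].
    + apply @ex_RInt_minus; apply cont2_ex_RInt_y; auto.
    + intros t Ht. left. apply Hd; try lra.
      rewrite Rminus_diag, Rabs_R0. apply cond_pos.
  - apply (Rmult_lt_reg_r (2 * PI + 1)); [lra|].
    replace ((2 * PI - 0) * (eps / (2 * PI + 1)) * (2 * PI + 1)) with (2 * PI * eps)
      by (field; lra).
    pose proof (cond_pos eps). nra.
Qed.

Definition I2 (f : R -> R -> R) : R := RInt (fun x => RInt (fun y => f x y) 0 (2 * PI)) 0 (2 * PI).

Lemma cont2_ex_RInt2 f : cont2 f -> ex_RInt (fun x => RInt (fun y => f x y) 0 (2 * PI)) 0 (2 * PI).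
Proof.
  intros H. apply (ex_RInt_continuous (fun x => RInt (fun y => f x y) 0 (2 * PI))).
  intros; apply cont2_RInt; auto.
Qed.

Lemma I2_ext f g : (forall x y, f x y = g x y) -> I2 f = I2 g.
Proof.
  intros H. replace g with f; auto.
  apply functional_extensionality; intros x. apply functional_extensionality; auto.
Qed.

Lemma I2_plus f g : cont2 f -> cont2 g -> I2 (fun x y => f x y + g x y) = I2 f + I2 g.
Proof.
  intros Hf Hg. unfold I2.
  transitivity (RInt (fun x => plus (RInt (fun y => f x y) 0 (2 * PI))
                                    (RInt (fun y => g x y) 0 (2 * PI))) 0 (2 * PI)).
  - apply RInt_ext. intros x _.
    apply (RInt_plus (fun y => f x y) (fun y => g x y)); apply cont2_ex_RInt_y; auto.
  - apply (RInt_plus (V := R_CompleteNormedModule)); apply cont2_ex_RInt2; auto.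
Qed.

Lemma I2_scal c f : cont2 f -> I2 (fun x y => c * f x y) = c * I2 f.
Proof.
  intros Hf. unfold I2.
  transitivity (RInt (fun x => scal c (RInt (fun y => f x y) 0 (2 * PI))) 0 (2 * PI)).
  - apply RInt_ext. intros x _.
    apply (RInt_scal (fun y => f x y)); apply cont2_ex_RInt_y; auto.
  - apply (RInt_scal (V := R_CompleteNormedModule)); apply cont2_ex_RInt2; auto.
Qed.

Lemma I2_zero : I2 (fun _ _ => 0) = 0.
Proof.
  rewrite (I2_ext _ (fun x y => 0 * 0)) by (intros; ring).
  rewrite I2_scal; [ring|apply cont2_const].
Qed.

Lemma I2_sumL {A} (l : list A) (f : A -> R -> R -> R) : (forall a, cont2 (f a)) ->
  I2 (fun x y => sumL l (fun a => f a x y)) = sumL l (fun a => I2 (f a)).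
Proof.
  intros H. induction l as [|a l IH]; simpl; [apply I2_zero|].
  rewrite (I2_plus (f a) (fun x y => sumL l (fun a => f a x y))); [congruence|auto|].
  apply cont2_sumL; auto.
Qed.

Lemma I2_bound f M : cont2 f -> (forall x y, Rabs (f x y) <= M) ->
  Rabs (I2 f) <= 4 * PI ^ 2 * M.
Proof.
  intros Hf HM. unfold I2. pose proof two_PI_pos.
  replace (4 * PI ^ 2 * M) with ((2 * PI - 0) * ((2 * PI - 0) * M)) by ring.
  apply abs_RInt_le_const; [lra|apply cont2_ex_RInt2; auto|].
  intros t _. apply abs_RInt_le_const; [lra|apply cont2_ex_RInt_y; auto|auto].
Qed.

Lemma cos_add_2PI_Z p (z : Z) : cos (p + IZR z * (2 * PI)) = cos p.
Proof.
  destruct (Z_le_gt_dec 0 z).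
  - replace (p + IZR z * (2 * PI)) with (p + 2 * INR (Z.to_nat z) * PI);
      [apply cos_period|]. rewrite INR_IZR_INZ, Z2Nat.id by auto. ring.
  - rewrite <- (cos_period (p + IZR z * (2 * PI)) (Z.to_nat (- z))).
    f_equal. rewrite INR_IZR_INZ, Z2Nat.id by lia. rewrite opp_IZR. ring.
Qed.

Lemma sin_cos_shift x : sin x = cos (x + - (PI / 2)).
Proof. rewrite cos_plus, cos_neg, sin_neg, cos_PI2, sin_PI2. ring. Qed.

Lemma sin_add_2PI_Z p (z : Z) : sin (p + IZR z * (2 * PI)) = sin p.
Proof.
  rewrite !sin_cos_shift.
  replace (p + IZR z * (2 * PI) + - (PI / 2)) with (p + - (PI / 2) + IZR z * (2 * PI)) by ring.
  apply cos_add_2PI_Z.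
Qed.

Lemma RInt_cos_lin (m : Z) p : m <> 0%Z -> RInt (fun y => cos (p + IZR m * y)) 0 (2 * PI) = 0.
Proof.
  intros Hm. assert (Hr : IZR m <> 0) by (apply not_0_IZR; auto).
  apply is_RInt_unique.
  replace 0 with (minus (/ IZR m * sin (p + IZR m * (2 * PI))) (/ IZR m * sin (p + IZR m * 0))) at 2.
  - apply (is_RInt_derive (fun y => / IZR m * sin (p + IZR m * y)) (fun y => cos (p + IZR m * y))).
    + intros x _. auto_derive; auto. field; auto.
    + intros x _. apply (continuous_comp (fun y => p + IZR m * y) cos); [|apply continuous_cos].
      apply (continuous_plus (fun _ => p) (fun y => IZR m * y)); [apply continuous_const|].
      apply (continuous_mult (fun _ => IZR m) (fun y => y)); [apply continuous_const|apply continuous_id].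
  - unfold minus, plus, opp; simpl. rewrite sin_add_2PI_Z, Rmult_0_r, Rplus_0_r. ring.
Qed.

Lemma I2_cos_nz (k : Z * Z) p : k <> (0, 0)%Z ->
  I2 (fun x y => cos (kx k * x + ky k * y + p)) = 0.
Proof.
  destruct k as [k1 k2]. unfold kx, ky; simpl. intros Hk. unfold I2.
  destruct (Z.eq_dec k2 0) as [->|H2].
  - assert (k1 <> 0%Z) by congruence.
    rewrite (RInt_ext _ (fun x => (2 * PI) * cos (p + IZR k1 * x))).
    + rewrite (RInt_scal (V := R_CompleteNormedModule)).
      * rewrite RInt_cos_lin by auto. apply Rmult_0_r.
      * apply (ex_RInt_continuous (fun x => cos (p + IZR k1 * x))). intros z _.
        apply (continuous_comp (fun y => p + IZR k1 * y) cos); [|apply continuous_cos].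
        apply (continuous_plus (fun _ => p) (fun y => IZR k1 * y)); [apply continuous_const|].
        apply (continuous_mult (fun _ => IZR k1) (fun y => y)); [apply continuous_const|apply continuous_id].
    + intros x _. rewrite (RInt_ext _ (fun _ => cos (p + IZR k1 * x))).
      * rewrite RInt_const. unfold scal; simpl; unfold mult; simpl. ring.
      * intros y _. f_equal. ring.
  - rewrite (RInt_ext _ (fun _ => 0)).
    + rewrite RInt_const. unfold scal; simpl; unfold mult; simpl. ring.
    + intros x _. rewrite (RInt_ext _ (fun y => cos ((IZR k1 * x + p) + IZR k2 * y))).
      * apply RInt_cos_lin; auto.
      * intros y _. f_equal. ring.
Qed.

Lemma I2_cos_0 p : I2 (fun x y => cos (0 * x + 0 * y + p)) = 4 * PI ^ 2 * cos p.
Proof.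
  unfold I2. rewrite (RInt_ext _ (fun _ => 2 * PI * cos p)).
  - rewrite RInt_const. unfold scal; simpl; unfold mult; simpl. ring.
  - intros x _. rewrite (RInt_ext _ (fun _ => cos p)).
    + rewrite RInt_const. unfold scal; simpl; unfold mult; simpl. ring.
    + intros y _. f_equal. ring.
Qed.

(** One mode times [e + cos (x - x0)] is a combination of five: the mode [k] itself, and the cosine
    and sine of [k + 1] and of [k - 1]. This is the shape needed by [peak_annihilated]. *)
Lemma is_RInt_lin5 (f1 f2 f3 f4 f5 f : R -> R) c1 c2 c3 c4 c5 a b :
  is_RInt f1 a b 0 -> is_RInt f2 a b 0 -> is_RInt f3 a b 0 -> is_RInt f4 a b 0 ->
  is_RInt f5 a b 0 ->
  (forall x, f x = c1 * f1 x + c2 * f2 x + c3 * f3 x + c4 * f4 x + c5 * f5 x) ->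
  is_RInt f a b 0.
Proof.
  intros H1 H2 H3 H4 H5 H.
  apply (is_RInt_ext (fun x => c1 * f1 x + c2 * f2 x + c3 * f3 x + c4 * f4 x + c5 * f5 x)); auto.
  apply (is_RInt_scal _ _ _ c1) in H1. apply (is_RInt_scal _ _ _ c2) in H2.
  apply (is_RInt_scal _ _ _ c3) in H3. apply (is_RInt_scal _ _ _ c4) in H4.
  apply (is_RInt_scal _ _ _ c5) in H5.
  pose proof (is_RInt_plus _ _ _ _ _ _ (is_RInt_plus _ _ _ _ _ _ (is_RInt_plus _ _ _ _ _ _
     (is_RInt_plus _ _ _ _ _ _ H1 H2) H3) H4) H5) as HH.
  unfold scal, plus in HH; simpl in HH; unfold mult in HH; simpl in HH.
  rewrite !Rmult_0_r, !Rplus_0_r in HH. exact HH.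
Qed.

(** * Uniqueness of Fourier coefficients in one variable *)

Section Uniqueness1D.
Variable g : R -> R.
Hypothesis Hg : forall x, continuous g x.
Hypothesis Hc : forall k : Z, is_RInt (fun x => g x * cos (IZR k * x)) 0 (2 * PI) 0.
Hypothesis Hs : forall k : Z, is_RInt (fun x => g x * sin (IZR k * x)) 0 (2 * PI) 0.

(** Powers of [e + cos (x - x0)] are trigonometric polynomials, so [g] stays orthogonal to them. The
    mode [k] is carried through the induction because one more factor shifts it to [k - 1] and
    [k + 1]. *)
Lemma peak_annihilated e x0 (n : nat) : forall k : Z,
  is_RInt (fun x => g x * (e + cos (x - x0)) ^ n * cos (IZR k * x)) 0 (2 * PI) 0 /\
  is_RInt (fun x => g x * (e + cos (x - x0)) ^ n * sin (IZR k * x)) 0 (2 * PI) 0.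
Proof.
  induction n as [|n IH]; intros k.
  - split; [eapply is_RInt_ext; [|apply (Hc k)] | eapply is_RInt_ext; [|apply (Hs k)]];
      intros; simpl; ring.
  - destruct (IH k) as [A1 A2], (IH (k + 1)%Z) as [B1 B2], (IH (k - 1)%Z) as [C1 C2].
    split.
    + apply (is_RInt_lin5 _ _ _ _ _ _ e (cos x0 / 2) (cos x0 / 2) (sin x0 / 2) (- sin x0 / 2)
        _ _ A1 B1 C1 B2 C2).
      intros x. rewrite cos_minus, plus_IZR, minus_IZR.
      replace ((IZR k + 1) * x) with (IZR k * x + x) by ring.
      replace ((IZR k - 1) * x) with (IZR k * x - x) by ring.
      rewrite cos_plus, cos_minus, sin_plus, sin_minus. simpl. field.
    + apply (is_RInt_lin5 _ _ _ _ _ _ e (cos x0 / 2) (cos x0 / 2) (- sin x0 / 2) (sin x0 / 2)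
        _ _ A2 B2 C2 B1 C1).
      intros x. rewrite cos_minus, plus_IZR, minus_IZR.
      replace ((IZR k + 1) * x) with (IZR k * x + x) by ring.
      replace ((IZR k - 1) * x) with (IZR k * x - x) by ring.
      rewrite cos_plus, cos_minus, sin_plus, sin_minus. simpl. field.
Qed.

(* The trigonometric polynomial [1 - cos d + cos (x - x0)] exceeds 1 near [x0] and has modulus
   at most 1 away from it, so the integral of [g] against its powers would blow up. *)
Lemma unique1D_nonpos x0 : 0 < x0 < 2 * PI -> g x0 <= 0.
Proof.
  intros Hx0. destruct (Rle_or_lt (g x0) 0) as [|Hpos]; auto. exfalso.
  pose proof PI_RGT_0 as HPI.
  assert (Hcc : continuity_pt g x0) by (apply continuity_pt_filterlim, Hg).
  assert (Hc2 : 0 < g x0 / 2) by lra.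
  destruct (proj1 (continuity_pt_locally g x0) Hcc (mkposreal _ Hc2)) as [d0 Hd0].
  (* The radius [d] keeps [[x0 - d, x0 + d]] inside the period and inside the neighbourhood where
     [g] exceeds [g x0 / 2]; [d <= PI / 2] stays in the range where the cosine decreases. *)
  set (d := Rmin (d0 / 2) (Rmin (x0 / 2) (Rmin ((2 * PI - x0) / 2) (PI / 2)))).
  pose proof (cond_pos d0) as Hd0p.
  assert (Hd : 0 < d) by (unfold d; repeat apply Rmin_pos; lra).
  assert (Hdd : d <= d0 / 2 /\ d <= x0 / 2 /\ d <= (2 * PI - x0) / 2 /\ d <= PI / 2).
  { unfold d. repeat split.
    - apply Rmin_l.
    - eapply Rle_trans; [apply Rmin_r|apply Rmin_l].
    - eapply Rle_trans; [apply Rmin_r|eapply Rle_trans; [apply Rmin_r|apply Rmin_l]].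
    - eapply Rle_trans; [apply Rmin_r|eapply Rle_trans; [apply Rmin_r|apply Rmin_r]]. }
  destruct Hdd as (D1 & D2 & D3 & D4).
  assert (Hnear : forall x, Rabs (x - x0) <= d -> g x0 / 2 <= g x).
  { intros x Hx. assert (Hb : Rabs (g x - g x0) < g x0 / 2).
    { apply (Hd0 x). change (Rabs (x - x0) < d0). lra. }
    apply Rabs_def2 in Hb. lra. }
  destruct (continuity_ab_maj (fun x => Rabs (g x)) 0 (2 * PI)) as (xm & HM & _); [lra| |].
  { intros c _. apply continuity_pt_filterlim.
    apply (continuous_comp g Rabs); [apply Hg|apply continuous_Rabs]. }
  set (M := Rabs (g xm)) in *. assert (HM0 : 0 <= M) by apply Rabs_pos.
  set (eta := cos (d / 2) - cos d).
  assert (Heta : 0 < eta).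
  { unfold eta. assert (cos d < cos (d / 2)); [|lra]. apply cos_decreasing_1; lra. }
  assert (Hcd : 0 <= cos d < 1).
  { split; [apply cos_ge_0; lra|]. rewrite <- cos_0. apply cos_decreasing_1; lra. }
  set (T := fun x => (1 - cos d) + cos (x - x0)).
  assert (HTc : forall n x, continuous (fun x => g x * T x ^ n) x).
  { intros n x. apply (continuous_mult g (fun x => T x ^ n)); [apply Hg|].
    apply (continuous_comp T (fun z => z ^ n)).
    - apply (continuous_plus (fun _ => 1 - cos d) (fun x => cos (x - x0))); [apply continuous_const|].
      apply (continuous_comp (fun x => x - x0) cos); [|apply continuous_cos].
      apply (continuous_minus (fun x => x) (fun _ => x0)); [apply continuous_id|apply continuous_const].
    - apply continuity_pt_filterlim. apply derivable_continuous_pt. apply derivable_pt_pow. }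
  assert (Habs : forall a x, Rabs x <= a <-> - a <= x <= a).
  { intros a x; split; intros H; [apply Rabs_le_between in H; lra | apply Rabs_le_between; lra]. }
  assert (Hcosabs : forall x, cos x = cos (Rabs x)).
  { intros x. unfold Rabs. destruct (Rcase_abs x); auto. rewrite cos_neg; auto. }
  assert (HTin : forall x c, 0 <= c <= PI -> Rabs (x - x0) <= c -> cos c <= cos (x - x0)).
  { intros x c Hcp Hx. rewrite (Hcosabs (x - x0)). pose proof (Rabs_pos (x - x0)).
    apply cos_decr_1; lra. }
  assert (HTout : forall x, 0 <= x <= 2 * PI -> d <= Rabs (x - x0) -> cos (x - x0) <= cos d).
  { intros x Hx Hxd. rewrite (Hcosabs (x - x0)).
    assert (Hle : Rabs (x - x0) <= 2 * PI - d) by (apply Habs; lra).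
    destruct (Rle_or_lt (Rabs (x - x0)) PI).
    - apply cos_decr_1; lra.
    (* Beyond half a turn the distance is measured around the other side of the circle, where it is
       still at least [d]. *)
    - replace (cos (Rabs (x - x0))) with (cos (2 * PI - Rabs (x - x0))).
      + apply cos_decr_1; lra.
      + rewrite cos_minus, cos_2PI, sin_2PI. ring. }
  assert (Hlow : forall n x, 0 <= x <= 2 * PI -> - M <= g x * T x ^ n).
  { intros n x Hx. destruct (Rle_or_lt d (Rabs (x - x0))) as [Hf|Hn].
    - assert (HT1 : Rabs (T x ^ n) <= 1).
      { rewrite <- RPow_abs. rewrite <- (pow1 n). apply pow_incr. split; [apply Rabs_pos|].
        apply Habs. unfold T. pose proof (HTout x Hx Hf). pose proof (COS_bound (x - x0)). lra. }
      assert (Hgm : Rabs (g x) <= M) by (apply HM; lra).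
      assert (Hb : Rabs (g x * T x ^ n) <= M).
      { rewrite Rabs_mult. pose proof (Rabs_pos (g x)). pose proof (Rabs_pos (T x ^ n)). nra. }
      apply Habs in Hb. lra.
    - assert (0 <= g x * T x ^ n); [|lra].
      apply Rmult_le_pos; [pose proof (Hnear x ltac:(lra)); lra|].
      apply pow_le. unfold T. pose proof (HTin x d ltac:(lra) ltac:(lra)). lra. }
  assert (Hmid : forall n x, Rabs (x - x0) <= d / 2 -> g x0 / 2 * (1 + eta) ^ n <= g x * T x ^ n).
  { intros n x Hx. apply Rmult_le_compat; [lra|apply pow_le; lra|apply Hnear; lra|].
    apply pow_incr. split; [lra|]. unfold T, eta.
    pose proof (HTin x (d / 2) ltac:(lra) Hx). lra. }
  assert (Hex : forall n a b, ex_RInt (fun x => g x * T x ^ n) a b).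
  { intros n a b. apply (ex_RInt_continuous (fun x => g x * T x ^ n)). intros; apply HTc. }
  (* The whole integral vanishes, the two outer pieces contribute at least [- 2 PI M], and the
     middle one, of length [d], grows like [(1 + eta)^n]. Bernoulli's inequality reduces this to
     linear growth, already incompatible with a fixed bound. *)
  assert (Hbound : forall n : nat, d * (g x0 / 2 * (1 + INR n * eta)) <= 2 * PI * M).
  { intros n.
    assert (E0 : RInt (fun x => g x * T x ^ n) 0 (2 * PI) = 0).
    { apply is_RInt_unique. destruct (peak_annihilated (1 - cos d) x0 n 0) as [H0 _].
      eapply is_RInt_ext; [|apply H0]. intros x _. unfold T. simpl. rewrite Rmult_0_l, cos_0. ring. }
    rewrite <- (RInt_Chasles (V := R_CompleteNormedModule) _ 0 (x0 - d / 2)) in E0 by apply Hex.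
    rewrite <- (RInt_Chasles (V := R_CompleteNormedModule) _ (x0 - d / 2) (x0 + d / 2)) in E0 by apply Hex.
    unfold plus in E0; simpl in E0.
    assert (Hcst : forall a b c, a <= b -> (forall x, a < x < b -> c <= g x * T x ^ n) ->
       (b - a) * c <= RInt (fun x => g x * T x ^ n) a b).
    { intros a b c Hab Hle. replace ((b - a) * c) with (RInt (fun _ => c) a b).
      - apply RInt_le; auto. apply ex_RInt_const.
      - rewrite RInt_const. reflexivity. }
    pose proof (Hcst 0 (x0 - d / 2) (- M) ltac:(lra) ltac:(intros; apply Hlow; lra)).
    pose proof (Hcst (x0 + d / 2) (2 * PI) (- M) ltac:(lra) ltac:(intros; apply Hlow; lra)).
    pose proof (Hcst (x0 - d / 2) (x0 + d / 2) (g x0 / 2 * (1 + eta) ^ n) ltac:(lra)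
      ltac:(intros; apply Hmid; apply Habs; lra)).
    pose proof (poly n eta Heta).
    assert (g x0 / 2 * (1 + INR n * eta) <= g x0 / 2 * (1 + eta) ^ n)
      by (apply Rmult_le_compat_l; lra).
    nra. }
  destruct (INR_unbounded (2 * PI * M / (d * (g x0 / 2) * eta))) as [n Hn].
  specialize (Hbound n).
  assert (Hp : 0 < d * (g x0 / 2) * eta) by (repeat apply Rmult_lt_0_compat; lra).
  apply (Rmult_lt_compat_r _ _ _ Hp) in Hn.
  replace (2 * PI * M / (d * (g x0 / 2) * eta) * (d * (g x0 / 2) * eta)) with (2 * PI * M) in Hn
    by (field; repeat split; lra).
  nra.
Qed.

End Uniqueness1D.

Lemma unique1D g : (forall x, continuous g x) ->
  (forall k : Z, is_RInt (fun x => g x * cos (IZR k * x)) 0 (2 * PI) 0) ->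
  (forall k : Z, is_RInt (fun x => g x * sin (IZR k * x)) 0 (2 * PI) 0) ->
  forall x, 0 < x < 2 * PI -> g x = 0.
Proof.
  intros Hg Hc Hs x Hx.
  assert (g x <= 0) by (apply unique1D_nonpos; auto).
  assert (- g x <= 0).
  { apply (unique1D_nonpos (fun x => - g x)); auto.
    - intros z. apply (continuous_opp g); auto.
    - intros k. apply (is_RInt_lin5 _ _ _ _ _ _ (-1) 0 0 0 0 _ _ (Hc k) (Hc k) (Hc k) (Hc k) (Hc k)).
      intros; ring.
    - intros k. apply (is_RInt_lin5 _ _ _ _ _ _ (-1) 0 0 0 0 _ _ (Hs k) (Hs k) (Hs k) (Hs k) (Hs k)).
      intros; ring. }
  lra.
Qed.

Lemma RInt_trig_mul f x (h k : R -> R) a b : cont2 f -> (forall z, continuous k z) ->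
  RInt (fun y => f x y * (h x * k y)) a b = h x * RInt (fun y => f x y * k y) a b.
Proof.
  intros Hf Hk.
  rewrite <- (RInt_scal (V := R_CompleteNormedModule) (fun y => f x y * k y)).
  - apply RInt_ext. intros y _. unfold scal; simpl; unfold mult; simpl. ring.
  - apply (ex_RInt_continuous (fun y => f x y * k y)). intros z _.
    apply (continuous_mult (fun y => f x y) k); auto. apply cont2_y; auto.
Qed.

Lemma continuous_cos_lin m z : continuous (fun x => cos (m * x)) z.
Proof.
  apply (continuous_comp (fun x => m * x) cos); [|apply continuous_cos].
  apply (continuous_mult (fun _ => m) (fun y => y)); [apply continuous_const|apply continuous_id].
Qed.

Lemma continuous_sin_lin m z : continuous (fun x => sin (m * x)) z.
Proof.
  apply (continuous_comp (fun x => m * x) sin); [|apply continuous_sin].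
  apply (continuous_mult (fun _ => m) (fun y => y)); [apply continuous_const|apply continuous_id].
Qed.

Lemma cont2_of_y (k : R -> R) : (forall z, continuous k z) -> cont2 (fun _ y => k y).
Proof. intros H. apply (cont2_comp k (fun _ y => y)); auto. apply cont2_snd. Qed.

Lemma is_RInt_of_eq0 (f : R -> R) a b : (forall z, continuous f z) ->
  RInt f a b = 0 -> is_RInt f a b 0.
Proof.
  intros Hf E.
  assert (H : ex_RInt f a b) by (apply (ex_RInt_continuous f); auto).
  apply (RInt_correct (V := R_CompleteNormedModule)) in H. rewrite E in H. exact H.
Qed.

Lemma I2_product f (h k : R -> R) : cont2 f -> (forall z, continuous h z) ->
  (forall z, continuous k z) -> I2 (fun x y => f x y * (h x * k y)) = 0 ->
  is_RInt (fun x => RInt (fun y => f x y * k y) 0 (2 * PI) * h x) 0 (2 * PI) 0.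
Proof.
  intros Hf Hh Hk E. unfold I2 in E.
  rewrite (RInt_ext _ (fun x => RInt (fun y => f x y * k y) 0 (2 * PI) * h x)) in E.
  - apply is_RInt_of_eq0; auto.
    intros z. apply (continuous_mult (fun x => RInt (fun y => f x y * k y) 0 (2 * PI)) h); auto.
    apply (cont2_RInt (fun x y => f x y * k y)).
    apply cont2_mult; auto. apply cont2_of_y; auto.
  - intros x _. rewrite RInt_trig_mul by auto. apply Rmult_comm.
Qed.

(** Sums and differences of the modes [(k1, k2)] and [(k1, -k2)] separate the variables. For fixed
    [k2] the Fourier coefficient in [y] is a continuous function of [x] with vanishing coefficients,
    hence zero; one-dimensional uniqueness then applies once more in [y]. *)
Lemma unique2D_open f : cont2 f ->
  (forall k : Z * Z, I2 (fun x y => f x y * cos (kx k * x + ky k * y)) = 0) ->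
  (forall k : Z * Z, I2 (fun x y => f x y * sin (kx k * x + ky k * y)) = 0) ->
  forall x y, 0 < x < 2 * PI -> 0 < y < 2 * PI -> f x y = 0.
Proof.
  intros Hf HC HS.
  assert (CT : forall a b, cont2 (fun x y => f x y * cos (a * x + b * y))).
  { intros a b. apply cont2_mult; auto. intros x y.
    pose proof (cont2_cos a b 0 x y) as H. eapply continuous_ext; [|exact H].
    intros q; simpl. f_equal; ring. }
  assert (ST : forall a b, cont2 (fun x y => f x y * sin (a * x + b * y))).
  { intros a b. apply cont2_mult; auto. intros x y.
    pose proof (cont2_sin a b 0 x y) as H. eapply continuous_ext; [|exact H].
    intros q; simpl. f_equal; ring. }
  assert (Hneg : forall k1 k2 : Z, kx (k1, (- k2)%Z) = IZR k1 /\ ky (k1, (- k2)%Z) = - IZR k2).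
  { intros; unfold kx, ky; simpl. rewrite opp_IZR; auto. }
  assert (Hprod : forall (c1 c2 : R) (F G Q : R -> R -> R), I2 F = 0 -> I2 G = 0 -> cont2 F -> cont2 G ->
    (forall x y, Q x y = c1 * F x y + c2 * G x y) -> I2 Q = 0).
  { intros c1 c2 F G Q E1 E2 C1 C2 E. rewrite (I2_ext _ _ E).
    rewrite I2_plus by (apply cont2_scal; auto). rewrite !I2_scal by auto. rewrite E1, E2; ring. }
  assert (Hcc : forall k1 k2 : Z, I2 (fun x y => f x y * (cos (IZR k1 * x) * cos (IZR k2 * y))) = 0).
  { intros k1 k2. apply (Hprod (/2) (/2) _ _ _ (HC (k1, k2)) (HC (k1, (- k2)%Z)) (CT _ _) (CT _ _)).
    intros x y. destruct (Hneg k1 k2) as [-> ->]. unfold kx, ky; simpl.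
    replace (IZR k1 * x + - IZR k2 * y) with (IZR k1 * x - IZR k2 * y) by ring.
    rewrite cos_plus, cos_minus. field. }
  assert (Hss : forall k1 k2 : Z, I2 (fun x y => f x y * (sin (IZR k1 * x) * sin (IZR k2 * y))) = 0).
  { intros k1 k2. apply (Hprod (-/2) (/2) _ _ _ (HC (k1, k2)) (HC (k1, (- k2)%Z)) (CT _ _) (CT _ _)).
    intros x y. destruct (Hneg k1 k2) as [-> ->]. unfold kx, ky; simpl.
    replace (IZR k1 * x + - IZR k2 * y) with (IZR k1 * x - IZR k2 * y) by ring.
    rewrite cos_plus, cos_minus. field. }
  assert (Hsc : forall k1 k2 : Z, I2 (fun x y => f x y * (sin (IZR k1 * x) * cos (IZR k2 * y))) = 0).
  { intros k1 k2. apply (Hprod (/2) (/2) _ _ _ (HS (k1, k2)) (HS (k1, (- k2)%Z)) (ST _ _) (ST _ _)).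
    intros x y. destruct (Hneg k1 k2) as [-> ->]. unfold kx, ky; simpl.
    replace (IZR k1 * x + - IZR k2 * y) with (IZR k1 * x - IZR k2 * y) by ring.
    rewrite sin_plus, sin_minus. field. }
  assert (Hcs : forall k1 k2 : Z, I2 (fun x y => f x y * (cos (IZR k1 * x) * sin (IZR k2 * y))) = 0).
  { intros k1 k2. apply (Hprod (/2) (-/2) _ _ _ (HS (k1, k2)) (HS (k1, (- k2)%Z)) (ST _ _) (ST _ _)).
    intros x y. destruct (Hneg k1 k2) as [-> ->]. unfold kx, ky; simpl.
    replace (IZR k1 * x + - IZR k2 * y) with (IZR k1 * x - IZR k2 * y) by ring.
    rewrite sin_plus, sin_minus. field. }
  assert (Hinner : forall (k : R -> R) x, (forall z, continuous k z) -> 0 < x < 2 * PI ->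
    RInt (fun y => f x y * k y) 0 (2 * PI) = 0 -> is_RInt (fun y => f x y * k y) 0 (2 * PI) 0).
  { intros k x Hk Hx E. apply is_RInt_of_eq0; auto. intros z.
    apply (continuous_mult (fun y => f x y) k); auto. apply cont2_y; auto. }
  intros x y Hx Hy.
  apply (unique1D (fun y => f x y)); auto.
  - intros z. apply cont2_y; auto.
  - intros k2. apply Hinner; auto; [intros; apply continuous_cos_lin|].
    apply (unique1D (fun x => RInt (fun y => f x y * cos (IZR k2 * y)) 0 (2 * PI))); auto.
    + intros z. apply (cont2_RInt (fun x y => f x y * cos (IZR k2 * y))).
      apply cont2_mult; auto. apply (cont2_of_y (fun y => cos (IZR k2 * y))).
      intros; apply continuous_cos_lin.
    + intros k1. apply (I2_product f (fun x => cos (IZR k1 * x)) (fun y => cos (IZR k2 * y))); auto;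
        intros; apply continuous_cos_lin.
    + intros k1. apply (I2_product f (fun x => sin (IZR k1 * x)) (fun y => cos (IZR k2 * y))); auto;
        intros; [apply continuous_sin_lin | apply continuous_cos_lin].
  - intros k2. apply Hinner; auto; [intros; apply continuous_sin_lin|].
    apply (unique1D (fun x => RInt (fun y => f x y * sin (IZR k2 * y)) 0 (2 * PI))); auto.
    + intros z. apply (cont2_RInt (fun x y => f x y * sin (IZR k2 * y))).
      apply cont2_mult; auto. apply (cont2_of_y (fun y => sin (IZR k2 * y))).
      intros; apply continuous_sin_lin.
    + intros k1. apply (I2_product f (fun x => cos (IZR k1 * x)) (fun y => sin (IZR k2 * y))); auto;
        intros; [apply continuous_cos_lin | apply continuous_sin_lin].
    + intros k1. apply (I2_product f (fun x => sin (IZR k1 * x)) (fun y => sin (IZR k2 * y))); auto;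
        intros; apply continuous_sin_lin.
Qed.

Lemma periodic_Z (g : R -> R) : (forall x, g (x + 2 * PI) = g x) ->
  forall (z : Z) x, g (x + IZR z * (2 * PI)) = g x.
Proof.
  intros Hg.
  assert (Hn : forall (n : nat) x, g (x + INR n * (2 * PI)) = g x).
  { induction n as [|n IH]; intros x.
    - simpl. f_equal; ring.
    - rewrite S_INR. replace (x + (INR n + 1) * (2 * PI)) with (x + INR n * (2 * PI) + 2 * PI) by ring.
      rewrite Hg; auto. }
  intros z x. destruct (Z_le_gt_dec 0 z).
  - rewrite <- (Hn (Z.to_nat z) x). f_equal. rewrite INR_IZR_INZ, Z2Nat.id by auto; auto.
  - rewrite <- (Hn (Z.to_nat (- z)) (x + _)). f_equal.
    rewrite INR_IZR_INZ, Z2Nat.id by lia. rewrite opp_IZR. ring.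
Qed.

Lemma period_rep x : exists z : Z, 0 <= x + IZR z * (2 * PI) < 2 * PI.
Proof.
  pose proof two_PI_pos as HP. exists (- Int_part (x / (2 * PI)))%Z.
  destruct (base_Int_part (x / (2 * PI))) as [H1 H2]. rewrite opp_IZR.
  apply (Rmult_le_compat_r (2 * PI)) in H1; [|lra].
  apply Rgt_lt in H2.
  assert (x / (2 * PI) * (2 * PI) = x) by (field; lra).
  assert (H3 : x / (2 * PI) < IZR (Int_part (x / (2 * PI))) + 1) by lra.
  apply (Rmult_lt_compat_r (2 * PI)) in H3; [|lra]. lra.
Qed.

Theorem unique2D f : cont2 f -> periodic2 f ->
  (forall k : Z * Z, I2 (fun x y => f x y * cos (kx k * x + ky k * y)) = 0) ->
  (forall k : Z * Z, I2 (fun x y => f x y * sin (kx k * x + ky k * y)) = 0) ->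
  forall x y, f x y = 0.
Proof.
  intros Hf Hp HC HS x y.
  assert (E : forall z w : Z, f (x + IZR z * (2 * PI)) (y + IZR w * (2 * PI)) = f x y).
  { intros z w. rewrite (periodic_Z (fun x => f x _)) by (intros; apply Hp).
    apply (periodic_Z (fun y => f x y)). intros; apply Hp. }
  destruct (period_rep x) as [z Hz]. destruct (period_rep y) as [w Hw].
  rewrite <- (E z w). set (x' := x + _) in *. set (y' := y + _) in *.
  destruct (Req_dec (f x' y') 0) as [|Hn]; auto. exfalso.
  destruct (proj1 (cont2_eps f) Hf x' y' (mkposreal _ (Rabs_pos_lt _ Hn))) as [d Hd].
  simpl in Hd. pose proof (cond_pos d) as Hdp.
  (* The representative may lie on an edge [x' = 0] or [y' = 0] of the period square, so the open
     square is reached by a short diagonal step, and continuity does the rest. *)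
  set (t := Rmin (d / 2) (Rmin ((2 * PI - x') / 2) ((2 * PI - y') / 2))).
  assert (Ht : 0 < t) by (unfold t; repeat apply Rmin_pos; lra).
  assert (t <= d / 2) by apply Rmin_l.
  assert (t <= (2 * PI - x') / 2) by (eapply Rle_trans; [apply Rmin_r|apply Rmin_l]).
  assert (t <= (2 * PI - y') / 2) by (eapply Rle_trans; [apply Rmin_r|apply Rmin_r]).
  specialize (Hd (x' + t) (y' + t)).
  rewrite (unique2D_open f Hf HC HS (x' + t) (y' + t)) in Hd by lra.
  replace (0 - f x' y') with (- f x' y') in Hd by ring. rewrite Rabs_Ropp in Hd.
  replace (x' + t - x') with t in Hd by ring. replace (y' + t - y') with t in Hd by ring.
  rewrite (Rabs_pos_eq t) in Hd by lra. specialize (Hd ltac:(lra) ltac:(lra)). lra.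
Qed.

(** * Differentiated Fourier series *)

(* The [(i,j)]-th partial derivative of [a k * cos (k.x) + b k * sin (k.x)]: each derivative
   multiplies by a frequency and advances the phase by a quarter turn. *)
Definition trm (i j : nat) (a b : Z * Z -> R) (k : Z * Z) (x y : R) : R :=
  kx k ^ i * ky k ^ j *
  (a k * cos (kx k * x + ky k * y + INR (i + j) * (PI / 2))
   + b k * sin (kx k * x + ky k * y + INR (i + j) * (PI / 2))).

Definition Sij i j a b (n : nat) (x y : R) : R := sumL (box n) (fun k => trm i j a b k x y).
Definition Fij i j a b (x y : R) : R := real (Lim_seq (fun n => Sij i j a b n x y)).

(** The weight [wgt k ^ 2] dominates every monomial of degree at most 4 in the frequency, so this
    one condition gives uniform convergence of all derivatives up to the order of the
    bi-Laplacian. *)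
Definition abs_sum a b A : Prop :=
  forall n, sumL (box n) (fun k => wgt k ^ 2 * (Rabs (a k) + Rabs (b k))) <= A.

Definition inb (m : nat) (k : Z * Z) : bool :=
  ((Z.abs (fst k) <=? Z.of_nat m) && (Z.abs (snd k) <=? Z.of_nat m))%Z%bool.

Lemma inb_spec m k : inb m k = true <-> In k (box m).
Proof. unfold inb. rewrite Bool.andb_true_iff, !Z.leb_le, in_box. lia. Qed.

Lemma box_split m n f : (m <= n)%nat ->
  sumL (box n) f = sumL (box m) f + sumL (box n) (fun k => if inb m k then 0 else f k).
Proof.
  intros H.
  rewrite (sumL_ext _ f (fun k => (if inb m k then f k else 0) + (if inb m k then 0 else f k)))
    at 1 by (intros k _; destruct (inb m k); ring).
  rewrite sumL_plus. f_equal.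
  rewrite (sumL_ext (box m) f (fun k => if inb m k then f k else 0)).
  - apply sumL_support; try apply NoDup_box. intros k Hk.
    destruct (inb m k) eqn:E; [|congruence]. apply inb_spec in E. split; auto.
    intros _. eapply box_incl; eauto.
  - intros k Hk. apply inb_spec in Hk. rewrite Hk; auto.
Qed.

Lemma box_diff_le m n f g : (m <= n)%nat -> (forall k, Rabs (f k) <= g k) ->
  Rabs (sumL (box n) f - sumL (box m) f) <= sumL (box n) g - sumL (box m) g.
Proof.
  intros H Hfg. rewrite (box_split m n f H), (box_split m n g H).
  replace (_ + _ - _) with (sumL (box n) (fun k => if inb m k then 0 else f k)) by ring.
  replace (_ + _ - _) with (sumL (box n) (fun k => if inb m k then 0 else g k)) by ring.
  eapply Rle_trans; [apply sumL_abs|]. apply sumL_le. intros k _.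
  destruct (inb m k); [rewrite Rabs_R0; lra|auto].
Qed.

Lemma monomial_le_wgt i j k : (i + j <= 4)%nat -> Rabs (kx k ^ i * ky k ^ j) <= wgt k ^ 2.
Proof.
  intros H. rewrite Rabs_mult, <- !RPow_abs.
  set (x := Rabs (kx k)). set (y := Rabs (ky k)).
  assert (Hx : 0 <= x) by apply Rabs_pos. assert (Hy : 0 <= y) by apply Rabs_pos.
  (* Monomials of degree at most 4 are at most [M ^ 4] because [M >= 1], and [M ^ 2] is at most the
     weight. *)
  set (M := Rmax 1 (Rmax x y)).
  assert (M1 : 1 <= M) by apply Rmax_l.
  assert (Mx : x <= M) by (eapply Rle_trans; [apply Rmax_l|apply Rmax_r]).
  assert (My : y <= M) by (eapply Rle_trans; [apply Rmax_r|apply Rmax_r]).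
  apply Rle_trans with (M ^ 4).
  - apply Rle_trans with (M ^ (i + j)).
    + rewrite pow_add. apply Rmult_le_compat; try (apply pow_le; lra); apply pow_incr; lra.
    + apply Rle_pow; auto.
  - replace (M ^ 4) with ((M ^ 2) ^ 2) by ring. apply pow_incr. split; [apply pow2_ge_0|].
    assert (x ^ 2 = kx k ^ 2) by apply pow2_abs. assert (y ^ 2 = ky k ^ 2) by apply pow2_abs.
    unfold wgt. pose proof (pow2_ge_0 x). pose proof (pow2_ge_0 y).
    unfold M, Rmax. destruct (Rle_dec x y); destruct (Rle_dec 1 _); lra.
Qed.

Lemma Rabs_trig_le a b t : Rabs (a * cos t + b * sin t) <= Rabs a + Rabs b.
Proof.
  eapply Rle_trans; [apply Rabs_triang|]. rewrite !Rabs_mult.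
  assert (Rabs (cos t) <= 1) by (apply Rabs_le; apply COS_bound).
  assert (Rabs (sin t) <= 1) by (apply Rabs_le; apply SIN_bound).
  pose proof (Rabs_pos a); pose proof (Rabs_pos b). nra.
Qed.

Lemma trm_bound i j a b k x y : (i + j <= 4)%nat ->
  Rabs (trm i j a b k x y) <= wgt k ^ 2 * (Rabs (a k) + Rabs (b k)).
Proof.
  intros H. unfold trm. rewrite Rabs_mult.
  apply Rmult_le_compat; try apply Rabs_pos; [apply monomial_le_wgt; auto|apply Rabs_trig_le].
Qed.

(** Increments dominated by those of a bounded increasing sequence make [S] Cauchy. The error bound
    involves [P] alone; with [P] independent of the point it becomes uniform convergence. *)
Lemma dominated_limit (S P : nat -> R) A :
  (forall m n, (m <= n)%nat -> Rabs (S n - S m) <= P n - P m) -> (forall n, P n <= A) ->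
  is_lim_seq S (real (Lim_seq S)) /\
  forall n, Rabs (real (Lim_seq S) - S n) <= real (Lim_seq P) - P n.
Proof.
  intros H HA.
  assert (Hinc : forall n, P n <= P (Datatypes.S n)).
  { intros n. pose proof (H n (Datatypes.S n) ltac:(lia)).
    pose proof (Rabs_pos (S (Datatypes.S n) - S n)). lra. }
  assert (HP : is_lim_seq P (real (Lim_seq P))).
  { apply Lim_seq_correct'. apply ex_finite_lim_seq_incr with A; auto. }
  assert (HS : is_lim_seq S (real (Lim_seq S))).
  { apply Lim_seq_correct'. apply ex_lim_seq_cauchy_corr. intros eps.
    assert (HPc : ex_finite_lim_seq P) by (exists (real (Lim_seq P)); auto).
    apply ex_lim_seq_cauchy_corr in HPc. destruct (HPc eps) as [n0 Hn0].
    exists n0. intros n m Hn Hm.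
    destruct (Nat.le_ge_cases m n) as [L|L].
    - eapply Rle_lt_trans; [apply H; auto|]. eapply Rle_lt_trans; [apply Rle_abs|]. auto.
    - rewrite Rabs_minus_sym. eapply Rle_lt_trans; [apply H; auto|].
      eapply Rle_lt_trans; [apply Rle_abs|]. auto. }
  split; auto. intros n.
  assert (L1 : is_lim_seq (fun m => Rabs (S m - S n)) (Rabs (real (Lim_seq S) - S n))).
  { apply (is_lim_seq_abs (fun m => S m - S n) (Finite (real (Lim_seq S) - S n))).
    apply is_lim_seq_minus'; auto. apply is_lim_seq_const. }
  assert (L2 : is_lim_seq (fun m => P m - P n) (real (Lim_seq P) - P n)).
  { apply is_lim_seq_minus'; auto. apply is_lim_seq_const. }
  assert (L := is_lim_seq_le_loc _ _ _ _ (ex_intro _ n (fun m Hm => H n m Hm)) L1 L2).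
  exact L.
Qed.

Section Series.
Variables (a b : Z * Z -> R) (A : R).
Hypothesis HA : abs_sum a b A.

Let P n := sumL (box n) (fun k => wgt k ^ 2 * (Rabs (a k) + Rabs (b k))).

Lemma Fij_limit i j x y : (i + j <= 4)%nat ->
  is_lim_seq (fun n => Sij i j a b n x y) (Fij i j a b x y) /\
  forall n, Rabs (Fij i j a b x y - Sij i j a b n x y) <= real (Lim_seq P) - P n.
Proof.
  intros Hij. apply (dominated_limit (fun n => Sij i j a b n x y) P A); [|exact HA].
  intros m n Hmn. apply box_diff_le; auto. intros k. apply trm_bound; auto.
Qed.

Lemma Fij_uniform eps : 0 < eps -> exists n0, forall n, (n0 <= n)%nat ->
  forall i j x y, (i + j <= 4)%nat -> Rabs (Fij i j a b x y - Sij i j a b n x y) < eps.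
Proof.
  intros He.
  assert (HP : is_lim_seq P (real (Lim_seq P))).
  { apply Lim_seq_correct'. apply ex_finite_lim_seq_incr with A; [|exact HA].
    intros n. apply sumL_incl_le; [apply NoDup_box|apply box_incl; lia|].
    intros k _. apply Rmult_le_pos; [apply pow2_ge_0|].
    pose proof (Rabs_pos (a k)); pose proof (Rabs_pos (b k)); lra. }
  apply is_lim_seq_spec in HP. destruct (HP (mkposreal _ He)) as [n0 Hn0].
  exists n0. intros n Hn i j x y Hij. eapply Rle_lt_trans; [apply Fij_limit; auto|].
  specialize (Hn0 n Hn). simpl in Hn0. rewrite Rabs_minus_sym in Hn0.
  eapply Rle_lt_trans; [apply Rle_abs|]. auto.
Qed.

Lemma Sij_bound i j n x y : (i + j <= 4)%nat -> Rabs (Sij i j a b n x y) <= A.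
Proof.
  intros Hij. eapply Rle_trans; [apply sumL_abs|]. eapply Rle_trans; [|apply (HA n)].
  apply sumL_le. intros k _. apply trm_bound; auto.
Qed.

Lemma Fij_bound i j x y : (i + j <= 4)%nat -> Rabs (Fij i j a b x y) <= A.
Proof.
  intros Hij. destruct (Fij_limit i j x y Hij) as [L _].
  apply (is_lim_seq_le (fun n => Rabs (Sij i j a b n x y)) (fun _ => A)
          (Rabs (Fij i j a b x y)) A).
  - intros n. apply Sij_bound; auto.
  - apply (is_lim_seq_abs _ (Finite (Fij i j a b x y))); auto.
  - apply is_lim_seq_const.
Qed.

Lemma cont2_Sij i j n : cont2 (Sij i j a b n).
Proof.
  apply (cont2_sumL (box n) (fun k => trm i j a b k)). intros k. unfold trm.
  apply cont2_scal. apply cont2_plus; apply cont2_scal; [apply cont2_cos|apply cont2_sin].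
Qed.

Lemma cont2_Fij i j : (i + j <= 4)%nat -> cont2 (Fij i j a b).
Proof.
  intros Hij. apply cont2_eps. intros x y eps. pose proof (cond_pos eps) as He.
  destruct (Fij_uniform (eps / 3) ltac:(lra)) as [n Hn]. specialize (Hn n (le_n n) i j).
  assert (He3 : 0 < eps / 3) by lra.
  destruct (proj1 (cont2_eps _) (cont2_Sij i j n) x y (mkposreal _ He3)) as [d Hd].
  exists d. intros u v Hu Hv. specialize (Hd u v Hu Hv). simpl in Hd.
  pose proof (Hn x y Hij) as H1. pose proof (Hn u v Hij) as H2.
  apply Rabs_def2 in H1. apply Rabs_def2 in H2. apply Rabs_def2 in Hd. apply Rabs_def1; lra.
Qed.

Lemma trm_derive_x i j k x y :
  is_derive (fun z => trm i j a b k z y) x (trm (S i) j a b k x y).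
Proof.
  unfold trm. replace (INR (S i + j)) with (INR (i + j) + 1) by (rewrite <- S_INR; f_equal; lia).
  set (q := INR (i + j) * (PI / 2)).
  replace (kx k * x + ky k * y + (INR (i + j) + 1) * (PI / 2))
    with ((kx k * x + ky k * y + q) + PI / 2) by (unfold q; ring).
  rewrite (cos_plus (kx k * x + ky k * y + q)), (sin_plus (kx k * x + ky k * y + q)), cos_PI2, sin_PI2.
  auto_derive; auto. simpl. ring.
Qed.

Lemma trm_derive_y i j k x y :
  is_derive (fun z => trm i j a b k x z) y (trm i (S j) a b k x y).
Proof.
  unfold trm. replace (INR (i + S j)) with (INR (i + j) + 1) by (rewrite <- S_INR; f_equal; lia).
  set (q := INR (i + j) * (PI / 2)).
  replace (kx k * x + ky k * y + (INR (i + j) + 1) * (PI / 2))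
    with ((kx k * x + ky k * y + q) + PI / 2) by (unfold q; ring).
  rewrite (cos_plus (kx k * x + ky k * y + q)), (sin_plus (kx k * x + ky k * y + q)), cos_PI2, sin_PI2.
  auto_derive; auto. simpl. ring.
Qed.

Lemma is_derive_sumL {I} (l : list I) (f f' : I -> R -> R) x :
  (forall k, is_derive (f k) x (f' k x)) ->
  is_derive (fun z => sumL l (fun k => f k z)) x (sumL l (fun k => f' k x)).
Proof.
  intros H. induction l as [|k l IH]; simpl; [apply (is_derive_const (V := R_NormedModule))|].
  apply (is_derive_plus (V := R_NormedModule) (f k)); auto.
Qed.

Lemma Sij_derive_x i j n x y : is_derive (fun z => Sij i j a b n z y) x (Sij (S i) j a b n x y).
Proof.
  apply (is_derive_sumL (box n) (fun k z => trm i j a b k z y) (fun k z => trm (S i) j a b k z y)).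
  intros k; apply trm_derive_x.
Qed.

Lemma Sij_derive_y i j n x y : is_derive (fun z => Sij i j a b n x z) y (Sij i (S j) a b n x y).
Proof.
  apply (is_derive_sumL (box n) (fun k z => trm i j a b k x z) (fun k z => trm i (S j) a b k x z)).
  intros k; apply trm_derive_y.
Qed.

Lemma Fij_derive_x i j x y : (S i + j <= 4)%nat ->
  is_derive (fun z => Fij i j a b z y) x (Fij (S i) j a b x y).
Proof.
  intros Hij. apply is_derive_Reals.
  assert (H1 : 0 < 1) by lra.
  apply (CVU_derivable (fun n z => Sij i j a b n z y) (fun n z => Sij (S i) j a b n z y)
     (fun z => Fij i j a b z y) (fun z => Fij (S i) j a b z y) x (mkposreal 1 H1)).
  - intros eps He. destruct (Fij_uniform eps He) as [n0 Hn0]. exists n0.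
    intros n z Hn _. apply Hn0; auto.
  - intros z _. apply is_lim_seq_Reals. apply Fij_limit. lia.
  - intros n z _. apply is_derive_Reals. apply Sij_derive_x.
  - unfold Boule. simpl. rewrite Rminus_diag, Rabs_R0. lra.
Qed.

Lemma Fij_derive_y i j x y : (i + S j <= 4)%nat ->
  is_derive (fun z => Fij i j a b x z) y (Fij i (S j) a b x y).
Proof.
  intros Hij. apply is_derive_Reals.
  assert (H1 : 0 < 1) by lra.
  apply (CVU_derivable (fun n z => Sij i j a b n x z) (fun n z => Sij i (S j) a b n x z)
     (fun z => Fij i j a b x z) (fun z => Fij i (S j) a b x z) y (mkposreal 1 H1)).
  - intros eps He. destruct (Fij_uniform eps He) as [n0 Hn0]. exists n0.
    intros n z Hn _. apply Hn0; auto.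
  - intros z _. apply is_lim_seq_Reals. apply Fij_limit. lia.
  - intros n z _. apply is_derive_Reals. apply Sij_derive_y.
  - unfold Boule. simpl. rewrite Rminus_diag, Rabs_R0. lra.
Qed.

Lemma Sij_periodic i j n : periodic2 (Sij i j a b n).
Proof.
  intros x y. unfold Sij, trm. split; apply sumL_ext; intros k _.
  - replace (kx k * (x + 2 * PI) + ky k * y + INR (i + j) * (PI / 2))
      with ((kx k * x + ky k * y + INR (i + j) * (PI / 2)) + IZR (fst k) * (2 * PI))
      by (unfold kx; ring).
    rewrite cos_add_2PI_Z, sin_add_2PI_Z. auto.
  - replace (kx k * x + ky k * (y + 2 * PI) + INR (i + j) * (PI / 2))
      with ((kx k * x + ky k * y + INR (i + j) * (PI / 2)) + IZR (snd k) * (2 * PI))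
      by (unfold ky; ring).
    rewrite cos_add_2PI_Z, sin_add_2PI_Z. auto.
Qed.

Lemma Fij_periodic i j : periodic2 (Fij i j a b).
Proof.
  intros x y. unfold Fij. split; do 2 f_equal; apply functional_extensionality; intros n;
    apply Sij_periodic.
Qed.

End Series.

Lemma Fij_linear a b A a' b' A' c c' i j x y :
  abs_sum a b A -> abs_sum a' b' A' -> (i + j <= 4)%nat ->
  Fij i j (fun k => c * a k + c' * a' k) (fun k => c * b k + c' * b' k) x y
  = c * Fij i j a b x y + c' * Fij i j a' b' x y.
Proof.
  intros H H' Hij. unfold Fij at 1.
  assert (L : is_lim_seq (fun n => c * Sij i j a b n x y + c' * Sij i j a' b' n x y)
    (c * Fij i j a b x y + c' * Fij i j a' b' x y)).
  { apply is_lim_seq_plus'; apply (is_lim_seq_scal_l _ _ (Finite _)); eapply Fij_limit; eauto. }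
  erewrite Lim_seq_ext; [rewrite (is_lim_seq_unique _ _ L); reflexivity|].
  intros n. unfold Sij. rewrite <- !sumL_scal, <- sumL_plus. apply sumL_ext. intros k _.
  unfold trm. ring.
Qed.

(** * Fourier coefficients and the inversion theorem *)

Definition are (f : R -> R -> R) (k : Z * Z) : R := fcoef_re f (kx k) (ky k).
Definition bim (f : R -> R -> R) (k : Z * Z) : R := fcoef_im f (kx k) (ky k).

Lemma are_I2 f k : are f k = / (4 * PI ^ 2) * I2 (fun x y => f x y * cos (kx k * x + ky k * y)).
Proof. reflexivity. Qed.

Lemma bim_I2 f k : bim f k = / (4 * PI ^ 2) * I2 (fun x y => f x y * sin (kx k * x + ky k * y)).
Proof. reflexivity. Qed.

Lemma cont2_cos0 a b : cont2 (fun x y => cos (a * x + b * y)).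
Proof.
  intros x y. pose proof (cont2_cos a b 0 x y) as H. eapply continuous_ext; [|exact H].
  intros q; simpl. f_equal; ring.
Qed.

Lemma cont2_sin0 a b : cont2 (fun x y => sin (a * x + b * y)).
Proof.
  intros x y. pose proof (cont2_sin a b 0 x y) as H. eapply continuous_ext; [|exact H].
  intros q; simpl. f_equal; ring.
Qed.

Lemma coef_lin f g c c' k : cont2 f -> cont2 g ->
  are (fun x y => c * f x y + c' * g x y) k = c * are f k + c' * are g k /\
  bim (fun x y => c * f x y + c' * g x y) k = c * bim f k + c' * bim g k.
Proof.
  intros Hf Hg. rewrite !are_I2, !bim_I2. split.
  - rewrite (I2_ext _ (fun x y => c * (f x y * cos (kx k * x + ky k * y))
       + c' * (g x y * cos (kx k * x + ky k * y)))) by (intros; ring).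
    rewrite I2_plus, !I2_scal; [ring| | | |]; repeat apply cont2_scal;
      apply cont2_mult; auto; apply cont2_cos0.
  - rewrite (I2_ext _ (fun x y => c * (f x y * sin (kx k * x + ky k * y))
       + c' * (g x y * sin (kx k * x + ky k * y)))) by (intros; ring).
    rewrite I2_plus, !I2_scal; [ring| | | |]; repeat apply cont2_scal;
      apply cont2_mult; auto; apply cont2_sin0.
Qed.

Definition nk (k : Z * Z) : Z * Z := ((- fst k)%Z, (- snd k)%Z).
Lemma kx_nk k : kx (nk k) = - kx k.
Proof. unfold kx, nk; simpl. apply opp_IZR. Qed.
Lemma ky_nk k : ky (nk k) = - ky k.
Proof. unfold ky, nk; simpl. apply opp_IZR. Qed.

(** A real function has conjugate coefficients at opposite frequencies. Since the series runs over
    all of [Z^2], each real mode occurs twice, and this symmetry makes the two occurrences add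
    up. *)
Lemma coef_sym f k : cont2 f -> are f (nk k) = are f k /\ bim f (nk k) = - bim f k.
Proof.
  intros Hf. rewrite !are_I2, !bim_I2, kx_nk, ky_nk. split.
  - f_equal. apply I2_ext. intros x y.
    replace (- kx k * x + - ky k * y) with (- (kx k * x + ky k * y)) by ring.
    rewrite cos_neg. auto.
  - rewrite (I2_ext _ (fun x y => (-1) * (f x y * sin (kx k * x + ky k * y)))).
    + rewrite I2_scal; [ring|]. apply cont2_mult; auto; apply cont2_sin0.
    + intros x y. replace (- kx k * x + - ky k * y) with (- (kx k * x + ky k * y)) by ring.
      rewrite sin_neg. ring.
Qed.

Lemma ZZ_eq_dec (k l : Z * Z) : {k = l} + {k <> l}.
Proof. decide equality; apply Z.eq_dec. Qed.

Definition dl (k l : Z * Z) : R := if ZZ_eq_dec k l then 1 else 0.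

Lemma sumL_dl l k f : NoDup l -> In k l -> sumL l (fun x => f x * dl x k) = f k.
Proof.
  intros H1 H2. rewrite (sumL_single l k); auto.
  - unfold dl. destruct (ZZ_eq_dec k k); [ring|congruence].
  - intros y _ Hy. unfold dl. destruct (ZZ_eq_dec y k); [congruence|ring].
Qed.

(** Arbitrary phases treat cosines and sines at once. For [k = l = 0] both deltas are 1, which
    accounts for the doubled integral of a constant mode. *)
Lemma I2_pair k l p q :
  I2 (fun x y => cos (kx k * x + ky k * y + p) * cos (kx l * x + ky l * y + q))
  = 2 * PI ^ 2 * (dl k l * cos (p - q) + dl k (nk l) * cos (p + q)).
Proof.
  assert (H : forall (m : Z * Z) r, I2 (fun x y => cos (kx m * x + ky m * y + r))
     = 4 * PI ^ 2 * (dl m (0, 0)%Z * cos r)).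
  { intros m r. unfold dl. destruct (ZZ_eq_dec m (0, 0)%Z) as [->|Hm].
    - unfold kx, ky; simpl. rewrite I2_cos_0. ring.
    - rewrite I2_cos_nz by auto. ring. }
  set (m1 := ((fst k - fst l)%Z, (snd k - snd l)%Z)).
  set (m2 := ((fst k + fst l)%Z, (snd k + snd l)%Z)).
  rewrite (I2_ext _ (fun x y => / 2 * cos (kx m1 * x + ky m1 * y + (p - q))
       + / 2 * cos (kx m2 * x + ky m2 * y + (p + q)))).
  - rewrite I2_plus, !I2_scal, !H; try (repeat apply cont2_scal; apply cont2_cos).
    replace (dl m1 (0, 0)%Z) with (dl k l).
    + replace (dl m2 (0, 0)%Z) with (dl k (nk l)); [field|].
      unfold dl, m2, nk. destruct k as [k1 k2], l as [l1 l2]; simpl.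
      destruct (ZZ_eq_dec _ _) as [E1|E1]; destruct (ZZ_eq_dec _ _) as [E2|E2]; auto.
      * exfalso; apply E2. injection E1; intros; f_equal; lia.
      * exfalso; apply E1. injection E2; intros; f_equal; lia.
    + unfold dl, m1. destruct k as [k1 k2], l as [l1 l2]; simpl.
      destruct (ZZ_eq_dec _ _) as [E1|E1]; destruct (ZZ_eq_dec _ _) as [E2|E2]; auto.
      * exfalso; apply E2. injection E1; intros; f_equal; lia.
      * exfalso; apply E1. injection E2; intros; f_equal; lia.
  - intros x y. set (u := kx k * x + ky k * y + p). set (v := kx l * x + ky l * y + q).
    replace (kx m1 * x + ky m1 * y + (p - q)) with (u - v)
      by (unfold u, v, kx, ky, m1; simpl; rewrite !minus_IZR; ring).
    replace (kx m2 * x + ky m2 * y + (p + q)) with (u + v)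
      by (unfold u, v, kx, ky, m2; simpl; rewrite !plus_IZR; ring).
    rewrite cos_minus, cos_plus. field.
Qed.

Lemma in_box_nk n k : In k (box n) -> In (nk k) (box n).
Proof. rewrite !in_box. unfold nk; simpl. lia. Qed.

Lemma Sij_coef a b n l q : In l (box n) ->
  I2 (fun x y => Sij 0 0 a b n x y * cos (kx l * x + ky l * y + q))
  = 2 * PI ^ 2 * ((a l + a (nk l)) * cos q + (b (nk l) - b l) * sin q).
Proof.
  intros Hl.
  (* A sine is a cosine with phase [- PI / 2], so every term takes the form of [I2_pair]. *)
  rewrite (I2_ext _ (fun x y => sumL (box n) (fun k =>
     a k * (cos (kx k * x + ky k * y + 0) * cos (kx l * x + ky l * y + q))
   + b k * (cos (kx k * x + ky k * y + - (PI / 2)) * cos (kx l * x + ky l * y + q))))).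
  - rewrite (I2_sumL (box n) (fun k x y =>
     a k * (cos (kx k * x + ky k * y + 0) * cos (kx l * x + ky l * y + q))
   + b k * (cos (kx k * x + ky k * y + - (PI / 2)) * cos (kx l * x + ky l * y + q)))).
    + rewrite (sumL_ext _ _ (fun k => 2 * PI ^ 2 * (
        ((a k * cos q) * dl k l + (a k * cos q) * dl k (nk l)) +
        ((- b k * sin q) * dl k l + (b k * sin q) * dl k (nk l))))).
      * rewrite sumL_scal, !sumL_plus, !sumL_dl by (auto using NoDup_box, in_box_nk). ring.
      * intros k _. rewrite I2_plus, !I2_scal, !I2_pair;
          try (repeat apply cont2_scal; apply cont2_mult; apply cont2_cos).
        replace (0 - q) with (- q) by ring. rewrite Rplus_0_l, cos_neg.
        replace (- (PI / 2) - q) with (- (q + PI / 2)) by ring. rewrite cos_neg.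
        rewrite !cos_plus, sin_neg, cos_neg, cos_PI2, sin_PI2. ring.
    + intros k. apply cont2_plus; apply cont2_scal; apply cont2_mult; apply cont2_cos.
  - intros x y. unfold Sij. rewrite <- sumL_scal_r. apply sumL_ext. intros k _.
    unfold trm. simpl. rewrite <- sin_cos_shift. rewrite Rmult_0_l, !Rplus_0_r. ring.
Qed.

(** A partial sum whose box contains [l] already has the exact value, and uniform convergence passes
    it to the limit under the integral. *)
Lemma Fij_coef a b A l q : abs_sum a b A ->
  I2 (fun x y => Fij 0 0 a b x y * cos (kx l * x + ky l * y + q))
  = 2 * PI ^ 2 * ((a l + a (nk l)) * cos q + (b (nk l) - b l) * sin q).
Proof.
  intros HA. apply cond_eq. intros eps He.
  assert (HP : 0 < 4 * PI ^ 2) by (pose proof PI_RGT_0; nra).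
  destruct (Fij_uniform a b A HA (eps / (4 * PI ^ 2) / 2)) as [n0 Hn0].
  { repeat apply Rdiv_lt_0_compat; lra. }
  set (n := (n0 + Z.to_nat (Z.abs (fst l)) + Z.to_nat (Z.abs (snd l)))%nat).
  rewrite <- (Sij_coef a b n l q) by (rewrite in_box; unfold n; lia).
  set (u := I2 _). set (v := I2 _).
  replace (u - v) with (u + (-1) * v) by ring. unfold u, v. rewrite <- I2_scal, <- I2_plus.
  - eapply Rle_lt_trans; [apply (I2_bound _ (eps / (4 * PI ^ 2) / 2))|].
    + apply cont2_plus; [|apply cont2_scal]; apply cont2_mult; try apply cont2_cos.
      * eapply cont2_Fij; eauto.
      * apply cont2_Sij.
    + intros x y. replace (_ + _) with ((Fij 0 0 a b x y - Sij 0 0 a b n x y)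
         * cos (kx l * x + ky l * y + q)) by ring.
      rewrite Rabs_mult.
      assert (Rabs (cos (kx l * x + ky l * y + q)) <= 1) by (apply Rabs_le; apply COS_bound).
      pose proof (Hn0 n ltac:(unfold n; lia) 0%nat 0%nat x y ltac:(lia)).
      pose proof (Rabs_pos (cos (kx l * x + ky l * y + q))).
      pose proof (Rabs_pos (Fij 0 0 a b x y - Sij 0 0 a b n x y)). nra.
    + replace (4 * PI ^ 2 * (eps / (4 * PI ^ 2) / 2)) with (eps / 2) by (field; apply PI_neq0). lra.
  - apply cont2_mult; [eapply cont2_Fij; eauto|apply cont2_cos].
  - apply cont2_scal. apply cont2_mult; [apply cont2_Sij|apply cont2_cos].
  - apply cont2_mult; [apply cont2_Sij|apply cont2_cos].
Qed.

(** The difference between [f] and its series is continuous and periodic with vanishing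
    coefficients, so [unique2D] applies; [coef_sym] turns the [2 * PI ^ 2] of [Fij_coef] into the
    [4 * PI ^ 2] of the normalisation. *)
Theorem fourier_inversion f A : cont2 f -> periodic2 f -> abs_sum (are f) (bim f) A ->
  f = Fij 0 0 (are f) (bim f).
Proof.
  intros Hf Hp HA.
  assert (CF : cont2 (Fij 0 0 (are f) (bim f))) by (eapply cont2_Fij; eauto).
  assert (HPI : PI <> 0) by apply PI_neq0.
  assert (H : forall x y, f x y - Fij 0 0 (are f) (bim f) x y = 0).
  { apply (unique2D (fun x y => f x y - Fij 0 0 (are f) (bim f) x y)).
    - apply cont2_minus; auto.
    - intros x y. destruct (Hp x y) as [-> ->].
      destruct (Fij_periodic (are f) (bim f) 0 0 x y) as [-> ->]. auto.
    - intros k.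
      assert (K1 : cont2 (fun x y => f x y * cos (kx k * x + ky k * y)))
        by (apply cont2_mult; [auto|apply cont2_cos0]).
      assert (K2 : cont2 (fun x y => Fij 0 0 (are f) (bim f) x y * cos (kx k * x + ky k * y + 0)))
        by (apply cont2_mult; [auto|apply cont2_cos]).
      rewrite (I2_ext _ (fun x y => f x y * cos (kx k * x + ky k * y)
         + (-1) * (Fij 0 0 (are f) (bim f) x y * cos (kx k * x + ky k * y + 0)))).
      + rewrite (I2_plus _ _ K1 (cont2_scal (-1) _ K2)), (I2_scal (-1) _ K2), (Fij_coef _ _ A) by auto.
        destruct (coef_sym f k Hf) as [-> ->]. rewrite cos_0, sin_0, are_I2. field. auto.
      + intros x y. rewrite Rplus_0_r. ring.
    - intros k.
      assert (K1 : cont2 (fun x y => f x y * sin (kx k * x + ky k * y)))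
        by (apply cont2_mult; [auto|apply cont2_sin0]).
      assert (K2 : cont2 (fun x y => Fij 0 0 (are f) (bim f) x y * cos (kx k * x + ky k * y + - (PI / 2))))
        by (apply cont2_mult; [auto|apply cont2_cos]).
      rewrite (I2_ext _ (fun x y => f x y * sin (kx k * x + ky k * y)
         + (-1) * (Fij 0 0 (are f) (bim f) x y * cos (kx k * x + ky k * y + - (PI / 2))))).
      + rewrite (I2_plus _ _ K1 (cont2_scal (-1) _ K2)), (I2_scal (-1) _ K2), (Fij_coef _ _ A) by auto.
        destruct (coef_sym f k Hf) as [-> ->].
        rewrite cos_neg, sin_neg, cos_PI2, sin_PI2, bim_I2. field. auto.
      + intros x y. rewrite <- sin_cos_shift. ring. }
  apply functional_extensionality; intros x. apply functional_extensionality; intros y.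
  specialize (H x y). lra.
Qed.

(* The squared [H^{s+4}] norm of the series with coefficients [a], [b] is at most [B]. *)
Definition HB s a b B : Prop :=
  forall n, sumL (box n) (fun k => Rpower (wgt k) (s + 4) * (a k ^ 2 + b k ^ 2)) <= B.

(** Cauchy-Schwarz after splitting [wgt^2] as [wgt^(-s/2)] times [wgt^((s+4)/2)]; the sum of
    [wgt^(-s)] over [Z^2] converges because [s > 1]. This is the Sobolev embedding of [H^{s+4}] into
    functions with four bounded derivatives. *)
Lemma HB_abs_sum s : 1 < s -> exists C, 0 < C /\
  forall a b B, HB s a b B -> abs_sum a b (C * sqrt B).
Proof.
  intros Hs. destruct (box_series_bound s Hs) as (D & HD & HDn).
  exists (sqrt D * sqrt 2). split; [apply Rmult_lt_0_compat; apply sqrt_lt_R0; lra|].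
  intros a b B H n.
  rewrite (sumL_ext _ _ (fun k => Rpower (wgt k) (- (s / 2)) *
     (Rpower (wgt k) ((s + 4) / 2) * (Rabs (a k) + Rabs (b k))))).
  - eapply Rle_trans; [apply Rle_abs|]. eapply Rle_trans; [apply l2_CS|].
    rewrite Rmult_assoc, <- sqrt_mult_alt by lra.
    apply Rmult_le_compat; try apply l2_nonneg; apply sqrt_le_1_alt.
    + eapply Rle_trans; [|apply (HDn n)]. right. apply sumL_ext. intros k _.
      rewrite <- Rpower_pow by apply Rpower_pos. rewrite Rpower_mult. f_equal. simpl; field.
    + apply Rle_trans with (2 * sumL (box n) (fun k => Rpower (wgt k) (s + 4) * (a k ^ 2 + b k ^ 2))).
      * rewrite <- sumL_scal. apply sumL_le. intros k _. rewrite Rpow_mult_distr.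
        replace (Rpower (wgt k) ((s + 4) / 2) ^ 2) with (Rpower (wgt k) (s + 4)).
        -- pose proof (Rpower_pos (wgt k) (s + 4)).
           pose proof (pow2_ge_0 (Rabs (a k) - Rabs (b k))).
           rewrite <- (pow2_abs (a k)), <- (pow2_abs (b k)). nra.
        -- rewrite <- Rpower_pow by apply Rpower_pos. rewrite Rpower_mult. f_equal. simpl; field.
      * apply Rmult_le_compat_l; [lra|apply H].
  - intros k _. rewrite <- Rmult_assoc, <- Rpower_plus.
    replace (- (s / 2) + (s + 4) / 2) with (INR 2) by (simpl; field).
    rewrite Rpower_pow; auto. pose proof (wgt_ge1 k); lra.
Qed.

Lemma Hsum_sumL r f n :
  Hsum r f n = sumL (box n) (fun k => Rpower (wgt k) r * (are f k ^ 2 + bim f k ^ 2)).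
Proof.
  unfold Hsum, box, rng2. rewrite sumL_prod, sum_n_sumL. unfold rng. rewrite sumL_map.
  replace (2 * n + 1)%nat with (S (2 * n)) by lia.
  apply sumL_ext. intros m1 _. rewrite sum_n_sumL, sumL_map. apply sumL_ext. intros m2 _.
  assert (E : forall m, IZR (- Z.of_nat n + Z.of_nat m) = zidx n m).
  { intros m. rewrite plus_IZR, opp_IZR, <- !INR_IZR_INZ. unfold zidx. ring. }
  unfold wgt, are, bim, kx, ky. cbn [fst snd]. rewrite !E. reflexivity.
Qed.

(** * Aliasing on the grid *)

Lemma sumL_CS_pair {K} (Q : list K) (a b c d : K -> R) :
  (sumL Q (fun k => a k * c k + b k * d k)) ^ 2 <=
  sumL Q (fun k => a k ^ 2 + b k ^ 2) * sumL Q (fun k => c k ^ 2 + d k ^ 2).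
Proof.
  pose (f := fun k : K + K => match k with inl k => a k | inr k => b k end).
  pose (g := fun k : K + K => match k with inl k => c k | inr k => d k end).
  pose proof (sumL_CS (map inl Q ++ map inr Q) f g) as H.
  rewrite !sumL_app, !sumL_map in H. simpl in H. rewrite !sumL_plus. exact H.
Qed.

Section TrigKernel.
Context {I K : Type} (P : list I) (Q : list K) (th : K -> I -> R) (c : R).
Hypothesis Hker : forall (V : I -> R) j, In j P ->
  sumL P (fun j' => V j' * sumL Q (fun k => cos (th k j - th k j'))) = c * V j.

(** [Hker] says that the Dirichlet kernel of the frequencies [Q] acts on the points [P] as [c] times
    the identity. Parseval, inversion and synthesis follow from this alone, so the same proofs serve
    one line of the grid and the whole grid. *)
Definition Cc (q : R) (U : I -> R) (k : K) : R := sumL P (fun j => U j * cos (th k j + q)).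
Definition Sc (q : R) (U : I -> R) (k : K) : R := sumL P (fun j => U j * sin (th k j + q)).

(** Expanding the squares leaves only differences of angles, so the phase [q] drops out and the
    kernel appears. *)
Lemma trig_parseval q U :
  sumL Q (fun k => Cc q U k ^ 2 + Sc q U k ^ 2) = c * sumL P (fun j => U j ^ 2).
Proof.
  rewrite (sumL_ext Q _ (fun k => sumL P (fun j => sumL P (fun j' =>
     U j * (U j' * cos (th k j - th k j')))))).
  - rewrite sumL_swap.
    rewrite (sumL_ext P _ (fun j => c * U j ^ 2)); [apply sumL_scal|].
    intros j Hj. rewrite sumL_swap.
    rewrite (sumL_ext P _ (fun j' => U j * (U j' * sumL Q (fun k => cos (th k j - th k j'))))).
    + rewrite sumL_scal, Hker by auto. ring.
    + intros j' _. rewrite !sumL_scal. auto.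
  - intros k _. unfold Cc, Sc. simpl. rewrite !Rmult_1_r.
    rewrite <- !sumL_scal_r, <- sumL_plus. apply sumL_ext. intros j _.
    rewrite <- !sumL_scal, <- sumL_plus. apply sumL_ext. intros j' _.
    replace (th k j - th k j') with ((th k j + q) - (th k j' + q)) by ring.
    rewrite cos_minus. ring.
Qed.

Lemma trig_inversion U j : In j P ->
  c * U j = sumL Q (fun k => Cc 0 U k * cos (th k j) + Sc 0 U k * sin (th k j)).
Proof.
  intros Hj. rewrite <- Hker by auto.
  rewrite (sumL_ext P _ (fun j' => sumL Q (fun k => U j' * cos (th k j - th k j'))))
    by (intros; rewrite sumL_scal; auto).
  rewrite sumL_swap. apply sumL_ext. intros k _. unfold Cc, Sc.
  rewrite <- !sumL_scal_r, <- sumL_plus. apply sumL_ext. intros j' _.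
  rewrite cos_minus, !Rplus_0_r. ring.
Qed.

(** Duality with Parseval: the squared norm [X] of the synthesised function is the pairing of the
    amplitudes with its own coefficients, so [X^2 <= Y * c * X]. Only an inequality can hold, since
    the cosines and sines of [Q] need not be independent on [P]. *)
Lemma trig_synthesis q (a b : K -> R) : 0 <= c ->
  sumL P (fun j => (sumL Q (fun k => a k * cos (th k j + q) + b k * sin (th k j + q))) ^ 2)
  <= c * sumL Q (fun k => a k ^ 2 + b k ^ 2).
Proof.
  intros Hc.
  set (g := fun j => sumL Q (fun k => a k * cos (th k j + q) + b k * sin (th k j + q))).
  assert (E : sumL P (fun j => g j ^ 2) = sumL Q (fun k => a k * Cc q g k + b k * Sc q g k)).
  { rewrite (sumL_ext P _ (fun j => sumL Q (fun k =>
       g j * (a k * cos (th k j + q) + b k * sin (th k j + q))))).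
    - rewrite sumL_swap. apply sumL_ext. intros k _. unfold Cc, Sc.
      rewrite <- !sumL_scal, <- sumL_plus. apply sumL_ext. intros; ring.
    - intros j _. rewrite sumL_scal. unfold g. ring. }
  pose proof (sumL_CS_pair Q a b (Cc q g) (Sc q g)) as H.
  rewrite <- E, trig_parseval in H.
  set (X := sumL P (fun j => g j ^ 2)) in *.
  assert (0 <= X) by (apply sumL_nonneg; intros; apply pow2_ge_0).
  set (Y := sumL Q (fun k => a k ^ 2 + b k ^ 2)) in *.
  assert (0 <= Y).
  { apply sumL_nonneg; intros. pose proof (pow2_ge_0 (a x)); pose proof (pow2_ge_0 (b x)); lra. }
  change (X <= c * Y).
  destruct (Req_dec X 0) as [->|Hn]; [apply Rmult_le_pos; auto|].
  apply (Rmult_le_reg_r X); [lra|]. nra.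
Qed.

End TrigKernel.

(** * Orthogonality of the modes on the grid *)

Definition G (N : nat) : list (nat * nat) := list_prod (seq 0 N) (seq 0 N).

Lemma in_G N j : In j (G N) <-> (fst j < N /\ snd j < N)%nat.
Proof. destruct j as [j1 j2]. unfold G. rewrite in_prod_iff, !in_seq. simpl. lia. Qed.

(** The root mean square over the grid, normalised so that a function bounded by [c] has norm at
    most [c]; [hnorm] is [2 PI] times it. *)
Definition hn (N : nat) (U : grid) : R := / INR N * l2 (G N) (fun j => U (fst j) (snd j)).

Lemma cos_sum_telescope p al n :
  2 * sin (al / 2) * sumL (seq 0 n) (fun i => cos (p + INR i * al))
  = sin (p + (INR n - / 2) * al) - sin (p - al / 2).
Proof.
  induction n as [|n IH].
  - simpl. replace (p + (0 - / 2) * al) with (p - al / 2) by field. ring.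
  - rewrite seq_S, sumL_app, Rmult_plus_distr_l, IH, S_INR. simpl.
    replace (p + (INR n + 1 - / 2) * al) with ((p + INR n * al) + al / 2) by field.
    replace (p + (INR n - / 2) * al) with ((p + INR n * al) - al / 2) by field.
    rewrite sin_plus, sin_minus. ring.
Qed.

Lemma cos_sum_orth N p (d : Z) : (0 < N)%nat -> ~ (Z.of_nat N | d)%Z ->
  sumL (seq 0 N) (fun i => cos (p + INR i * (IZR d * hstep N))) = 0.
Proof.
  intros HN Hd. assert (HNr : 0 < INR N) by (apply lt_0_INR; auto).
  pose proof PI_RGT_0 as HPI.
  pose proof (cos_sum_telescope p (IZR d * hstep N) N) as H.
  (* [N] steps make up one period, so the two boundary terms of the telescoped sum coincide. *)
  replace (p + (INR N - / 2) * (IZR d * hstep N))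
    with ((p - IZR d * hstep N / 2) + IZR d * (2 * PI)) in H
    by (unfold hstep; field; lra).
  rewrite sin_add_2PI_Z, Rminus_diag in H.
  apply Rmult_integral in H. destruct H as [H|]; auto. exfalso.
  apply Rmult_integral in H. destruct H as [|H]; [lra|].
  apply sin_eq_0_0 in H. destruct H as [k Hk]. apply Hd. exists k.
  apply eq_IZR. rewrite mult_IZR, <- INR_IZR_INZ.
  unfold hstep in Hk. apply (Rmult_eq_reg_r PI); [|lra].
  replace (IZR k * INR N * PI) with (IZR k * PI * INR N) by ring. rewrite <- Hk. field. lra.
Qed.

Lemma cos_sum_aligned N p (d : Z) : (0 < N)%nat -> (Z.of_nat N | d)%Z ->
  sumL (seq 0 N) (fun i => cos (p + INR i * (IZR d * hstep N))) = INR N * cos p.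
Proof.
  intros HN [e ->]. assert (HNr : 0 < INR N) by (apply lt_0_INR; auto).
  rewrite (sumL_ext _ _ (fun _ => cos p)).
  - rewrite sumL_const, length_seq. auto.
  - intros i _.
    replace (p + INR i * (IZR (e * Z.of_nat N) * hstep N))
      with (p + IZR (Z.of_nat i * e) * (2 * PI)); [apply cos_add_2PI_Z|].
    rewrite !mult_IZR, <- !INR_IZR_INZ. unfold hstep. field. lra.
Qed.

Lemma rng_sum_cos N z p (d : Z) :
  sumL (rng z N) (fun k => cos (p + IZR k * (IZR d * hstep N)))
  = sumL (seq 0 N) (fun i => cos ((p + IZR z * (IZR d * hstep N)) + INR i * (IZR d * hstep N))).
Proof.
  unfold rng. rewrite sumL_map. apply sumL_ext. intros i _. f_equal.
  rewrite plus_IZR, <- INR_IZR_INZ. ring.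
Qed.

Lemma dirichlet N z p (i j : nat) : (0 < N)%nat -> (i < N)%nat -> (j < N)%nat ->
  sumL (rng z N) (fun k => cos (p + IZR k * (xg N i - xg N j)))
  = if Nat.eqb i j then INR N * cos p else 0.
Proof.
  intros HN Hi Hj. set (d := (Z.of_nat i - Z.of_nat j)%Z).
  assert (E : xg N i - xg N j = IZR d * hstep N).
  { unfold xg, d. rewrite minus_IZR, <- !INR_IZR_INZ. ring. }
  rewrite E, rng_sum_cos. destruct (Nat.eqb_spec i j) as [->|Hn].
  - unfold d. rewrite Z.sub_diag, cos_sum_aligned by (auto; exists 0%Z; auto).
    f_equal. f_equal. ring.
  - apply cos_sum_orth; auto. intros [e He]. unfold d in He.
    destruct (Z.eq_dec e 0) as [->|]; [lia|]. nia.
Qed.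

Lemma ker1 N z : (0 < N)%nat -> forall (V : nat -> R) j, In j (seq 0 N) ->
  sumL (seq 0 N) (fun j' => V j' * sumL (rng z N) (fun k => cos (IZR k * xg N j - IZR k * xg N j')))
  = INR N * V j.
Proof.
  intros HN V j Hj.
  rewrite (sumL_single (seq 0 N) j); auto using seq_NoDup.
  - apply in_seq in Hj.
    rewrite (sumL_ext _ _ (fun k => cos (0 + IZR k * (xg N j - xg N j))))
      by (intros; f_equal; ring).
    rewrite dirichlet by lia. rewrite Nat.eqb_refl, cos_0. ring.
  - intros y Hy Hn. apply in_seq in Hj. apply in_seq in Hy.
    rewrite (sumL_ext _ _ (fun k => cos (0 + IZR k * (xg N j - xg N y))))
      by (intros; f_equal; ring).
    rewrite dirichlet by lia. destruct (Nat.eqb_spec j y); [congruence|ring].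
Qed.

Definition th2 (N : nat) (k : Z * Z) (j : nat * nat) : R :=
  kx k * xg N (fst j) + ky k * xg N (snd j).

(** The corner [(z, w)] of the frequency window is arbitrary, so the identity serves the centred
    window of the discrete transform as well as every aliasing block. *)
Lemma ker2 N z w : (0 < N)%nat -> forall (V : nat * nat -> R) j, In j (G N) ->
  sumL (G N) (fun j' => V j' * sumL (rng2 z w N) (fun k => cos (th2 N k j - th2 N k j')))
  = INR N ^ 2 * V j.
Proof.
  intros HN V [j1 j2] Hj. apply in_G in Hj; simpl in Hj.
  assert (E : forall i1 i2, (i1 < N)%nat -> (i2 < N)%nat ->
    sumL (rng2 z w N) (fun k => cos (th2 N k (j1, j2) - th2 N k (i1, i2)))
    = if Nat.eqb j1 i1 then (if Nat.eqb j2 i2 then INR N ^ 2 else 0) else 0).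
  { intros i1 i2 H1 H2. unfold rng2. rewrite sumL_prod.
    rewrite (sumL_ext _ _ (fun k1 => (if Nat.eqb j2 i2 then INR N else 0) *
       cos (0 + IZR k1 * (xg N j1 - xg N i1)))).
    - rewrite sumL_scal, dirichlet by lia. rewrite cos_0.
      destruct (Nat.eqb j1 i1), (Nat.eqb j2 i2); ring.
    - intros k1 _. unfold th2, kx, ky; simpl.
      rewrite (sumL_ext _ _ (fun k2 => cos ((0 + IZR k1 * (xg N j1 - xg N i1))
         + IZR k2 * (xg N j2 - xg N i2)))) by (intros; f_equal; ring).
      rewrite dirichlet by lia. destruct (Nat.eqb j2 i2); ring. }
  rewrite (sumL_single (G N) (j1, j2)).
  - rewrite E, !Nat.eqb_refl by lia. ring.
  - apply NoDup_list_prod; apply seq_NoDup.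
  - apply in_G; auto.
  - intros [i1 i2] Hi Hn. apply in_G in Hi; simpl in Hi. rewrite E by lia.
    destruct (Nat.eqb_spec j1 i1), (Nat.eqb_spec j2 i2); subst; try ring. congruence.
Qed.

(** * Tiling the frequencies by blocks of side [N] *)

Lemma sumL_flat_map {A B} (b : A -> list B) l (f : B -> R) :
  sumL (flat_map b l) f = sumL l (fun x => sumL (b x) f).
Proof. induction l as [|x l IH]; simpl; auto. rewrite sumL_app, IH; auto. Qed.

Lemma NoDup_flat_map {A B} (b : A -> list B) l : NoDup l -> (forall x, NoDup (b x)) ->
  (forall x y k, In k (b x) -> In k (b y) -> x = y) -> NoDup (flat_map b l).
Proof.
  intros Hl Hb Hd. induction Hl as [|x l Hx Hl IH]; simpl; [constructor|].
  apply NoDup_app; auto. intros k H1 H2. apply in_flat_map in H2.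
  destruct H2 as (y & Hy & Hk). rewrite (Hd x y k) in Hx; auto.
Qed.

(** Half-open blocks centred at [2 m M] tile [Z^2], and each contains exactly one representative of
    every class of frequencies modulo [N = 2 m]. *)
Definition blk (m : nat) (M : Z * Z) : list (Z * Z) :=
  rng2 (fst M * Z.of_nat (2 * m) - Z.of_nat m) (snd M * Z.of_nat (2 * m) - Z.of_nat m) (2 * m).

Lemma blk_disjoint m M M' k : In k (blk m M) -> In k (blk m M') -> M = M'.
Proof.
  unfold blk. rewrite !in_rng2. destruct M, M'; simpl. intros. f_equal; nia.
Qed.

Lemma blk_cover m n k : (1 <= m)%nat -> In k (box n) -> exists M, In M (box n) /\ In k (blk m M).
Proof.
  intros Hm Hk. apply in_box in Hk. destruct k as [k1 k2]; simpl in Hk.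
  assert (H : forall z, (- Z.of_nat n <= z <= Z.of_nat n)%Z -> exists M,
     (- Z.of_nat n <= M <= Z.of_nat n)%Z /\
     (M * Z.of_nat (2 * m) - Z.of_nat m <= z < M * Z.of_nat (2 * m) - Z.of_nat m + Z.of_nat (2 * m))%Z).
  { intros z Hz. exists ((z + Z.of_nat m) / Z.of_nat (2 * m))%Z.
    pose proof (Z.div_mod (z + Z.of_nat m) (Z.of_nat (2 * m)) ltac:(lia)).
    pose proof (Z.mod_pos_bound (z + Z.of_nat m) (Z.of_nat (2 * m)) ltac:(lia)).
    set (M := ((z + Z.of_nat m) / Z.of_nat (2 * m))%Z) in *.
    set (r := ((z + Z.of_nat m) mod Z.of_nat (2 * m))%Z) in *. nia. }
  destruct (H k1) as (M1 & A1 & B1); [tauto|]. destruct (H k2) as (M2 & A2 & B2); [tauto|].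
  exists (M1, M2). unfold blk. rewrite in_box, in_rng2. simpl fst; simpl snd. tauto.
Qed.

(** The blocks indexed by [box n] cover [box n] but stick out of it; the indicator [inb n] restores
    the exact sum. *)
Lemma blk_sum m n f : (1 <= m)%nat ->
  sumL (box n) f =
  sumL (box n) (fun M => sumL (blk m M) (fun k => if inb n k then f k else 0)).
Proof.
  intros Hm. rewrite <- sumL_flat_map.
  rewrite (sumL_ext (box n) f (fun k => if inb n k then f k else 0)).
  - apply sumL_support.
    + apply NoDup_box.
    + apply NoDup_flat_map; [apply NoDup_box|intros; apply NoDup_rng2|apply blk_disjoint].
    + intros k Hk. destruct (inb n k) eqn:E; [|congruence]. apply inb_spec in E.
      split; auto. intros _. apply in_flat_map. apply blk_cover; auto.
  - intros k Hk. apply inb_spec in Hk. rewrite Hk. auto.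
Qed.

(** In block [M] each coordinate of [k] is in modulus at least [m] times that of [M], which controls
    the growing part of [wgt M]. The constant part needs [k] to be large even in the central block;
    this comes from [k] lying outside [box K] with [K + 1 >= m / (p + 1)], hence the factor
    [INR (p + 1) ^ 2]. *)
Lemma blk_wgt p m K M k : (1 <= m)%nat -> (m <= (p + 1) * (K + 1))%nat ->
  In k (blk m M) -> inb K k = false ->
  / (8 * INR (p + 1) ^ 2) * INR (2 * m) ^ 2 * wgt M <= wgt k.
Proof.
  intros Hm HK Hk Hout. unfold blk in Hk. rewrite in_rng2 in Hk.
  destruct k as [k1 k2], M as [M1 M2]. unfold inb in Hout. cbn [fst snd] in *.
  assert (Hlow : forall z Mz, (Mz * Z.of_nat (2 * m) - Z.of_nat m <= z <
      Mz * Z.of_nat (2 * m) - Z.of_nat m + Z.of_nat (2 * m))%Z ->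
      (Z.of_nat m * Z.of_nat m * (Mz * Mz) <= z * z)%Z).
  { intros z Mz Hz. assert (Z.of_nat m * Z.abs Mz <= Z.abs z)%Z.
    { destruct (Z_lt_le_dec Mz 0); [|destruct (Z.eq_dec Mz 0) as [->|]]; nia. }
    rewrite <- (Z.abs_square z), <- (Z.abs_square Mz). nia. }
  pose proof (Hlow k1 M1 ltac:(lia)) as H1. pose proof (Hlow k2 M2 ltac:(lia)) as H2.
  assert (H3 : (Z.of_nat m * Z.of_nat m <=
     Z.of_nat (p + 1) * Z.of_nat (p + 1) * (k1 * k1 + k2 * k2))%Z).
  { assert (Hz : (Z.of_nat K + 1 <= Z.abs k1 \/ Z.of_nat K + 1 <= Z.abs k2)%Z).
    { apply Bool.andb_false_iff in Hout. rewrite !Z.leb_gt in Hout. lia. }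
    assert (Hq : (Z.of_nat m <= Z.of_nat (p + 1) * (Z.of_nat K + 1))%Z) by lia.
    assert (Hs : ((Z.of_nat K + 1) * (Z.of_nat K + 1) <= k1 * k1 + k2 * k2)%Z).
    { rewrite <- (Z.abs_square k1), <- (Z.abs_square k2). destruct Hz; nia. }
    clear H1 H2.
    set (P := Z.of_nat (p + 1)) in *. set (L := (Z.of_nat K + 1)%Z) in *.
    assert (0 <= P)%Z by lia. assert (0 <= L)%Z by lia.
    apply Z.le_trans with ((P * L) * (P * L))%Z; [nia|].
    replace (P * L * (P * L))%Z with (P * P * (L * L))%Z by ring.
    apply Z.mul_le_mono_nonneg_l; nia. }
  apply IZR_le in H1, H2, H3.
  repeat rewrite mult_IZR in H1; repeat rewrite mult_IZR in H2.
  rewrite !mult_IZR, plus_IZR, !mult_IZR in H3.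
  repeat rewrite <- INR_IZR_INZ in *.
  unfold wgt, kx, ky; simpl fst; simpl snd.
  set (P := INR (p + 1)) in *.
  assert (HP : 1 <= P) by (unfold P; apply (le_INR 1); lia).
  rewrite mult_INR. simpl (INR 2). set (mr := INR m) in *.
  assert (HPP : 1 <= P * P) by nra.
  assert (HS : 0 <= IZR M1 * IZR M1 + IZR M2 * IZR M2) by nra.
  assert (H4 : mr * mr * (IZR M1 * IZR M1 + IZR M2 * IZR M2) <= P * P * (IZR k1 * IZR k1 + IZR k2 * IZR k2)).
  { assert (Hk0 : 0 <= IZR k1 * IZR k1 + IZR k2 * IZR k2) by nra.
    pose proof (Rmult_le_compat_r _ _ _ Hk0 HPP). lra. }
  apply (Rmult_le_reg_l (8 * P ^ 2)); [nra|].
  replace (8 * P ^ 2 * (/ (8 * P ^ 2) * ((1 + 1) * mr) ^ 2 * (1 + IZR M1 ^ 2 + IZR M2 ^ 2)))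
    with (4 * (mr * mr) + 4 * (mr * mr * (IZR M1 * IZR M1 + IZR M2 * IZR M2))) by (field; lra).
  replace (8 * P ^ 2 * (1 + IZR k1 ^ 2 + IZR k2 ^ 2)) with
    (8 * (P * P) + 8 * (P * P * (IZR k1 * IZR k1 + IZR k2 * IZR k2))) by ring.
  lra.
Qed.

Lemma hn_of_sqr N U c : (0 < N)%nat -> 0 <= c ->
  sumL (G N) (fun j => U (fst j) (snd j) ^ 2) <= (INR N * c) ^ 2 -> hn N U <= c.
Proof.
  intros HN Hc H. assert (HNr : 0 < INR N) by (apply lt_0_INR; auto).
  unfold hn. apply (Rmult_le_reg_l (INR N)); auto.
  rewrite <- Rmult_assoc, Rinv_r, Rmult_1_l by lra. apply l2_le_of_sqr; auto.
  apply Rmult_le_pos; lra.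
Qed.

(** On block [M] the weights are at least [c0 * N^2 * wgt M], so up to a constant its grid norm is
    at most [N^-sg * wgt(M)^(-sg/2)] times the root of its weighted energy. Cauchy-Schwarz over the
    blocks leaves the total energy and the sum of [wgt(M)^(-sg)], finite for [sg > 1]. General
    amplitudes and a phase cover all derivatives at once. *)
Lemma tail_finite sg p : 1 < sg -> exists C, 0 < C /\
  forall (m K n : nat) (al be : Z * Z -> R) (q B : R),
  (1 <= m)%nat -> (m <= (p + 1) * (K + 1))%nat ->
  sumL (box n) (fun k => Rpower (wgt k) sg * (al k ^ 2 + be k ^ 2)) <= B ->
  hn (2 * m) (fun j1 j2 => sumL (box n) (fun k => if inb K k then 0 else
     al k * cos (th2 (2 * m) k (j1, j2) + q) + be k * sin (th2 (2 * m) k (j1, j2) + q)))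
  <= C * sqrt B * Rpower (INR (2 * m)) (- sg).
Proof.
  intros Hsg. destruct (box_series_bound sg Hsg) as (D & HD & HDn).
  set (c0 := / (8 * INR (p + 1) ^ 2)).
  assert (HP : 0 < INR (p + 1)) by (apply lt_0_INR; lia).
  assert (Hc0 : 0 < c0) by (unfold c0; apply Rinv_0_lt_compat; nra).
  exists (Rpower c0 (- (sg / 2)) * sqrt D).
  split; [apply Rmult_lt_0_compat; [apply Rpower_pos|apply sqrt_lt_R0; auto]|].
  intros m K n al be q B Hm HK HB. set (N := (2 * m)%nat).
  assert (HN : 0 < INR N) by (apply lt_0_INR; unfold N; lia).
  (* Amplitudes cut off outside [box n] and inside [box K], so that whole blocks can be summed. *)
  set (al' := fun k => if inb n k then if inb K k then 0 else al k else 0).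
  set (be' := fun k => if inb n k then if inb K k then 0 else be k else 0).
  unfold hn.
  rewrite (Rmult_comm _ (Rpower (INR N) (- sg))).
  apply (Rmult_le_reg_l (INR N)); auto. rewrite <- Rmult_assoc, Rinv_r, Rmult_1_l by lra.
  eapply Rle_trans.
  { apply l2_le with (g := fun j => sumL (box n) (fun M => sumL (blk m M) (fun k =>
      al' k * cos (th2 N k j + q) + be' k * sin (th2 N k j + q)))).
    intros [j1 j2] _. simpl fst; simpl snd. rewrite (blk_sum m n) by auto. right. f_equal.
    apply sumL_ext. intros M _. apply sumL_ext. intros k _. unfold al', be', N.
    destruct (inb n k), (inb K k); ring. }
  eapply Rle_trans; [apply l2_sum|].
  (* The share of block [M] in the weighted energy; the shares add up to at most [B]. *)
  set (bM := fun M => sumL (blk m M) (fun k => Rpower (wgt k) sg * (al' k ^ 2 + be' k ^ 2))).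
  assert (HbM : forall M, 0 <= bM M).
  { intros M. apply sumL_nonneg. intros k _. apply Rmult_le_pos; [left; apply Rpower_pos|].
    pose proof (pow2_ge_0 (al' k)); pose proof (pow2_ge_0 (be' k)); lra. }
  assert (Hblk : forall M, l2 (G N) (fun j => sumL (blk m M) (fun k =>
      al' k * cos (th2 N k j + q) + be' k * sin (th2 N k j + q)))
      <= INR N * Rpower (c0 * INR N ^ 2) (- (sg / 2)) * (Rpower (wgt M) (- (sg / 2)) * sqrt (bM M))).
  { intros M. pose proof (wgt_ge1 M) as HwM.
    assert (HcN : 0 < c0 * INR N ^ 2) by (apply Rmult_lt_0_compat; [auto|nra]).
    apply l2_le_of_sqr.
    - repeat apply Rmult_le_pos; try (left; apply Rpower_pos); [lra|apply sqrt_pos].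
    - eapply Rle_trans.
      { apply (trig_synthesis (G N) (blk m M) (th2 N) (INR N ^ 2)).
        - apply ker2. unfold N; lia.
        - nra. }
      replace ((INR N * Rpower (c0 * INR N ^ 2) (- (sg / 2)) * (Rpower (wgt M) (- (sg / 2)) * sqrt (bM M))) ^ 2)
        with (INR N ^ 2 * ((Rpower (c0 * INR N ^ 2) (- (sg / 2)) * Rpower (wgt M) (- (sg / 2))) ^ 2 * (sqrt (bM M)) ^ 2))
        by ring.
      apply Rmult_le_compat_l; [nra|].
      rewrite Rpower_mult_distr by lra. rewrite pow2_sqrt by auto.
      rewrite <- Rpower_pow by apply Rpower_pos. rewrite Rpower_mult.
      replace (- (sg / 2) * INR 2) with (- sg) by (simpl; field).
      unfold bM. rewrite <- sumL_scal. apply sumL_le. intros k Hk.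
      assert (Hsq : 0 <= al' k ^ 2 + be' k ^ 2)
        by (pose proof (pow2_ge_0 (al' k)); pose proof (pow2_ge_0 (be' k)); lra).
      destruct (inb K k) eqn:EK.
      { unfold al', be'. rewrite EK. destruct (inb n k); right; ring. }
      rewrite <- Rmult_assoc. rewrite <- (Rmult_1_l (al' k ^ 2 + be' k ^ 2)) at 1.
      apply Rmult_le_compat_r; auto.
      pose proof (blk_wgt p m K M k Hm HK Hk EK) as Hw. fold c0 N in Hw.
      pose proof (wgt_ge1 k).
      apply Rle_trans with (Rpower (wgt k) (- sg) * Rpower (wgt k) sg).
      + rewrite <- Rpower_plus. replace (- sg + sg) with 0 by ring. rewrite Rpower_O by lra. lra.
      + apply Rmult_le_compat_r; [left; apply Rpower_pos|].
        apply Rpower_neg_anti; [|auto|lra]. apply Rmult_lt_0_compat; lra. }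
  eapply Rle_trans; [apply sumL_le; intros M _; apply Hblk|].
  rewrite sumL_scal.
  assert (HSB : sumL (box n) bM <= B).
  { eapply Rle_trans; [|apply HB].
    rewrite (blk_sum m n (fun k => Rpower (wgt k) sg * (al k ^ 2 + be k ^ 2))) by auto. apply sumL_le. intros M _.
    apply sumL_le. intros k _. unfold al', be'.
    assert (0 <= Rpower (wgt k) sg * (al k ^ 2 + be k ^ 2)).
    { apply Rmult_le_pos; [left; apply Rpower_pos|].
      pose proof (pow2_ge_0 (al k)); pose proof (pow2_ge_0 (be k)); lra. }
    destruct (inb n k), (inb K k); lra. }
  assert (HCS : sumL (box n) (fun M => Rpower (wgt M) (- (sg / 2)) * sqrt (bM M)) <= sqrt D * sqrt B).
  { eapply Rle_trans; [apply Rle_abs|]. eapply Rle_trans; [apply l2_CS|].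
    apply Rmult_le_compat; try apply l2_nonneg; apply sqrt_le_1_alt.
    - eapply Rle_trans; [|apply (HDn n)]. right. apply sumL_ext. intros k _.
      rewrite <- Rpower_pow by apply Rpower_pos. rewrite Rpower_mult. f_equal. simpl; field.
    - eapply Rle_trans; [|apply HSB]. right. apply sumL_ext. intros M _. apply pow2_sqrt; auto. }
  replace (Rpower (c0 * INR N ^ 2) (- (sg / 2))) with (Rpower c0 (- (sg / 2)) * Rpower (INR N) (- sg)).
  - pose proof (Rpower_pos c0 (- (sg / 2))). pose proof (Rpower_pos (INR N) (- sg)).
    apply Rle_trans with (INR N * (Rpower c0 (- (sg / 2)) * Rpower (INR N) (- sg)) * (sqrt D * sqrt B)).
    + apply Rmult_le_compat_l; auto. repeat apply Rmult_le_pos; lra.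
    + right; ring.
  - rewrite <- Rpower_mult_distr by nra. f_equal.
    rewrite <- Rpower_pow by auto. rewrite Rpower_mult. f_equal. simpl; field.
Qed.

Lemma hn_lim N (U : nat -> grid) (V : grid) c (n0 : nat) : (0 < N)%nat -> 0 <= c ->
  (forall j1 j2, is_lim_seq (fun n => U n j1 j2) (V j1 j2)) ->
  (forall n, (n0 <= n)%nat -> hn N (U n) <= c) -> hn N V <= c.
Proof.
  intros HN Hc HL H. assert (HNr : 0 < INR N) by (apply lt_0_INR; auto).
  apply hn_of_sqr; auto.
  assert (L : is_lim_seq (fun n => sumL (G N) (fun j => U n (fst j) (snd j) ^ 2))
     (sumL (G N) (fun j => V (fst j) (snd j) ^ 2))).
  { apply sumL_lim. intros j _. simpl.
    apply (is_lim_seq_mult' (fun n => U n (fst j) (snd j))); auto.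
    apply (is_lim_seq_mult' (fun n => U n (fst j) (snd j))); auto. apply is_lim_seq_const. }
  assert (Hle : forall n, (n0 <= n)%nat ->
    sumL (G N) (fun j => U n (fst j) (snd j) ^ 2) <= (INR N * c) ^ 2).
  { intros n Hn. rewrite <- l2_sqr. apply pow_incr. split; [apply l2_nonneg|].
    specialize (H n Hn). unfold hn in H.
    apply (Rmult_le_compat_l (INR N)) in H; [|lra].
    rewrite <- Rmult_assoc, Rinv_r, Rmult_1_l in H by lra. exact H. }
  exact (is_lim_seq_le_loc _ _ _ _ (ex_intro _ n0 Hle) L (is_lim_seq_const _)).
Qed.

Lemma trm_weight s i j (a b : Z * Z -> R) k : (i + j <= 4)%nat ->
  Rpower (wgt k) s * ((kx k ^ i * ky k ^ j * a k) ^ 2 + (kx k ^ i * ky k ^ j * b k) ^ 2)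
  <= Rpower (wgt k) (s + 4) * (a k ^ 2 + b k ^ 2).
Proof.
  intros Hij. pose proof (wgt_ge1 k). pose proof (Rpower_pos (wgt k) s).
  replace (_ ^ 2 + _ ^ 2) with ((kx k ^ i * ky k ^ j) ^ 2 * (a k ^ 2 + b k ^ 2)) by ring.
  rewrite Rpower_plus, Rmult_assoc. apply Rmult_le_compat_l; [lra|].
  apply Rmult_le_compat_r; [pose proof (pow2_ge_0 (a k)); pose proof (pow2_ge_0 (b k)); lra|].
  replace 4 with (INR 4) by (simpl; ring). rewrite Rpower_pow by lra.
  replace (wgt k ^ 4) with ((wgt k ^ 2) ^ 2) by ring.
  rewrite <- (pow2_abs (kx k ^ i * ky k ^ j)). apply pow_incr.
  split; [apply Rabs_pos|apply monomial_le_wgt; auto].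
Qed.

(** Derivatives up to order 4 of an [H^{s+4}] function lie in [H^s], whereas the function itself
    keeps the full rate; the latter will pay for the powers of [m] produced by the differentiation
    matrices. *)
Lemma tail_bound s p : 1 < s -> exists C, 0 < C /\
  forall (m K : nat) a b B, (1 <= m)%nat -> (m <= (p + 1) * (K + 1))%nat -> HB s a b B ->
  (forall i j, (i + j <= 4)%nat ->
   hn (2 * m) (gridval (2 * m) (fun x y => Fij i j a b x y - Sij i j a b K x y))
   <= C * sqrt B * Rpower (INR (2 * m)) (- s)) /\
  hn (2 * m) (gridval (2 * m) (fun x y => Fij 0 0 a b x y - Sij 0 0 a b K x y))
   <= C * sqrt B * Rpower (INR (2 * m)) (- (s + 4)).
Proof.
  intros Hs. destruct (tail_finite s p Hs) as (C1 & HC1 & H1).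
  destruct (tail_finite (s + 4) p ltac:(lra)) as (C2 & HC2 & H2).
  destruct (HB_abs_sum s Hs) as (C3 & HC3 & H3).
  exists (C1 + C2). split; [lra|]. intros m K a b B Hm HK HBs.
  pose proof (H3 a b B HBs) as HA.
  assert (HN : (0 < 2 * m)%nat) by lia.
  assert (HB0 : 0 <= sqrt B) by apply sqrt_pos.
  assert (Key : forall i j C sg, (i + j <= 4)%nat -> 0 < C ->
     (forall n, (K <= n)%nat -> hn (2 * m) (fun j1 j2 => sumL (box n) (fun k => if inb K k then 0 else
        (kx k ^ i * ky k ^ j * a k) * cos (th2 (2 * m) k (j1, j2) + INR (i + j) * (PI / 2))
      + (kx k ^ i * ky k ^ j * b k) * sin (th2 (2 * m) k (j1, j2) + INR (i + j) * (PI / 2))))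
        <= C * sqrt B * Rpower (INR (2 * m)) (- sg)) -> C <= C1 + C2 ->
     hn (2 * m) (gridval (2 * m) (fun x y => Fij i j a b x y - Sij i j a b K x y))
     <= (C1 + C2) * sqrt B * Rpower (INR (2 * m)) (- sg)).
  { intros i j C sg Hij HC Hn Hle.
    pose proof (Rpower_pos (INR (2 * m)) (- sg)) as HR.
    apply Rle_trans with (C * sqrt B * Rpower (INR (2 * m)) (- sg)).
    - apply (hn_lim (2 * m) (fun n => gridval (2 * m) (fun x y => Sij i j a b n x y - Sij i j a b K x y))
        _ _ K); auto.
      + repeat apply Rmult_le_pos; lra.
      + intros j1 j2. apply is_lim_seq_minus'; [|apply is_lim_seq_const].
        eapply Fij_limit; eauto.
      + intros n Hn'. eapply Rle_trans; [|apply (Hn n Hn')]. right. unfold hn. f_equal.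
        f_equal. apply functional_extensionality. intros [j1 j2]. simpl fst; simpl snd.
        unfold gridval, Sij. rewrite (box_split K n _ Hn').
        match goal with |- ?u + ?v - ?u = _ => replace (u + v - u) with v by ring end.
        apply sumL_ext. intros k _. destruct (inb K k); auto.
        unfold trm, th2. simpl fst; simpl snd. ring.
    - apply Rmult_le_compat_r; [lra|]. apply Rmult_le_compat_r; lra. }
  split.
  - intros i j Hij. apply (Key i j C1); auto; [|lra]. intros n Hn.
    apply (H1 m K n (fun k => kx k ^ i * ky k ^ j * a k) (fun k => kx k ^ i * ky k ^ j * b k)); auto.
    eapply Rle_trans; [|apply (HBs n)]. apply sumL_le. intros k _. apply trm_weight; auto.
  - apply (Key 0%nat 0%nat C2); auto; [|lra]. intros n Hn.
    apply (H2 m K n (fun k => kx k ^ 0 * ky k ^ 0 * a k) (fun k => kx k ^ 0 * ky k ^ 0 * b k)); auto.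
    eapply Rle_trans; [|apply (HBs n)]. right. apply sumL_ext. intros k _. simpl. ring.
Qed.

(** * Spectral differentiation matrices *)

Lemma cos_add_nPI x (n : nat) : cos (x + INR n * PI) = (-1) ^ n * cos x.
Proof.
  induction n as [|n IH]; [simpl; rewrite Rmult_0_l, Rplus_0_r; ring|].
  rewrite S_INR. replace (x + (INR n + 1) * PI) with (x + INR n * PI + PI) by ring.
  rewrite neg_cos, IH. simpl; ring.
Qed.

Lemma cos_quarter_flip t (n : nat) :
  cos (t + INR n * (PI / 2)) = (-1) ^ n * cos (t - INR n * (PI / 2)).
Proof. rewrite <- cos_add_nPI. f_equal. field. Qed.

Lemma gk_Derive_n N k n : forall x, Derive_n (gk N k) n x =
  / INR N * sumL (seq 0 (S N)) (fun r => / a_coef N r * (INR r - INR N / 2) ^ n *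
     cos ((INR r - INR N / 2) * (x - xg N k) + INR n * (PI / 2))).
Proof.
  induction n as [|n IH]; intros x.
  - simpl Derive_n. unfold gk. rewrite sum_n_sumL. f_equal. apply sumL_ext. intros r _.
    simpl INR. rewrite Rmult_0_l, Rplus_0_r. simpl; ring.
  - change (Derive (Derive_n (gk N k) n) x = / INR N * sumL (seq 0 (S N)) (fun r =>
      / a_coef N r * (INR r - INR N / 2) ^ S n *
      cos ((INR r - INR N / 2) * (x - xg N k) + INR (S n) * (PI / 2)))).
    rewrite (Derive_ext _ _ x IH). apply is_derive_unique.
    apply is_derive_scal.
    apply (is_derive_sumL (seq 0 (S N)) (fun r x =>
      / a_coef N r * (INR r - INR N / 2) ^ n *
      cos ((INR r - INR N / 2) * (x - xg N k) + INR n * (PI / 2)))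
     (fun r x =>
      / a_coef N r * (INR r - INR N / 2) ^ S n *
      cos ((INR r - INR N / 2) * (x - xg N k) + INR (S n) * (PI / 2)))).
    intros r. rewrite S_INR.
    set (w := INR r - INR N / 2). set (q := INR n * (PI / 2)).
    replace (w * (x - xg N k) + (INR n + 1) * (PI / 2)) with ((w * (x - xg N k) + q) + PI / 2)
      by (unfold q; ring).
    rewrite (cos_plus (w * (x - xg N k) + q)), cos_PI2, sin_PI2.
    auto_derive; auto. unfold Rminus. simpl. ring.
Qed.

(** The terms of [gk] at the frequencies [-N/2] and [N/2] have equal derivatives, so their two
    halves merge into one term at [-m], and exactly [N] consecutive frequencies remain. *)
Lemma Dmat_formula m s j k : (1 <= m)%nat ->
  Dmat (2 * m) s j k = / INR (2 * m) * sumL (rng (- Z.of_nat m) (2 * m)) (fun l =>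
    IZR l ^ s * cos (IZR l * (xg (2 * m) j - xg (2 * m) k) + INR s * (PI / 2))).
Proof.
  intros Hm. unfold Dmat. rewrite gk_Derive_n. f_equal. set (N := (2 * m)%nat).
  set (t := fun r : nat => (INR r - INR N / 2) ^ s *
     cos ((INR r - INR N / 2) * (xg N j - xg N k) + INR s * (PI / 2))).
  assert (HNm : INR N / 2 = INR m) by (unfold N; rewrite mult_INR; simpl; field).
  assert (Hends : t 0%nat = t N).
  { unfold t. simpl (INR 0). rewrite HNm.
    replace (INR N) with (2 * INR m) by (unfold N; rewrite mult_INR; simpl; ring).
    replace (2 * INR m - INR m) with (INR m) by ring.
    replace (0 - INR m) with ((-1) * INR m) by ring. rewrite Rpow_mult_distr.
    rewrite (cos_quarter_flip (INR m * (xg N j - xg N k))).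
    replace (-1 * INR m * (xg N j - xg N k) + INR s * (PI / 2))
      with (- (INR m * (xg N j - xg N k) - INR s * (PI / 2))) by ring.
    rewrite cos_neg. ring. }
  rewrite (sumL_ext _ _ (fun r => / a_coef N r * t r)) by (intros; unfold t; ring).
  transitivity (sumL (seq 0 N) t).
  - rewrite seq_S, sumL_app. cbn [sumL]. rewrite Nat.add_0_l, Rplus_0_r.
    assert (EN : N = S (N - 1)) by (unfold N; lia).
    assert (Ea : forall r, a_coef N r = if (Nat.eqb r 0 || Nat.eqb r N)%bool then 2 else 1) by reflexivity.
    rewrite (Ea N), Nat.eqb_refl, Bool.orb_true_r.
    assert (Es : seq 0 N = 0%nat :: seq 1 (N - 1)) by (rewrite EN at 1; reflexivity).
    rewrite Es. cbn [sumL].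
    rewrite (Ea 0%nat). simpl (_ || _)%bool.
    rewrite (sumL_ext (seq 1 (N - 1)) _ t).
    + rewrite Hends. cbn [Nat.eqb orb]. field.
    + intros r Hr. apply in_seq in Hr. rewrite Ea.
      destruct (Nat.eqb_spec r 0); [lia|]. destruct (Nat.eqb_spec r N); [lia|]. simpl. field.
  - unfold rng. rewrite sumL_map. apply sumL_ext. intros r _. unfold t.
    rewrite HNm, plus_IZR, opp_IZR, <- !INR_IZR_INZ.
    replace (- INR m + INR r) with (INR r - INR m) by ring. auto.
Qed.

Lemma Dmat_sym m s j k : (1 <= m)%nat -> Dmat (2 * m) s k j = (-1) ^ s * Dmat (2 * m) s j k.
Proof.
  intros Hm. rewrite !Dmat_formula by auto.
  rewrite <- !Rmult_assoc, (Rmult_comm ((-1) ^ s)), Rmult_assoc. f_equal.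
  rewrite <- sumL_scal. apply sumL_ext. intros l _.
  rewrite cos_quarter_flip.
  replace (IZR l * (xg (2 * m) k - xg (2 * m) j) - INR s * (PI / 2))
    with (- (IZR l * (xg (2 * m) j - xg (2 * m) k) + INR s * (PI / 2))) by ring.
  rewrite cos_neg. ring.
Qed.

Lemma grid_sum_cos m p (d : Z) : (1 <= m)%nat ->
  sumL (seq 0 (2 * m)) (fun k => cos (p + IZR d * xg (2 * m) k))
  = if Zdivide_dec (Z.of_nat (2 * m)) d then INR (2 * m) * cos p else 0.
Proof.
  intros Hm.
  rewrite (sumL_ext _ _ (fun k => cos (p + INR k * (IZR d * hstep (2 * m)))))
    by (intros; unfold xg; f_equal; ring).
  destruct (Zdivide_dec (Z.of_nat (2 * m)) d).
  - apply cos_sum_aligned; auto; lia.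
  - apply cos_sum_orth; auto; lia.
Qed.

(** After the product-to-sum formula the grid sum selects the frequencies congruent to [l] or to
    [-l], each with weight one half. At [l = -m] these two classes coincide; the two contributions
    agree for order 2, whereas for odd orders they cancel. *)
Lemma Dmat_mode m s j (l : Z) q : (1 <= m)%nat -> (- Z.of_nat m <= l < Z.of_nat m)%Z ->
  (- Z.of_nat m < l)%Z \/ s = 2%nat ->
  sumL (seq 0 (2 * m)) (fun k => Dmat (2 * m) s j k * cos (IZR l * xg (2 * m) k + q))
  = IZR l ^ s * cos (IZR l * xg (2 * m) j + q + INR s * (PI / 2)).
Proof.
  intros Hm Hl Hs. set (N := (2 * m)%nat).
  assert (HN : 0 < INR N) by (apply lt_0_INR; unfold N; lia).
  set (t1 := fun r : Z => IZR r ^ s * cos (IZR r * xg N j + INR s * (PI / 2) + q)).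
  set (t2 := fun r : Z => IZR r ^ s * cos (IZR r * xg N j + INR s * (PI / 2) - q)).
  transitivity (sumL (rng (- Z.of_nat m) N) (fun r =>
     / 2 * (if Zdivide_dec (Z.of_nat N) (l - r) then t1 r else 0)
   + / 2 * (if Zdivide_dec (Z.of_nat N) (- (l + r)) then t2 r else 0))).
  - rewrite (sumL_ext _ _ (fun k => sumL (rng (- Z.of_nat m) N) (fun r =>
      / INR N * / 2 * IZR r ^ s * cos ((IZR r * xg N j + INR s * (PI / 2) + q) + IZR (l - r) * xg N k)
    + / INR N * / 2 * IZR r ^ s * cos ((IZR r * xg N j + INR s * (PI / 2) - q) + IZR (- (l + r)) * xg N k)))).
    + rewrite sumL_swap. apply sumL_ext. intros r _. rewrite sumL_plus, !sumL_scal.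
      unfold N. rewrite !grid_sum_cos by auto. fold N. unfold t1, t2.
      destruct (Zdivide_dec _ (l - r)), (Zdivide_dec _ (- (l + r))); field; lra.
    + intros k _. unfold N. rewrite Dmat_formula by auto. fold N.
      rewrite Rmult_assoc, <- sumL_scal_r, <- sumL_scal. apply sumL_ext. intros r _.
      rewrite opp_IZR, plus_IZR, minus_IZR.
      set (u := IZR r * (xg N j - xg N k) + INR s * (PI / 2)). set (v := IZR l * xg N k + q).
      replace (IZR r * xg N j + INR s * (PI / 2) + q + (IZR l - IZR r) * xg N k) with (u + v)
        by (unfold u, v; ring).
      replace (IZR r * xg N j + INR s * (PI / 2) - q + - (IZR l + IZR r) * xg N k) with (u - v)
        by (unfold u, v; ring).
      rewrite cos_plus, cos_minus. field. lra.
  - rewrite sumL_plus, !sumL_scal.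
    rewrite (sumL_single _ l); [|apply NoDup_rng|apply in_rng; unfold N; lia|].
    2:{ intros y Hy Hn. apply in_rng in Hy. destruct (Zdivide_dec _ _) as [[e He]|]; auto.
        exfalso. apply Hn. assert (e = 0)%Z by (unfold N in *; nia). subst e; lia. }
    destruct (Zdivide_dec (Z.of_nat N) (l - l)) as [_|Hd]; [|exfalso; apply Hd; exists 0%Z; lia].
    (* The representative of [-l] in the window from [-m] to [m - 1]. *)
    set (l' := if Z.eq_dec l (- Z.of_nat m) then l else (- l)%Z).
    rewrite (sumL_single _ l'); [|apply NoDup_rng| |].
    2:{ apply in_rng. unfold l', N. destruct (Z.eq_dec l _); lia. }
    2:{ intros y Hy Hn. apply in_rng in Hy. destruct (Zdivide_dec _ _) as [[e He]|]; auto.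
        exfalso. apply Hn. unfold l', N in *.
        destruct (Z.eq_dec l _) as [->|].
        - assert (e = 1)%Z by nia. subst; lia.
        - assert (e = 0)%Z by nia. subst; lia. }
    destruct (Zdivide_dec (Z.of_nat N) (- (l + l'))) as [_|Hd].
    2:{ exfalso; apply Hd. unfold l', N. destruct (Z.eq_dec l _).
        - exists 1%Z; lia.
        - exists 0%Z; lia. }
    assert (E : t2 l' = t1 l).
    { unfold t1, t2, l'. destruct (Z.eq_dec l (- Z.of_nat m)) as [->|Hne].
      - destruct Hs as [ | -> ]; [lia|]. f_equal. rewrite opp_IZR, <- INR_IZR_INZ.
        replace (- INR m * xg N j) with (- (INR j * PI)).
        + simpl (INR 2).
          replace (- (INR j * PI) + (1 + 1) * (PI / 2) + q) with
            ((INR j * PI - (1 + 1) * (PI / 2) + q) + IZR (1 - Z.of_nat j) * (2 * PI))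
            by (rewrite minus_IZR, <- INR_IZR_INZ; field).
          rewrite cos_add_2PI_Z. rewrite <- cos_neg. f_equal. ring.
        + unfold xg, hstep, N. rewrite mult_INR. simpl (INR 2).
          assert (INR m <> 0) by (apply not_0_INR; lia). field. auto.
      - rewrite opp_IZR.
        replace (- IZR l) with ((-1) * IZR l) by ring. rewrite Rpow_mult_distr.
        replace (IZR l * xg N j + INR s * (PI / 2) + q) with
          ((IZR l * xg N j + q) + INR s * (PI / 2)) by ring.
        rewrite cos_quarter_flip.
        replace (-1 * IZR l * xg N j + INR s * (PI / 2) - q) with
          (- (IZR l * xg N j + q - INR s * (PI / 2))) by ring.
        rewrite cos_neg. ring. }
    rewrite E. unfold t1.
    replace (IZR l * xg N j + INR s * (PI / 2) + q) with
          (IZR l * xg N j + q + INR s * (PI / 2)) by ring. field.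
Qed.

(** The matrix analyses [V], multiplies by [l^s] with [|l| <= m], and synthesises; Parseval and
    [trig_synthesis] bound the two outer steps. *)
Lemma Dmat_norm m s V : (1 <= m)%nat ->
  sumL (seq 0 (2 * m)) (fun j => (sumL (seq 0 (2 * m)) (fun k => Dmat (2 * m) s j k * V k)) ^ 2)
  <= (INR m ^ s) ^ 2 * sumL (seq 0 (2 * m)) (fun k => V k ^ 2).
Proof.
  intros Hm. set (N := (2 * m)%nat). assert (HN : 0 < INR N) by (apply lt_0_INR; unfold N; lia).
  set (th := fun (l : Z) (j : nat) => IZR l * xg N j).
  (* The quarter turns of the derivative are moved into the phase of the analysis, so that each
     entry becomes a sum of cosines of differences. *)
  set (q := - (INR s * (PI / 2))).
  set (a := fun l => / INR N * IZR l ^ s * Cc (seq 0 N) th q V l).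
  set (b := fun l => / INR N * IZR l ^ s * Sc (seq 0 N) th q V l).
  assert (Hker : forall (V : nat -> R) j, In j (seq 0 N) ->
    sumL (seq 0 N) (fun j' => V j' * sumL (rng (- Z.of_nat m) N) (fun k => cos (th k j - th k j')))
    = INR N * V j) by (apply ker1; unfold N; lia).
  rewrite (sumL_ext _ _ (fun j => (sumL (rng (- Z.of_nat m) N) (fun l =>
     a l * cos (th l j + 0) + b l * sin (th l j + 0))) ^ 2)).
  - eapply Rle_trans; [apply (trig_synthesis (seq 0 N) _ th (INR N) Hker); lra|].
    apply Rle_trans with (INR N * (/ INR N ^ 2 * (INR m ^ s) ^ 2 *
       sumL (rng (- Z.of_nat m) N) (fun l => Cc (seq 0 N) th q V l ^ 2 + Sc (seq 0 N) th q V l ^ 2))).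
    + apply Rmult_le_compat_l; [lra|]. rewrite <- sumL_scal. apply sumL_le. intros l Hl.
      apply in_rng in Hl. unfold a, b.
      replace (_ + _) with (/ INR N ^ 2 * (IZR l ^ s) ^ 2 * (Cc (seq 0 N) th q V l ^ 2 + Sc (seq 0 N) th q V l ^ 2))
        by (field; lra).
      apply Rmult_le_compat_r.
      { pose proof (pow2_ge_0 (Cc (seq 0 N) th q V l)). pose proof (pow2_ge_0 (Sc (seq 0 N) th q V l)). lra. }
      apply Rmult_le_compat_l; [left; apply Rinv_0_lt_compat; nra|].
      rewrite <- (pow2_abs (IZR l ^ s)), <- RPow_abs. apply pow_incr.
      split; [apply pow_le, Rabs_pos|]. apply pow_incr. split; [apply Rabs_pos|].
      rewrite <- abs_IZR, INR_IZR_INZ. apply IZR_le. unfold N in Hl. lia.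
    + rewrite (trig_parseval _ _ _ _ Hker). right. field. lra.
  - intros j _. f_equal.
    rewrite (sumL_ext _ _ (fun k => sumL (rng (- Z.of_nat m) N) (fun l =>
       / INR N * IZR l ^ s * (V k * cos (th l k + q)) * cos (th l j + 0)
     + / INR N * IZR l ^ s * (V k * sin (th l k + q)) * sin (th l j + 0)))).
    + rewrite sumL_swap. apply sumL_ext. intros l _. unfold a, b, Cc, Sc.
      rewrite sumL_plus, !sumL_scal_r, !sumL_scal. ring.
    + intros k _. unfold N. rewrite Dmat_formula by auto. fold N.
      rewrite Rmult_assoc, <- sumL_scal_r, <- sumL_scal. apply sumL_ext. intros l _.
      replace (IZR l * (xg N j - xg N k) + INR s * (PI / 2)) with ((th l j + 0) - (th l k + q))
        by (unfold th, q; ring).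
      rewrite cos_minus. ring.
Qed.

(** * Kronecker products as actions along the two axes *)

Definition ax (N : nat) (D : nat -> nat -> R) (U : grid) : grid :=
  fun j1 j2 => sumL (seq 0 N) (fun k => D j1 k * U k j2).
Definition ay (N : nat) (D : nat -> nat -> R) (U : grid) : grid :=
  fun j1 j2 => sumL (seq 0 N) (fun k => D j2 k * U j1 k).

Lemma kron_ax_ay N A B U : (0 < N)%nat -> kron N A B U = ay N A (ax N B U).
Proof.
  intros HN. apply functional_extensionality; intros j1. apply functional_extensionality; intros j2.
  unfold kron, ax, ay. rewrite sum_n_sumL. replace (S (N - 1)) with N by lia.
  apply sumL_ext. intros k2 _. rewrite sum_n_sumL. replace (S (N - 1)) with N by lia.
  rewrite <- sumL_scal. apply sumL_ext. intros; ring.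
Qed.

Lemma Idm_sum N j (V : nat -> R) : (j < N)%nat -> sumL (seq 0 N) (fun k => Idm j k * V k) = V j.
Proof.
  intros Hj. rewrite (sumL_single _ j).
  - unfold Idm. rewrite Nat.eqb_refl. ring.
  - apply seq_NoDup.
  - apply in_seq; lia.
  - intros y _ Hn. unfold Idm. destruct (Nat.eqb_spec j y); [congruence|ring].
Qed.

(** Grids are functions on all pairs of naturals, while summing against [Idm] reproduces a value
    only at indices below [N]; equality is therefore restricted to the actual grid. *)
Definition geq (N : nat) (U V : grid) : Prop :=
  forall j1 j2, (j1 < N)%nat -> (j2 < N)%nat -> U j1 j2 = V j1 j2.

Lemma kron_Idm_l N B U : (0 < N)%nat -> geq N (kron N Idm B U) (ax N B U).
Proof.
  intros HN j1 j2 H1 H2. rewrite kron_ax_ay by auto.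
  apply (Idm_sum N j2 (fun k => ax N B U j1 k)); auto.
Qed.

Lemma kron_Idm_r N A U : (0 < N)%nat -> geq N (kron N A Idm U) (ay N A U).
Proof.
  intros HN j1 j2 H1 H2. rewrite kron_ax_ay by auto. unfold ay. apply sumL_ext. intros k _.
  f_equal. apply (Idm_sum N j1 (fun k1 => U k1 k)); auto.
Qed.

Lemma hn_geq N U V : geq N U V -> hn N U = hn N V.
Proof.
  intros H. unfold hn, l2. do 2 f_equal. apply sumL_ext. intros j Hj. apply in_G in Hj.
  rewrite H by tauto. auto.
Qed.

Lemma hn_nonneg N U : 0 <= hn N U.
Proof.
  unfold hn. destruct N as [|N].
  - unfold l2. simpl. rewrite sqrt_0. lra.
  - apply Rmult_le_pos; [left; apply Rinv_0_lt_compat, lt_0_INR; lia|apply l2_nonneg].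
Qed.

Lemma hn_sqr N U : (0 < N)%nat ->
  INR N ^ 2 * hn N U ^ 2 = sumL (G N) (fun j => U (fst j) (snd j) ^ 2).
Proof.
  intros HN. assert (0 < INR N) by (apply lt_0_INR; auto).
  rewrite <- l2_sqr. unfold hn. field. lra.
Qed.

Lemma hn_triang N U V : (0 < N)%nat -> hn N (gadd U V) <= hn N U + hn N V.
Proof.
  intros HN. unfold hn. rewrite <- Rmult_plus_distr_l. apply Rmult_le_compat_l.
  - left; apply Rinv_0_lt_compat, lt_0_INR; auto.
  - apply (l2_triang (G N) (fun j => U (fst j) (snd j)) (fun j => V (fst j) (snd j))).
Qed.

Lemma hn_scal N c U : hn N (gscal c U) = Rabs c * hn N U.
Proof.
  unfold hn, gscal. rewrite (l2_scal (G N) c (fun j => U (fst j) (snd j))). ring.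
Qed.

Lemma hn_sub N U V : (0 < N)%nat -> hn N (gsub U V) <= hn N U + hn N V.
Proof.
  intros HN. replace (gsub U V) with (gadd U (gscal (-1) V)).
  - eapply Rle_trans; [apply hn_triang; auto|]. rewrite hn_scal, Rabs_left by lra. lra.
  - apply functional_extensionality; intros j1. apply functional_extensionality; intros j2.
    unfold gadd, gsub, gscal. ring.
Qed.

Lemma hn_le N U V : (0 < N)%nat ->
  (forall j1 j2, (j1 < N)%nat -> (j2 < N)%nat -> Rabs (U j1 j2) <= Rabs (V j1 j2)) ->
  hn N U <= hn N V.
Proof.
  intros HN H. unfold hn. apply Rmult_le_compat_l.
  - left; apply Rinv_0_lt_compat, lt_0_INR; auto.
  - apply l2_le. intros j Hj. apply in_G in Hj. apply H; tauto.
Qed.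

Lemma hn_sup N U c : (0 < N)%nat -> 0 <= c ->
  (forall j1 j2, (j1 < N)%nat -> (j2 < N)%nat -> Rabs (U j1 j2) <= c) -> hn N U <= c.
Proof.
  intros HN Hc H. apply hn_of_sqr; auto.
  apply Rle_trans with (sumL (G N) (fun _ => c ^ 2)).
  - apply sumL_le. intros j Hj. apply in_G in Hj. rewrite <- pow2_abs. apply pow_incr.
    split; [apply Rabs_pos|apply H; tauto].
  - rewrite sumL_const. unfold G. rewrite length_prod, length_seq, mult_INR. right; ring.
Qed.

Lemma hn_ax m s U : (1 <= m)%nat -> hn (2 * m) (ax (2 * m) (Dmat (2 * m) s) U) <= INR m ^ s * hn (2 * m) U.
Proof.
  intros Hm. apply hn_of_sqr; [lia| |].
  - apply Rmult_le_pos; [apply pow_le, pos_INR|apply hn_nonneg].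
  - replace ((INR (2 * m) * (INR m ^ s * hn (2 * m) U)) ^ 2)
      with ((INR m ^ s) ^ 2 * (INR (2 * m) ^ 2 * hn (2 * m) U ^ 2)) by ring.
    rewrite hn_sqr by lia. unfold G. rewrite !sumL_prod.
    rewrite sumL_swap, (sumL_swap _ _ (fun x y => U (fst (x, y)) (snd (x, y)) ^ 2)).
    rewrite <- sumL_scal. apply sumL_le. intros j2 _. cbn [fst snd].
    apply (Dmat_norm m s (fun k => U k j2) Hm).
Qed.

Lemma hn_ay m s U : (1 <= m)%nat -> hn (2 * m) (ay (2 * m) (Dmat (2 * m) s) U) <= INR m ^ s * hn (2 * m) U.
Proof.
  intros Hm. apply hn_of_sqr; [lia| |].
  - apply Rmult_le_pos; [apply pow_le, pos_INR|apply hn_nonneg].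
  - replace ((INR (2 * m) * (INR m ^ s * hn (2 * m) U)) ^ 2)
      with ((INR m ^ s) ^ 2 * (INR (2 * m) ^ 2 * hn (2 * m) U ^ 2)) by ring.
    rewrite hn_sqr by lia. unfold G. rewrite !sumL_prod.
    rewrite <- sumL_scal. apply sumL_le. intros j1 _. cbn [fst snd].
    apply (Dmat_norm m s (fun k => U j1 k) Hm).
Qed.

Definition ip (N : nat) (U V : grid) : R :=
  sumL (G N) (fun j => U (fst j) (snd j) * V (fst j) (snd j)).

Lemma ip_ax m s U V : (1 <= m)%nat ->
  ip (2 * m) (ax (2 * m) (Dmat (2 * m) s) U) V = (-1) ^ s * ip (2 * m) U (ax (2 * m) (Dmat (2 * m) s) V).
Proof.
  intros Hm. unfold ip, G. rewrite !sumL_prod, sumL_swap.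
  rewrite (sumL_swap _ _ (fun x y => U (fst (x, y)) (snd (x, y)) * _)), <- sumL_scal.
  apply sumL_ext. intros j2 _. cbn [fst snd]. unfold ax.
  rewrite (sumL_ext _ _ (fun j1 => sumL (seq 0 (2 * m)) (fun k => Dmat (2 * m) s j1 k * U k j2 * V j1 j2)))
    by (intros; rewrite sumL_scal_r; auto).
  rewrite sumL_swap, <- sumL_scal. apply sumL_ext. intros k _.
  rewrite <- !sumL_scal. apply sumL_ext. intros j1 _. rewrite (Dmat_sym m s k j1) by auto. ring.
Qed.

Lemma ip_ay m s U V : (1 <= m)%nat ->
  ip (2 * m) (ay (2 * m) (Dmat (2 * m) s) U) V = (-1) ^ s * ip (2 * m) U (ay (2 * m) (Dmat (2 * m) s) V).
Proof.
  intros Hm. unfold ip, G. rewrite !sumL_prod, <- sumL_scal.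
  apply sumL_ext. intros j1 _. cbn [fst snd]. unfold ay.
  rewrite (sumL_ext _ _ (fun j2 => sumL (seq 0 (2 * m)) (fun k => Dmat (2 * m) s j2 k * U j1 k * V j1 j2)))
    by (intros; rewrite sumL_scal_r; auto).
  rewrite sumL_swap, <- sumL_scal. apply sumL_ext. intros k _.
  rewrite <- !sumL_scal. apply sumL_ext. intros j2 _. rewrite (Dmat_sym m s k j2) by auto. ring.
Qed.

Lemma ax_ay_comm N A B U : ax N A (ay N B U) = ay N B (ax N A U).
Proof.
  apply functional_extensionality; intros j1. apply functional_extensionality; intros j2.
  unfold ax, ay.
  rewrite (sumL_ext _ _ (fun k => sumL (seq 0 N) (fun k2 => A j1 k * (B j2 k2 * U k k2))))
    by (intros; rewrite sumL_scal; auto).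
  rewrite sumL_swap. apply sumL_ext. intros k2 _. rewrite <- sumL_scal. apply sumL_ext. intros; ring.
Qed.

(** [K < m] keeps the frequency [-m] out, so [Dmat_mode] applies at every order to each term of the
    partial sum. *)
Lemma ax_Sij m s i j a b K : (1 <= m)%nat -> (K < m)%nat ->
  ax (2 * m) (Dmat (2 * m) s) (gridval (2 * m) (Sij i j a b K))
  = gridval (2 * m) (Sij (i + s) j a b K).
Proof.
  intros Hm HK.
  apply functional_extensionality; intros j1. apply functional_extensionality; intros j2.
  unfold ax, gridval, Sij. set (N := (2 * m)%nat).
  rewrite (sumL_ext _ _ (fun r => sumL (box K) (fun k => Dmat N s j1 r * trm i j a b k (xg N r) (xg N j2))))
    by (intros; rewrite sumL_scal; auto).
  rewrite sumL_swap. apply sumL_ext. intros k Hk. apply in_box in Hk. unfold trm.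
  set (q := ky k * xg N j2 + INR (i + j) * (PI / 2)).
  rewrite (sumL_ext _ _ (fun r => kx k ^ i * ky k ^ j *
     (a k * (Dmat N s j1 r * cos (kx k * xg N r + q)) +
      b k * (Dmat N s j1 r * cos (kx k * xg N r + (q - PI / 2)))))).
  - rewrite sumL_scal, sumL_plus, !sumL_scal. unfold kx at 2 3, N.
    rewrite !Dmat_mode by lia. fold N. fold (kx k).
    replace (INR (i + s + j)) with (INR (i + j) + INR s) by (rewrite <- plus_INR; f_equal; lia).
    rewrite pow_add, sin_cos_shift.
    replace (kx k * xg N j1 + q + INR s * (PI / 2))
      with (kx k * xg N j1 + ky k * xg N j2 + (INR (i + j) + INR s) * (PI / 2)) by (unfold q; ring).
    replace (kx k * xg N j1 + (q - PI / 2) + INR s * (PI / 2))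
      with (kx k * xg N j1 + ky k * xg N j2 + (INR (i + j) + INR s) * (PI / 2) + - (PI / 2))
      by (unfold q; ring).
    ring.
  - intros r _. rewrite sin_cos_shift.
    replace (kx k * xg N r + ky k * xg N j2 + INR (i + j) * (PI / 2)) with (kx k * xg N r + q)
      by (unfold q; ring).
    replace (kx k * xg N r + (q - PI / 2)) with (kx k * xg N r + q + - (PI / 2)) by ring. ring.
Qed.

Lemma ay_Sij m s i j a b K : (1 <= m)%nat -> (K < m)%nat ->
  ay (2 * m) (Dmat (2 * m) s) (gridval (2 * m) (Sij i j a b K))
  = gridval (2 * m) (Sij i (j + s) a b K).
Proof.
  intros Hm HK.
  apply functional_extensionality; intros j1. apply functional_extensionality; intros j2.
  unfold ay, gridval, Sij. set (N := (2 * m)%nat).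
  rewrite (sumL_ext _ _ (fun r => sumL (box K) (fun k => Dmat N s j2 r * trm i j a b k (xg N j1) (xg N r))))
    by (intros; rewrite sumL_scal; auto).
  rewrite sumL_swap. apply sumL_ext. intros k Hk. apply in_box in Hk. unfold trm.
  set (q := kx k * xg N j1 + INR (i + j) * (PI / 2)).
  rewrite (sumL_ext _ _ (fun r => kx k ^ i * ky k ^ j *
     (a k * (Dmat N s j2 r * cos (ky k * xg N r + q)) +
      b k * (Dmat N s j2 r * cos (ky k * xg N r + (q - PI / 2)))))).
  - rewrite sumL_scal, sumL_plus, !sumL_scal. unfold ky at 2 3, N.
    rewrite !Dmat_mode by lia. fold N. fold (ky k).
    replace (INR (i + (j + s))) with (INR (i + j) + INR s) by (rewrite <- plus_INR; f_equal; lia).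
    rewrite pow_add, sin_cos_shift.
    replace (ky k * xg N j2 + q + INR s * (PI / 2))
      with (kx k * xg N j1 + ky k * xg N j2 + (INR (i + j) + INR s) * (PI / 2)) by (unfold q; ring).
    replace (ky k * xg N j2 + (q - PI / 2) + INR s * (PI / 2))
      with (kx k * xg N j1 + ky k * xg N j2 + (INR (i + j) + INR s) * (PI / 2) + - (PI / 2))
      by (unfold q; ring).
    ring.
  - intros r _. rewrite sin_cos_shift.
    replace (kx k * xg N j1 + ky k * xg N r + INR (i + j) * (PI / 2)) with (ky k * xg N r + q)
      by (unfold q; ring).
    replace (ky k * xg N r + (q - PI / 2)) with (ky k * xg N r + q + - (PI / 2)) by ring. ring.
Qed.

(** * Trigonometric polynomials and consistency *)

Lemma fun2_ext {A B C : Type} (f g : A -> B -> C) : (forall x y, f x y = g x y) -> f = g.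
Proof.
  intros H. apply functional_extensionality; intros x. apply functional_extensionality; auto.
Qed.

(** Cosines with a phase include the sines and are stable under products by the product-to-sum
    formula, so additivity of degrees is an induction on this predicate. *)
Inductive trig_poly (d : nat) : (R -> R -> R) -> Prop :=
| trig_poly_cos k c q : In k (box d) -> trig_poly d (fun x y => c * cos (kx k * x + ky k * y + q))
| trig_poly_add f g : trig_poly d f -> trig_poly d g -> trig_poly d (fun x y => f x y + g x y).

Lemma trig_poly_ext d f g : trig_poly d f -> (forall x y, f x y = g x y) -> trig_poly d g.
Proof. intros H E. rewrite <- (fun2_ext _ _ E). auto. Qed.

Lemma trig_poly_const d c : trig_poly d (fun _ _ => c).
Proof.
  apply (trig_poly_ext d (fun x y => c * cos (kx (0, 0)%Z * x + ky (0, 0)%Z * y + 0))).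
  - apply trig_poly_cos. apply in_box. simpl. lia.
  - intros x y. unfold kx, ky; simpl. rewrite !Rmult_0_l, !Rplus_0_r, cos_0. ring.
Qed.

Lemma trig_poly_mult d e f g : trig_poly d f -> trig_poly e g -> trig_poly (d + e) (fun x y => f x y * g x y).
Proof.
  intros Hf Hg. induction Hf as [k c q Hk|f1 f2 H1 IH1 H2 IH2].
  - induction Hg as [l c' q' Hl|g1 g2 H1 IH1 H2 IH2].
    + set (k1 := ((fst k + fst l)%Z, (snd k + snd l)%Z)).
      set (k2 := ((fst k - fst l)%Z, (snd k - snd l)%Z)).
      apply in_box in Hk. apply in_box in Hl.
      apply (trig_poly_ext _ (fun x y => (c * c' / 2) * cos (kx k1 * x + ky k1 * y + (q + q'))
         + (c * c' / 2) * cos (kx k2 * x + ky k2 * y + (q - q')))).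
      * apply trig_poly_add; apply trig_poly_cos; apply in_box; simpl; lia.
      * intros x y. set (u := kx k * x + ky k * y + q). set (v := kx l * x + ky l * y + q').
        replace (kx k1 * x + ky k1 * y + (q + q')) with (u + v)
          by (unfold u, v, kx, ky, k1; simpl; rewrite !plus_IZR; ring).
        replace (kx k2 * x + ky k2 * y + (q - q')) with (u - v)
          by (unfold u, v, kx, ky, k2; simpl; rewrite !minus_IZR; ring).
        rewrite cos_plus, cos_minus. field.
    + eapply trig_poly_ext; [apply (trig_poly_add _ _ _ IH1 IH2)|]. intros; simpl; ring.
  - eapply trig_poly_ext; [apply (trig_poly_add _ _ _ IH1 IH2)|]. intros; simpl; ring.
Qed.

Lemma trig_poly_pow d f n : trig_poly d f -> trig_poly (n * d) (fun x y => f x y ^ n).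
Proof.
  intros Hf. induction n as [|n IH]; [apply (trig_poly_const (0 * d) 1)|].
  apply (trig_poly_mult d (n * d) f (fun x y => f x y ^ n)); auto.
Qed.

Lemma trig_poly_Sij a b K : trig_poly K (Sij 0 0 a b K).
Proof.
  unfold Sij. assert (H : forall l, incl l (box K) -> trig_poly K (fun x y => sumL l (fun k => trm 0 0 a b k x y))).
  { induction l as [|k l IH]; intros Hl; simpl; [apply trig_poly_const|].
    apply (trig_poly_add K (fun x y => trm 0 0 a b k x y)).
    - assert (Hk : In k (box K)) by (apply Hl; left; auto).
      apply (trig_poly_ext K (fun x y => a k * cos (kx k * x + ky k * y + 0)
         + b k * cos (kx k * x + ky k * y + - (PI / 2)))).
      + apply trig_poly_add; apply trig_poly_cos; auto.
      + intros x y. rewrite <- sin_cos_shift. unfold trm. simpl.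
        rewrite Rmult_0_l, !Rplus_0_r. ring.
    - apply IH. intros z Hz. apply Hl; right; auto. }
  apply H. apply incl_refl.
Qed.

Lemma ax_gadd N D U V : ax N D (gadd U V) = gadd (ax N D U) (ax N D V).
Proof.
  apply fun2_ext; intros j1 j2. unfold ax, gadd. rewrite <- sumL_plus. apply sumL_ext; intros; ring.
Qed.
Lemma ay_gadd N D U V : ay N D (gadd U V) = gadd (ay N D U) (ay N D V).
Proof.
  apply fun2_ext; intros j1 j2. unfold ay, gadd. rewrite <- sumL_plus. apply sumL_ext; intros; ring.
Qed.
Lemma ax_gscal N D c U : ax N D (gscal c U) = gscal c (ax N D U).
Proof.
  apply fun2_ext; intros j1 j2. unfold ax, gscal. rewrite <- sumL_scal. apply sumL_ext; intros; ring.
Qed.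
Lemma ay_gscal N D c U : ay N D (gscal c U) = gscal c (ay N D U).
Proof.
  apply fun2_ext; intros j1 j2. unfold ay, gscal. rewrite <- sumL_scal. apply sumL_ext; intros; ring.
Qed.
Lemma gsub_gadd U V : gsub U V = gadd U (gscal (-1) V).
Proof. apply fun2_ext; intros. unfold gsub, gadd, gscal. ring. Qed.
Lemma ax_gsub N D U V : ax N D (gsub U V) = gsub (ax N D U) (ax N D V).
Proof. rewrite !gsub_gadd, ax_gadd, ax_gscal. auto. Qed.
Lemma ay_gsub N D U V : ay N D (gsub U V) = gsub (ay N D U) (ay N D V).
Proof. rewrite !gsub_gadd, ay_gadd, ay_gscal. auto. Qed.

Lemma trig_poly_exact m d f : (1 <= m)%nat -> (d < m)%nat -> trig_poly d f -> exists fx fy,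
  (forall x y, is_derive (fun z => f z y) x (fx x y)) /\
  (forall x y, is_derive (fun z => f x z) y (fy x y)) /\
  ax (2 * m) (Dmat (2 * m) 1) (gridval (2 * m) f) = gridval (2 * m) fx /\
  ay (2 * m) (Dmat (2 * m) 1) (gridval (2 * m) f) = gridval (2 * m) fy.
Proof.
  intros Hm Hd Hf. induction Hf as [k c q Hk|f g _ (fx & fy & H1 & H2 & H3 & H4) _ (gx & gy & I1 & I2 & I3 & I4)].
  - apply in_box in Hk. set (N := (2 * m)%nat).
    exists (fun x y => c * (kx k * cos (kx k * x + ky k * y + q + PI / 2))).
    exists (fun x y => c * (ky k * cos (kx k * x + ky k * y + q + PI / 2))).
    assert (E : forall t, cos (t + PI / 2) = - sin t).
    { intros t. rewrite cos_plus, cos_PI2, sin_PI2. ring. }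
    split; [|split; [|split]].
    + intros x y. rewrite E. auto_derive; auto. ring.
    + intros x y. rewrite E. auto_derive; auto. ring.
    + apply fun2_ext; intros j1 j2. unfold ax, gridval.
      rewrite (sumL_ext _ _ (fun r => c * (Dmat N 1 j1 r * cos (IZR (fst k) * xg N r + (ky k * xg N j2 + q))))).
      * rewrite sumL_scal. unfold N. rewrite Dmat_mode by lia. fold N. fold (kx k). simpl INR.
        f_equal. rewrite pow_1. f_equal. f_equal. ring.
      * intros r _. unfold kx.
        replace (IZR (fst k) * xg N r + (ky k * xg N j2 + q)) with
          (IZR (fst k) * xg N r + ky k * xg N j2 + q) by ring. ring.
    + apply fun2_ext; intros j1 j2. unfold ay, gridval.
      rewrite (sumL_ext _ _ (fun r => c * (Dmat N 1 j2 r * cos (IZR (snd k) * xg N r + (kx k * xg N j1 + q))))).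
      * rewrite sumL_scal. unfold N. rewrite Dmat_mode by lia. fold N. fold (ky k). simpl INR.
        f_equal. rewrite pow_1. f_equal. f_equal. ring.
      * intros r _. unfold ky.
        replace (IZR (snd k) * xg N r + (kx k * xg N j1 + q)) with
          (kx k * xg N j1 + IZR (snd k) * xg N r + q) by ring. ring.
  - exists (fun x y => fx x y + gx x y), (fun x y => fy x y + gy x y).
    split; [|split; [|split]].
    + intros x y. apply (is_derive_plus (V := R_NormedModule)); auto.
    + intros x y. apply (is_derive_plus (V := R_NormedModule)); auto.
    + change (gridval (2 * m) (fun x y => f x y + g x y)) with (gadd (gridval (2 * m) f) (gridval (2 * m) g)).
      rewrite ax_gadd, H3, I3. reflexivity.
    + change (gridval (2 * m) (fun x y => f x y + g x y)) with (gadd (gridval (2 * m) f) (gridval (2 * m) g)).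
      rewrite ay_gadd, H4, I4. reflexivity.
Qed.

(** Derivatives are unique, so exactness holds for any closed form of the partial derivatives, in
    particular the one given by the product rule. *)
Lemma trig_poly_exact_eq m d f fx fy : (1 <= m)%nat -> (d < m)%nat -> trig_poly d f ->
  (forall x y, is_derive (fun z => f z y) x (fx x y)) ->
  (forall x y, is_derive (fun z => f x z) y (fy x y)) ->
  ax (2 * m) (Dmat (2 * m) 1) (gridval (2 * m) f) = gridval (2 * m) fx /\
  ay (2 * m) (Dmat (2 * m) 1) (gridval (2 * m) f) = gridval (2 * m) fy.
Proof.
  intros Hm Hd Hf Hx Hy. destruct (trig_poly_exact m d f Hm Hd Hf) as (gx & gy & H1 & H2 & H3 & H4).
  rewrite H3, H4. split; apply fun2_ext; intros j1 j2; unfold gridval.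
  - rewrite <- (is_derive_unique _ _ _ (H1 (xg (2 * m) j1) (xg (2 * m) j2))).
    apply is_derive_unique. apply Hx.
  - rewrite <- (is_derive_unique _ _ _ (H2 (xg (2 * m) j1) (xg (2 * m) j2))).
    apply is_derive_unique. apply Hy.
Qed.

Lemma hn_dominated {I : Type} N U (l : list I) (V : I -> grid) c : (0 < N)%nat -> 0 <= c ->
  (forall j1 j2, Rabs (U j1 j2) <= c * sumL l (fun i => Rabs (V i j1 j2))) ->
  hn N U <= c * sumL l (fun i => hn N (V i)).
Proof.
  intros HN Hc H.
  assert (HNi : 0 <= / INR N) by (left; apply Rinv_0_lt_compat, lt_0_INR; auto).
  apply Rle_trans with (hn N (gscal c (fun j1 j2 => sumL l (fun i => Rabs (V i j1 j2))))).
  - apply hn_le; auto. intros j1 j2 _ _. eapply Rle_trans; [apply H|]. apply Rle_abs.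
  - rewrite hn_scal, Rabs_pos_eq by auto. apply Rmult_le_compat_l; auto. unfold hn.
    rewrite sumL_scal. apply Rmult_le_compat_l; auto.
    eapply Rle_trans; [apply l2_sum|]. apply sumL_le. intros i _. apply l2_le.
    intros j _. rewrite Rabs_Rabsolu. lra.
Qed.

(** * Consistency of the linear operators *)

Section FixedGrid.
Variables (m : nat).
Hypothesis Hm : (1 <= m)%nat.
Let N := (2 * m)%nat.

(** The primed operators drop the identity factors of the Kronecker products and agree with the
    original ones on the grid. *)
Definition opA' (U : grid) : grid := gadd (ax N (Dmat N 2) U) (ay N (Dmat N 2) U).
Definition opL' (U : grid) : grid := gadd (ax N (Dmat N 1) U) (ay N (Dmat N 1) U).
Definition opB' (U : grid) : grid := gadd (ax N (Dmat N 3) U) (ay N (Dmat N 2) (ax N (Dmat N 1) U)).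

Let HN : (0 < N)%nat.
Proof. unfold N; lia. Qed.

Lemma geq_ax D U V : geq N U V -> geq N (ax N D U) (ax N D V).
Proof.
  intros H j1 j2 H1 H2. apply sumL_ext. intros k Hk. apply in_seq in Hk. rewrite H by lia. auto.
Qed.
Lemma geq_ay D U V : geq N U V -> geq N (ay N D U) (ay N D V).
Proof.
  intros H j1 j2 H1 H2. apply sumL_ext. intros k Hk. apply in_seq in Hk. rewrite H by lia. auto.
Qed.

Lemma opA_geq U : geq N (opA N U) (opA' U).
Proof.
  intros j1 j2 H1 H2. unfold opA, opA', gadd.
  rewrite (kron_Idm_l N _ U HN j1 j2 H1 H2), (kron_Idm_r N _ U HN j1 j2 H1 H2). auto.
Qed.
Lemma opL_geq U : geq N (opL N U) (opL' U).
Proof.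
  intros j1 j2 H1 H2. unfold opL, opL', gadd.
  rewrite (kron_Idm_l N _ U HN j1 j2 H1 H2), (kron_Idm_r N _ U HN j1 j2 H1 H2). auto.
Qed.
Lemma opB_geq U : geq N (opB N U) (opB' U).
Proof.
  intros j1 j2 H1 H2. unfold opB, opB', gadd.
  rewrite (kron_Idm_l N _ U HN j1 j2 H1 H2), kron_ax_ay by auto. auto.
Qed.
Lemma opA'_geq U V : geq N U V -> geq N (opA' U) (opA' V).
Proof.
  intros H j1 j2 H1 H2. unfold opA', gadd.
  rewrite (geq_ax _ _ _ H j1 j2 H1 H2), (geq_ay _ _ _ H j1 j2 H1 H2). auto.
Qed.
Lemma opAA_geq U : geq N (opA N (opA N U)) (opA' (opA' U)).
Proof.
  intros j1 j2 H1 H2. rewrite (opA_geq _ j1 j2 H1 H2). apply opA'_geq; auto. apply opA_geq.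
Qed.

Section Truncation.
Variables (s : R) (K : nat) (a b : Z * Z -> R) (X : R).
Let g i j := gridval N (Fij i j a b).
Let q i j := gridval N (Sij i j a b K).
Hypothesis HK : (K < m)%nat.
Hypothesis HX : 0 <= X.
Hypothesis Htail : forall i j, (i + j <= 4)%nat -> hn N (gsub (g i j) (q i j)) <= X * Rpower (INR N) (- s).
Hypothesis Htail0 : hn N (gsub (g 0 0)%nat (q 0 0)%nat) <= X * Rpower (INR N) (- (s + 4)).

(** Each order of differentiation costs a factor at most [m]; up to four of them are absorbed by the
    better rate of the undifferentiated tail. *)
Lemma pow_m_le o : (o <= 4)%nat ->
  INR m ^ o * (X * Rpower (INR N) (- (s + 4))) <= X * Rpower (INR N) (- s).
Proof.
  intros Ho. assert (H1 : 1 <= INR m) by (apply (le_INR 1); auto).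
  assert (HNm : INR N = 2 * INR m) by (unfold N; rewrite mult_INR; simpl; ring).
  pose proof (Rpower_pos (INR N) (- (s + 4))) as HR.
  replace (Rpower (INR N) (- s)) with (INR N ^ 4 * Rpower (INR N) (- (s + 4))).
  - assert (INR m ^ o <= INR N ^ 4).
    { apply Rle_trans with (INR m ^ 4); [apply Rle_pow; auto|]. apply pow_incr. lra. }
    replace (X * (INR N ^ 4 * Rpower (INR N) (- (s + 4))))
      with (INR N ^ 4 * (X * Rpower (INR N) (- (s + 4)))) by ring.
    apply Rmult_le_compat_r; auto. apply Rmult_le_pos; lra.
  - rewrite <- Rpower_pow by lra. rewrite <- Rpower_plus. f_equal. simpl; ring.
Qed.

(** By exactness on the truncation, [T g - g_ij = T (g - q) - (g_ij - q_ij)]: the first term costs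
    [m^o] times the tail of [g], the second is the tail of the derivative. *)
Lemma cons_gen (T : grid -> grid) i j o : (o <= 4)%nat -> (i + j <= 4)%nat ->
  (forall U V, T (gsub U V) = gsub (T U) (T V)) ->
  (forall U, hn N (T U) <= INR m ^ o * hn N U) ->
  T (q 0 0)%nat = q i j ->
  hn N (gsub (T (g 0 0)%nat) (g i j)) <= 2 * X * Rpower (INR N) (- s).
Proof.
  intros Ho Hij HT1 HT2 HT3.
  replace (gsub (T (g 0 0)%nat) (g i j)) with
    (gsub (T (gsub (g 0 0)%nat (q 0 0)%nat)) (gsub (g i j) (q i j))).
  - eapply Rle_trans; [apply hn_sub; auto|].
    pose proof (Htail i j Hij). pose proof (HT2 (gsub (g 0 0)%nat (q 0 0)%nat)) as H2.
    assert (INR m ^ o * hn N (gsub (g 0 0)%nat (q 0 0)%nat) <= X * Rpower (INR N) (- s)).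
    { eapply Rle_trans; [|apply (pow_m_le o Ho)]. apply Rmult_le_compat_l; auto.
      apply pow_le, pos_INR. }
    lra.
  - rewrite HT1, HT3. apply fun2_ext; intros. unfold gsub. ring.
Qed.

Lemma gsub_gadd4 U U' V V' : gsub (gadd U U') (gadd V V') = gadd (gsub U V) (gsub U' V').
Proof. apply fun2_ext; intros. unfold gsub, gadd. ring. Qed.

Lemma hn_ax2 s1 s2 U : hn N (ax N (Dmat N s2) (ax N (Dmat N s1) U)) <= INR m ^ (s1 + s2) * hn N U.
Proof.
  eapply Rle_trans; [apply hn_ax; auto|]. rewrite Nat.add_comm, pow_add, Rmult_assoc.
  apply Rmult_le_compat_l; [apply pow_le, pos_INR|]. apply hn_ax; auto.
Qed.
Lemma hn_ay2 s1 s2 U : hn N (ay N (Dmat N s2) (ay N (Dmat N s1) U)) <= INR m ^ (s1 + s2) * hn N U.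
Proof.
  eapply Rle_trans; [apply hn_ay; auto|]. rewrite Nat.add_comm, pow_add, Rmult_assoc.
  apply Rmult_le_compat_l; [apply pow_le, pos_INR|]. apply hn_ay; auto.
Qed.
Lemma hn_ayx s1 s2 U : hn N (ay N (Dmat N s2) (ax N (Dmat N s1) U)) <= INR m ^ (s1 + s2) * hn N U.
Proof.
  eapply Rle_trans; [apply hn_ay; auto|]. rewrite Nat.add_comm, pow_add, Rmult_assoc.
  apply Rmult_le_compat_l; [apply pow_le, pos_INR|]. apply hn_ax; auto.
Qed.

Lemma consistency_L :
  hn N (gsub (opL N (g 0 0)%nat) (gadd (g 1 0)%nat (g 0 1)%nat)) <= 4 * X * Rpower (INR N) (- s).
Proof.
  rewrite (hn_geq N _ (gsub (opL' (g 0 0)%nat) (gadd (g 1 0)%nat (g 0 1)%nat))).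
  - unfold opL'. rewrite gsub_gadd4. eapply Rle_trans; [apply hn_triang; auto|].
    assert (H1 := cons_gen (ax N (Dmat N 1)) 1 0 1 ltac:(lia) ltac:(lia)
      (ax_gsub _ _) (fun U => hn_ax m 1 U Hm) (ax_Sij m 1 0 0 a b K Hm HK)).
    assert (H2 := cons_gen (ay N (Dmat N 1)) 0 1 1 ltac:(lia) ltac:(lia)
      (ay_gsub _ _) (fun U => hn_ay m 1 U Hm) (ay_Sij m 1 0 0 a b K Hm HK)).
    lra.
  - intros j1 j2 H1 H2. unfold gsub. rewrite (opL_geq _ j1 j2 H1 H2). auto.
Qed.

Lemma consistency_B :
  hn N (gsub (opB N (g 0 0)%nat) (gadd (g 3 0)%nat (g 1 2)%nat)) <= 4 * X * Rpower (INR N) (- s).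
Proof.
  rewrite (hn_geq N _ (gsub (opB' (g 0 0)%nat) (gadd (g 3 0)%nat (g 1 2)%nat))).
  - unfold opB'. rewrite gsub_gadd4. eapply Rle_trans; [apply hn_triang; auto|].
    assert (H1 := cons_gen (ax N (Dmat N 3)) 3 0 3 ltac:(lia) ltac:(lia)
      (ax_gsub _ _) (fun U => hn_ax m 3 U Hm) (ax_Sij m 3 0 0 a b K Hm HK)).
    assert (H2 := cons_gen (fun U => ay N (Dmat N 2) (ax N (Dmat N 1) U)) 1 2 3 ltac:(lia) ltac:(lia)
      ltac:(intros; cbv beta; rewrite ax_gsub, ay_gsub; auto) (hn_ayx 1 2)
      ltac:(unfold q, N; rewrite ax_Sij, ay_Sij by auto; auto)).
    simpl in H2. lra.
  - intros j1 j2 H1 H2. unfold gsub. rewrite (opB_geq _ j1 j2 H1 H2). auto.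
Qed.

Lemma opAA'_expand U : opA' (opA' U) =
  gadd (ax N (Dmat N 2) (ax N (Dmat N 2) U))
    (gadd (ay N (Dmat N 2) (ax N (Dmat N 2) U))
      (gadd (ay N (Dmat N 2) (ax N (Dmat N 2) U)) (ay N (Dmat N 2) (ay N (Dmat N 2) U)))).
Proof.
  unfold opA'. rewrite ax_gadd, ay_gadd, ax_ay_comm.
  apply fun2_ext; intros. unfold gadd. ring.
Qed.

Lemma consistency_A2 :
  hn N (gsub (opA N (opA N (g 0 0)%nat))
    (gadd (g 4 0)%nat (gadd (g 2 2)%nat (gadd (g 2 2)%nat (g 0 4)%nat)))) <= 8 * X * Rpower (INR N) (- s).
Proof.
  rewrite (hn_geq N _ (gsub (opA' (opA' (g 0 0)%nat))
    (gadd (g 4 0)%nat (gadd (g 2 2)%nat (gadd (g 2 2)%nat (g 0 4)%nat))))).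
  - rewrite opAA'_expand. rewrite !gsub_gadd4.
    assert (H1 := cons_gen (fun U => ax N (Dmat N 2) (ax N (Dmat N 2) U)) 4 0 4 ltac:(lia) ltac:(lia)
      ltac:(intros; cbv beta; rewrite !ax_gsub; auto) (hn_ax2 2 2)
      ltac:(unfold q, N; rewrite !ax_Sij by auto; auto)).
    assert (H2 := cons_gen (fun U => ay N (Dmat N 2) (ax N (Dmat N 2) U)) 2 2 4 ltac:(lia) ltac:(lia)
      ltac:(intros; cbv beta; rewrite ax_gsub, ay_gsub; auto) (hn_ayx 2 2)
      ltac:(unfold q, N; rewrite ax_Sij, ay_Sij by auto; auto)).
    assert (H3 := cons_gen (fun U => ay N (Dmat N 2) (ay N (Dmat N 2) U)) 0 4 4 ltac:(lia) ltac:(lia)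
      ltac:(intros; cbv beta; rewrite !ay_gsub; auto) (hn_ay2 2 2)
      ltac:(unfold q, N; rewrite !ay_Sij by auto; auto)).
    simpl in H1, H2, H3.
    eapply Rle_trans; [apply hn_triang; auto|].
    eapply Rle_trans; [apply Rplus_le_compat_l, hn_triang; auto|].
    eapply Rle_trans; [apply Rplus_le_compat_l, Rplus_le_compat_l, hn_triang; auto|]. lra.
  - intros j1 j2 H1 H2. unfold gsub. rewrite (opAA_geq _ j1 j2 H1 H2). auto.
Qed.

End Truncation.

End FixedGrid.

(** * Consistency of the nonlinear term *)

Lemma pow_diff_le x y A n : 1 <= A -> Rabs x <= A -> Rabs y <= A ->
  Rabs (x ^ n - y ^ n) <= INR n * A ^ n * Rabs (x - y).
Proof.
  intros HA Hx Hy. induction n as [|n IH].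
  - simpl. rewrite Rminus_diag, Rabs_R0. lra.
  - replace (x ^ S n - y ^ S n) with (x * (x ^ n - y ^ n) + y ^ n * (x - y)) by (simpl; ring).
    eapply Rle_trans; [apply Rabs_triang|]. rewrite !Rabs_mult, S_INR.
    assert (HyA : Rabs (y ^ n) <= A ^ n).
    { rewrite <- RPow_abs. apply pow_incr. split; [apply Rabs_pos|auto]. }
    assert (H0 : 0 < A ^ n) by (apply pow_lt; lra).
    pose proof (Rabs_pos (x - y)) as Hd. pose proof (pos_INR n).
    apply Rle_trans with (A * (INR n * A ^ n * Rabs (x - y)) + A ^ n * Rabs (x - y)).
    + apply Rplus_le_compat; apply Rmult_le_compat; auto; try apply Rabs_pos; lra.
    + replace ((INR n + 1) * A ^ S n * Rabs (x - y))
        with (A * (INR n * A ^ n * Rabs (x - y)) + A * (A ^ n * Rabs (x - y))) by (simpl; ring).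
      assert (0 <= A ^ n * Rabs (x - y)) by (apply Rmult_le_pos; lra). nra.
Qed.

Lemma mult_diff_le x y x' y' Q : Rabs x <= Q -> Rabs y' <= Q ->
  Rabs (x * y - x' * y') <= Q * (Rabs (x - x') + Rabs (y - y')).
Proof.
  intros H1 H2. replace (x * y - x' * y') with (x * (y - y') + y' * (x - x')) by ring.
  eapply Rle_trans; [apply Rabs_triang|]. rewrite !Rabs_mult.
  pose proof (Rabs_pos (x - x')). pose proof (Rabs_pos (y - y')). nra.
Qed.

(* [(d/dx + d/dy) (f^p * g)] when [df], [dg] are the values of [(d/dx + d/dy)] on [f], [g]. *)
Definition prodgrad (p : nat) (f df g dg : R) : R := INR p * (f ^ (p - 1) * df * g) + f ^ p * dg.

Lemma prodgrad_bound p f df g dg A : (1 <= p)%nat -> 1 <= A ->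
  Rabs f <= A -> Rabs df <= A -> Rabs g <= A -> Rabs dg <= A ->
  Rabs (prodgrad p f df g dg) <= (INR p + 1) * A ^ (p + 2).
Proof.
  intros Hp HA Hf Hdf Hg Hdg. unfold prodgrad.
  assert (Hpw : forall n, Rabs (f ^ n) <= A ^ n).
  { intros n. rewrite <- RPow_abs. apply pow_incr. split; [apply Rabs_pos|auto]. }
  eapply Rle_trans; [apply Rabs_triang|]. rewrite !Rabs_mult, (Rabs_pos_eq (INR p)) by apply pos_INR.
  rewrite Rmult_plus_distr_r. apply Rplus_le_compat.
  - apply Rmult_le_compat_l; [apply pos_INR|].
    apply Rle_trans with (A ^ (p - 1) * A * A).
    + repeat apply Rmult_le_compat; auto; repeat apply Rmult_le_pos; apply Rabs_pos.
    + replace (A ^ (p - 1) * A * A) with (A ^ (p + 1)).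
      * apply Rle_pow; auto; lia.
      * replace (p + 1)%nat with (S (S (p - 1))) by lia. simpl. ring.
  - apply Rle_trans with (A ^ p * A).
    + apply Rmult_le_compat; auto; apply Rabs_pos.
    + replace (A ^ p * A) with (A ^ (p + 1)) by (rewrite Nat.add_comm; simpl; ring).
      rewrite Rmult_1_l. apply Rle_pow; auto; lia.
Qed.

Lemma prodgrad_diff p f df g dg f' df' g' dg' A : (1 <= p)%nat -> 1 <= A ->
  Rabs f <= A -> Rabs df <= A -> Rabs g <= A -> Rabs dg <= A ->
  Rabs f' <= A -> Rabs df' <= A -> Rabs g' <= A -> Rabs dg' <= A ->
  Rabs (prodgrad p f df g dg - prodgrad p f' df' g' dg') <=
  (INR p + 1) ^ 2 * (A ^ (p + 2)) ^ 3 *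
  (Rabs (f - f') + Rabs (df - df') + Rabs (g - g') + Rabs (dg - dg')).
Proof.
  intros Hp HA Hf Hdf Hg Hdg Hf' Hdf' Hg' Hdg'.
  (* One majorant for all the powers of [A] that occur; the final constant is generous so that a
     single value serves every term. *)
  set (Q := A ^ (p + 2)).
  assert (HAQ : forall n, (n <= p + 2)%nat -> A ^ n <= Q) by (intros; apply Rle_pow; auto).
  assert (HQ1 : 1 <= Q) by (apply (HAQ 0%nat); lia).
  assert (HA1 : A <= Q) by (rewrite <- (pow_1 A) at 1; apply HAQ; lia).
  assert (Hpw : forall x n, Rabs x <= A -> (n <= p)%nat -> Rabs (x ^ n) <= Q).
  { intros x n Hx Hn. eapply Rle_trans; [|apply (HAQ n); lia]. rewrite <- RPow_abs.
    apply pow_incr. split; [apply Rabs_pos|auto]. }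
  assert (Hpd : forall n, (n <= p)%nat -> Rabs (f ^ n - f' ^ n) <= INR p * Q * Rabs (f - f')).
  { intros n Hn. eapply Rle_trans; [apply (pow_diff_le f f' A n); auto|].
    apply Rmult_le_compat_r; [apply Rabs_pos|].
    apply Rmult_le_compat; [apply pos_INR|apply pow_le; lra|apply le_INR; auto|apply HAQ; lia]. }
  set (D1 := Rabs (f - f')). set (D2 := Rabs (df - df')).
  set (D3 := Rabs (g - g')). set (D4 := Rabs (dg - dg')).
  assert (P1 : 0 <= D1) by apply Rabs_pos. assert (P2 : 0 <= D2) by apply Rabs_pos.
  assert (P3 : 0 <= D3) by apply Rabs_pos. assert (P4 : 0 <= D4) by apply Rabs_pos.
  assert (Hp1 : 1 <= INR p) by (apply (le_INR 1); auto).
  assert (M1 : Rabs (df * g - df' * g') <= Q * (D2 + D3)) by (apply mult_diff_le; lra).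
  assert (Hdg2 : Rabs (df' * g') <= Q).
  { rewrite Rabs_mult. apply Rle_trans with (A ^ 2); [|apply HAQ; lia].
    simpl. rewrite Rmult_1_r. apply Rmult_le_compat; auto; apply Rabs_pos. }
  assert (M2 : Rabs (f ^ (p - 1) * (df * g) - f' ^ (p - 1) * (df' * g'))
     <= Q * (INR p * Q * D1 + Q * (D2 + D3))).
  { eapply Rle_trans; [apply (mult_diff_le _ _ _ _ Q); auto; apply Hpw; auto; lia|].
    apply Rmult_le_compat_l; [lra|]. apply Rplus_le_compat; auto. apply Hpd; lia. }
  assert (M3 : Rabs (f ^ p * dg - f' ^ p * dg') <= Q * (INR p * Q * D1 + D4)).
  { eapply Rle_trans; [apply (mult_diff_le _ _ _ _ Q)|].
    - apply Hpw; auto.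
    - lra.
    - apply Rmult_le_compat_l; [lra|]. apply Rplus_le_compat; [apply Hpd; lia|unfold D4; lra]. }
  unfold prodgrad.
  replace (INR p * (f ^ (p - 1) * df * g) + f ^ p * dg - (INR p * (f' ^ (p - 1) * df' * g') + f' ^ p * dg'))
    with (INR p * (f ^ (p - 1) * (df * g) - f' ^ (p - 1) * (df' * g')) + (f ^ p * dg - f' ^ p * dg')) by ring.
  eapply Rle_trans; [apply Rabs_triang|]. rewrite Rabs_mult, (Rabs_pos_eq (INR p)) by lra.
  apply Rle_trans with (INR p * (Q * (INR p * Q * D1 + Q * (D2 + D3))) + Q * (INR p * Q * D1 + D4)).
  { apply Rplus_le_compat; auto. apply Rmult_le_compat_l; lra. }
  assert (Q2 : Q <= Q ^ 2) by nra. assert (Q3 : Q ^ 2 <= Q ^ 3) by (simpl; nra).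
  set (P := INR p) in *.
  replace (P * (Q * (P * Q * D1 + Q * (D2 + D3))) + Q * (P * Q * D1 + D4)) with
    ((P ^ 2 + P) * Q ^ 2 * D1 + P * Q ^ 2 * D2 + P * Q ^ 2 * D3 + Q * D4) by ring.
  assert (Hc : forall c, 0 <= c -> c <= (P + 1) ^ 2 -> c * Q ^ 2 <= (P + 1) ^ 2 * Q ^ 3).
  { intros c H0 H. apply Rmult_le_compat; try lra. }
  pose proof (Hc (P ^ 2 + P) ltac:(nra) ltac:(nra)). pose proof (Hc P ltac:(nra) ltac:(nra)).
  assert (Q <= (P + 1) ^ 2 * Q ^ 3) by (pose proof (Hc 1 ltac:(lra) ltac:(nra)); lra).
  rewrite !Rmult_plus_distr_l.
  repeat apply Rplus_le_compat; apply Rmult_le_compat_r; auto.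
Qed.

Section Product.
Variables (m : nat) (s : R) (p K : nat) (a0 b0 a1 b1 : Z * Z -> R) (X A : R).
Let N := (2 * m)%nat.
Hypothesis Hm : (1 <= m)%nat.
Hypothesis Hp : (1 <= p)%nat.
Hypothesis HpK : ((p + 1) * K < m)%nat.
Hypothesis HX : 0 <= X.
Hypothesis HA1 : 1 <= A.
Hypothesis HA0 : abs_sum a0 b0 A.
Hypothesis HA2 : abs_sum a1 b1 A.
Let T i j a b := gsub (gridval N (Fij i j a b)) (gridval N (Sij i j a b K)).
Hypothesis Htail0 : forall i j, (i + j <= 4)%nat -> hn N (T i j a0 b0) <= X * Rpower (INR N) (- s).
Hypothesis Htail1 : forall i j, (i + j <= 4)%nat -> hn N (T i j a1 b1) <= X * Rpower (INR N) (- s).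
Hypothesis Htail00 : hn N (T 0 0 a0 b0)%nat <= X * Rpower (INR N) (- (s + 4)).
Hypothesis Htail10 : hn N (T 0 0 a1 b1)%nat <= X * Rpower (INR N) (- (s + 4)).

Definition pgF a b a' b' x y : R :=
  prodgrad p (Fij 0 0 a b x y) (Fij 1 0 a b x y + Fij 0 1 a b x y)
    (Fij 0 0 a' b' x y) (Fij 1 0 a' b' x y + Fij 0 1 a' b' x y).

Definition pgS a b a' b' x y : R :=
  prodgrad p (Sij 0 0 a b K x y) (Sij 1 0 a b K x y + Sij 0 1 a b K x y)
    (Sij 0 0 a' b' K x y) (Sij 1 0 a' b' K x y + Sij 0 1 a' b' K x y).

Lemma opL_product_exact :
  opL' m (gridval N (fun x y => Sij 0 0 a0 b0 K x y ^ p * Sij 0 0 a1 b1 K x y))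
  = gridval N (pgS a0 b0 a1 b1).
Proof.
  assert (Hder : forall (f g : R -> R) x df dg, is_derive f x df -> is_derive g x dg ->
     is_derive (fun z => f z ^ p * g z) x (INR p * (f x ^ (p - 1) * df * g x) + f x ^ p * dg)).
  { intros f g x df dg H1 H2.
    replace (INR p * (f x ^ (p - 1) * df * g x) + f x ^ p * dg)
      with ((INR p * df * f x ^ pred p) * g x + f x ^ p * dg).
    - apply (is_derive_mult (fun z => f z ^ p) g); auto.
      + apply is_derive_pow; auto.
      + intros; apply Rmult_comm.
    - replace (p - 1)%nat with (pred p) by lia. ring. }
  destruct (trig_poly_exact_eq m ((p + 1) * K) (fun x y => Sij 0 0 a0 b0 K x y ^ p * Sij 0 0 a1 b1 K x y)
    (fun x y => INR p * (Sij 0 0 a0 b0 K x y ^ (p - 1) * Sij 1 0 a0 b0 K x y * Sij 0 0 a1 b1 K x y)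
        + Sij 0 0 a0 b0 K x y ^ p * Sij 1 0 a1 b1 K x y)
    (fun x y => INR p * (Sij 0 0 a0 b0 K x y ^ (p - 1) * Sij 0 1 a0 b0 K x y * Sij 0 0 a1 b1 K x y)
        + Sij 0 0 a0 b0 K x y ^ p * Sij 0 1 a1 b1 K x y)) as [E1 E2]; auto.
  - replace ((p + 1) * K)%nat with (p * K + K)%nat by lia.
    apply trig_poly_mult; [apply trig_poly_pow|]; apply trig_poly_Sij.
  - intros x y. apply (Hder (fun z => Sij 0 0 a0 b0 K z y) (fun z => Sij 0 0 a1 b1 K z y));
      apply Sij_derive_x.
  - intros x y. apply (Hder (fun z => Sij 0 0 a0 b0 K x z) (fun z => Sij 0 0 a1 b1 K x z));
      apply Sij_derive_y.
  - unfold opL'. fold N in E1, E2. fold N. rewrite E1, E2. apply fun2_ext; intros j1 j2.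
    unfold gadd, gridval, pgS, prodgrad. ring.
Qed.

Lemma hn_opL' U : hn N (opL' m U) <= 2 * (INR m ^ 1 * hn N U).
Proof.
  unfold opL'. eapply Rle_trans; [apply hn_triang; unfold N; lia|].
  pose proof (hn_ax m 1 U Hm). pose proof (hn_ay m 1 U Hm). unfold N. lra.
Qed.

Lemma opL'_gsub U V : opL' m (gsub U V) = gsub (opL' m U) (opL' m V).
Proof.
  unfold opL'. rewrite ax_gsub, ay_gsub. apply fun2_ext; intros. unfold gadd, gsub. ring.
Qed.

(** Inserting the truncated product, on which [L] is exact, leaves [L] of a difference of products
    and a difference of gradients. Both differences are bounded pointwise by tails, with a Lipschitz
    constant depending only on the sup bound ([2 A], since a gradient adds two derivatives); the
    factor [m] of [L] is paid by the faster tail. The contributions are 4 and 6 times [Q * W],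
    within the constant 16. *)
Lemma consistency_product :
  hn N (gsub (opL N (gmul (gpow (gridval N (Fij 0 0 a0 b0)) p) (gridval N (Fij 0 0 a1 b1))))
    (gridval N (pgF a0 b0 a1 b1)))
  <= 16 * ((INR p + 1) ^ 2 * ((2 * A) ^ (p + 2)) ^ 3) * X * Rpower (INR N) (- s).
Proof.
  assert (HN : (0 < N)%nat) by (unfold N; lia).
  set (Q := (INR p + 1) ^ 2 * ((2 * A) ^ (p + 2)) ^ 3).
  set (W := X * Rpower (INR N) (- s)).
  assert (HW : 0 <= W) by (apply Rmult_le_pos; auto; left; apply Rpower_pos).
  assert (Hp1 : 1 <= INR p) by (apply (le_INR 1); auto).
  assert (H2A : 1 <= (2 * A) ^ (p + 2)) by (apply pow_R1_Rle; lra).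
  assert (HQ : 0 <= Q) by (unfold Q; apply Rmult_le_pos; [nra|apply pow_le; lra]).
  set (UF := fun x y => Fij 0 0 a0 b0 x y ^ p * Fij 0 0 a1 b1 x y).
  set (US := fun x y => Sij 0 0 a0 b0 K x y ^ p * Sij 0 0 a1 b1 K x y).
  assert (BF0 : forall i j x y, (i + j <= 4)%nat -> Rabs (Fij i j a0 b0 x y) <= A) by (intros; eapply Fij_bound; eauto).
  assert (BF1 : forall i j x y, (i + j <= 4)%nat -> Rabs (Fij i j a1 b1 x y) <= A) by (intros; eapply Fij_bound; eauto).
  assert (BS0 : forall i j x y, (i + j <= 4)%nat -> Rabs (Sij i j a0 b0 K x y) <= A) by (intros; eapply Sij_bound; eauto).
  assert (BS1 : forall i j x y, (i + j <= 4)%nat -> Rabs (Sij i j a1 b1 K x y) <= A) by (intros; eapply Sij_bound; eauto).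
  assert (Htri : forall x y, Rabs x <= A -> Rabs y <= A -> Rabs (x + y) <= 2 * A).
  { intros x y H1 H2. eapply Rle_trans; [apply Rabs_triang|]. lra. }
  rewrite (hn_geq N _ (gsub (opL' m (gsub (gridval N UF) (gridval N US)))
     (gsub (gridval N (pgF a0 b0 a1 b1)) (gridval N (pgS a0 b0 a1 b1))))).
  2:{ intros j1 j2 H1 H2. rewrite opL'_gsub. unfold US. rewrite opL_product_exact.
      unfold gsub. rewrite (opL_geq m Hm _ j1 j2 H1 H2).
      change (gmul (gpow (gridval N (Fij 0 0 a0 b0)) p) (gridval N (Fij 0 0 a1 b1))) with (gridval N UF).
      ring. }
  eapply Rle_trans; [apply hn_sub; auto|].
  assert (E1 : hn N (gsub (gridval N UF) (gridval N US)) <= Q * (hn N (T 0 0 a0 b0)%nat + hn N (T 0 0 a1 b1)%nat)).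
  { eapply Rle_trans; [apply (hn_dominated N _ [true; false]
      (fun c => if c then T 0 0 a0 b0 else T 0 0 a1 b1)%nat Q HN HQ)|].
    - intros j1 j2. simpl. unfold gsub, T, gsub, gridval, UF, US.
      set (x := xg N j1). set (y := xg N j2).
      eapply Rle_trans; [apply (mult_diff_le _ _ _ _ ((2 * A) ^ p))|].
      + rewrite <- RPow_abs. apply pow_incr. split; [apply Rabs_pos|].
        pose proof (BF0 0%nat 0%nat x y ltac:(lia)). lra.
      + eapply Rle_trans; [apply BS1; lia|]. apply Rle_trans with ((2 * A) ^ 1); [lra|].
        apply Rle_pow; [lra|auto].
      + set (u := Fij 0 0 a0 b0 x y - Sij 0 0 a0 b0 K x y).
        set (v := Fij 0 0 a1 b1 x y - Sij 0 0 a1 b1 K x y).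
        pose proof (Rabs_pos u) as Pu. pose proof (Rabs_pos v) as Pv.
        pose proof (BF0 0%nat 0%nat x y ltac:(lia)) as B1.
        pose proof (BS0 0%nat 0%nat x y ltac:(lia)) as B2.
        pose proof (pow_diff_le (Fij 0 0 a0 b0 x y) (Sij 0 0 a0 b0 K x y) (2 * A) p
          ltac:(lra) ltac:(lra) ltac:(lra)) as Hpd. fold u in Hpd.
        set (Z := (2 * A) ^ p) in *. set (Z2 := (2 * A) ^ (p + 2)) in *.
        assert (Z1 : 1 <= Z) by (apply pow_R1_Rle; lra).
        assert (ZZ : Z <= Z2) by (apply Rle_pow; [lra|lia]).
        apply Rle_trans with (Z * (INR p * Z * Rabs u + Rabs v)); [apply Rmult_le_compat_l; lra|].
        assert (HZQ : INR p * (Z * Z) <= Q).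
        { unfold Q. apply Rmult_le_compat; nra. }
        assert (HZQ' : Z <= Q) by nra.
        replace (Z * (INR p * Z * Rabs u + Rabs v)) with (INR p * (Z * Z) * Rabs u + Z * Rabs v) by ring.
        rewrite Rplus_0_r, Rmult_plus_distr_l.
        apply Rplus_le_compat; apply Rmult_le_compat_r; auto.
    - simpl. right. ring. }
  assert (E2 : hn N (gsub (gridval N (pgF a0 b0 a1 b1)) (gridval N (pgS a0 b0 a1 b1))) <= Q * (6 * W)).
  { eapply Rle_trans; [apply (hn_dominated N _ [T 0 0 a0 b0; T 1 0 a0 b0; T 0 1 a0 b0;
        T 0 0 a1 b1; T 1 0 a1 b1; T 0 1 a1 b1]%nat (fun V => V) Q HN HQ)|].
    - intros j1 j2. cbn [sumL]. unfold gsub, T, gsub, gridval, pgF, pgS.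
      set (x := xg N j1). set (y := xg N j2).
      eapply Rle_trans; [apply (prodgrad_diff p _ _ _ _ _ _ _ _ (2 * A)); auto; try lra;
         first [apply Htri | match goal with |- Rabs _ <= _ => apply Rle_trans with A; [|lra] end];
         first [apply BF0 | apply BF1 | apply BS0 | apply BS1]; lia|].
      fold Q. apply Rmult_le_compat_l; auto.
      assert (Hsum : forall u v u' v', Rabs (u + v - (u' + v')) <= Rabs (u - u') + Rabs (v - v')).
      { intros. replace (u + v - (u' + v')) with ((u - u') + (v - v')) by ring. apply Rabs_triang. }
      pose proof (Hsum (Fij 1 0 a0 b0 x y) (Fij 0 1 a0 b0 x y) (Sij 1 0 a0 b0 K x y) (Sij 0 1 a0 b0 K x y)).
      pose proof (Hsum (Fij 1 0 a1 b1 x y) (Fij 0 1 a1 b1 x y) (Sij 1 0 a1 b1 K x y) (Sij 0 1 a1 b1 K x y)).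
      lra.
    - apply Rmult_le_compat_l; auto. cbn [sumL]. unfold W.
      pose proof (Htail0 0 0 ltac:(lia))%nat. pose proof (Htail0 1 0 ltac:(lia))%nat.
      pose proof (Htail0 0 1 ltac:(lia))%nat. pose proof (Htail1 0 0 ltac:(lia))%nat.
      pose proof (Htail1 1 0 ltac:(lia))%nat. pose proof (Htail1 0 1 ltac:(lia))%nat. lra. }
  pose proof (hn_opL' (gsub (gridval N UF) (gridval N US))) as E3.
  pose proof (pow_m_le m Hm s X HX 1 ltac:(lia)) as Hpm. fold N in Hpm. fold W in Hpm.
  assert (E4 : INR m ^ 1 * hn N (gsub (gridval N UF) (gridval N US)) <= Q * (2 * W)).
  { assert (Hm0 : 0 <= INR m ^ 1) by (apply pow_le, pos_INR).
    apply Rle_trans with (INR m ^ 1 * (Q * (2 * (X * Rpower (INR N) (- (s + 4)))))).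
    - apply Rmult_le_compat_l; auto. eapply Rle_trans; [apply E1|]. apply Rmult_le_compat_l; auto. lra.
    - replace (INR m ^ 1 * (Q * (2 * (X * Rpower (INR N) (- (s + 4))))))
        with (Q * (2 * (INR m ^ 1 * (X * Rpower (INR N) (- (s + 4)))))) by ring.
      apply Rmult_le_compat_l; auto. lra. }
  replace (16 * Q * X * Rpower (INR N) (- s)) with (16 * (Q * W)) by (unfold W; ring).
  assert (0 <= Q * W) by (apply Rmult_le_pos; auto). lra.
Qed.

End Product.

(** * The residual of the first step *)

Definition glinear (T : grid -> grid) : Prop :=
  forall U V c, T (gadd U (gscal c V)) = gadd (T U) (gscal c (T V)).

Lemma glinear_kron N A B : (0 < N)%nat -> glinear (kron N A B).
Proof.
  intros HN U V c. rewrite !kron_ax_ay by auto.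
  rewrite ax_gadd, ax_gscal, ay_gadd, ay_gscal. auto.
Qed.

Lemma glinear_sum T T' : glinear T -> glinear T' -> glinear (fun U => gadd (T U) (T' U)).
Proof.
  intros H H' U V c. rewrite H, H'. apply fun2_ext; intros. unfold gadd, gscal. ring.
Qed.

Lemma glinear_opA N : (0 < N)%nat -> glinear (opA N).
Proof. intros HN. apply glinear_sum; apply glinear_kron; auto. Qed.
Lemma glinear_opB N : (0 < N)%nat -> glinear (opB N).
Proof. intros HN. apply glinear_sum; apply glinear_kron; auto. Qed.
Lemma glinear_opL N : (0 < N)%nat -> glinear (opL N).
Proof. intros HN. apply glinear_sum; apply glinear_kron; auto. Qed.

Lemma glinear_gmul W : glinear (gmul W).
Proof. intros U V c. apply fun2_ext; intros. unfold gmul, gadd, gscal. ring. Qed.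

Lemma glinear_opD N p W : (0 < N)%nat -> glinear (opD N p W).
Proof.
  intros HN U V c. unfold opD.
  rewrite glinear_gmul, !glinear_opL, glinear_opB by auto.
  apply fun2_ext; intros. unfold gmul, gadd, gscal. ring.
Qed.

Lemma glinear_opIA2 N : (0 < N)%nat -> glinear (opIA2 N).
Proof.
  intros HN U V c. unfold opIA2. rewrite !glinear_opA by auto.
  apply fun2_ext; intros. unfold gadd, gscal. ring.
Qed.

Lemma abs_sum_mono a b A A' : abs_sum a b A -> A <= A' -> abs_sum a b A'.
Proof. intros H HA n. eapply Rle_trans; [apply H|auto]. Qed.

Lemma hn_cons_bound N U V c d : (0 < N)%nat -> hn N (gsub U V) <= c -> hn N V <= d -> hn N U <= c + d.
Proof.
  intros HN H1 H2. replace U with (gadd (gsub U V) V).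
  - eapply Rle_trans; [apply hn_triang; auto|]. lra.
  - apply fun2_ext; intros. unfold gadd, gsub. ring.
Qed.

Lemma Rpower_neg_le1 x s : 1 <= x -> 0 <= s -> Rpower x (- s) <= 1.
Proof.
  intros Hx Hs. rewrite <- (Rpower_O x) by lra. apply Rpower_le_exp; lra.
Qed.

(** The Lipschitz constant of [prodgrad_diff] for arguments bounded by [2 A]. *)
Definition prodconst (p : nat) (A : R) : R := (INR p + 1) ^ 2 * ((2 * A) ^ (p + 2)) ^ 3.

Lemma prodconst_ge p A : (1 <= p)%nat -> 1 <= A -> 1 <= prodconst p A /\ A ^ p <= prodconst p A /\
  (INR p + 1) * (2 * A) ^ (p + 2) <= prodconst p A.
Proof.
  intros Hp HA1. unfold prodconst. set (Z := (2 * A) ^ (p + 2)). assert (HZ : 1 <= Z) by (apply pow_R1_Rle; lra).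
  assert (Hp1 : 1 <= INR p) by (apply (le_INR 1); auto).
  assert (HAZ : A ^ p <= Z).
  { apply Rle_trans with (A ^ (p + 2)); [apply Rle_pow; auto; lia|]. apply pow_incr; lra. }
  assert (Z3 : Z <= Z ^ 3) by (assert (Z <= Z ^ 2) by nra; simpl in *; nra).
  assert (1 <= (INR p + 1) ^ 2) by nra. assert (INR p + 1 <= (INR p + 1) ^ 2) by nra.
  assert (Hmain : (INR p + 1) * Z <= (INR p + 1) ^ 2 * Z ^ 3) by (apply Rmult_le_compat; lra).
  repeat split; nra.
Qed.

Section Residual.
Variables (m : nat) (s : R) (p K : nat) (X A : R).
Let N := (2 * m)%nat.
Hypothesis Hm : (1 <= m)%nat.
Hypothesis Hs : 1 < s.
Hypothesis Hp : (1 <= p)%nat.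
Hypothesis HpK : ((p + 1) * K < m)%nat.
Hypothesis HX : 0 <= X.
Hypothesis HA1 : 1 <= A.

Definition well_truncated (a b : Z * Z -> R) : Prop :=
  abs_sum a b A /\
  (forall i j, (i + j <= 4)%nat ->
     hn N (gsub (gridval N (Fij i j a b)) (gridval N (Sij i j a b K))) <= X * Rpower (INR N) (- s)) /\
  hn N (gsub (gridval N (Fij 0 0 a b)) (gridval N (Sij 0 0 a b K))) <= X * Rpower (INR N) (- (s + 4)).

Let Qc := prodconst p A.
Let Qc_ge := prodconst_ge p A Hp HA1.

Let HN : (0 < N)%nat.
Proof. unfold N; lia. Qed.
Let HKm : (K < m)%nat.
Proof. nia. Qed.
Let HR : 0 < Rpower (INR N) (- s) <= 1.
Proof.
  split; [apply Rpower_pos|]. apply Rpower_neg_le1; [|lra]. apply (le_INR 1). unfold N; lia.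
Qed.

Lemma hn_gF a b i j : well_truncated a b -> (i + j <= 4)%nat -> hn N (gridval N (Fij i j a b)) <= A.
Proof.
  intros (H & _) Hij. apply hn_sup; auto; [lra|]. intros. eapply Fij_bound; eauto.
Qed.

Lemma bound_A2 a b : well_truncated a b -> hn N (opA N (opA N (gridval N (Fij 0 0 a b)))) <= 8 * X + 4 * A.
Proof.
  intros H. eapply hn_cons_bound; auto.
  - eapply Rle_trans; [apply (consistency_A2 m Hm s K a b X HKm HX); apply H|]. fold N. nra.
  - pose proof (hn_gF a b 4 0 H ltac:(lia)). pose proof (hn_gF a b 2 2 H ltac:(lia)).
    pose proof (hn_gF a b 0 4 H ltac:(lia)).
    eapply Rle_trans; [apply hn_triang; auto|].
    eapply Rle_trans; [apply Rplus_le_compat_l, hn_triang; auto|].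
    eapply Rle_trans; [apply Rplus_le_compat_l, Rplus_le_compat_l, hn_triang; auto|]. fold N. lra.
Qed.

Lemma bound_B a b : well_truncated a b -> hn N (opB N (gridval N (Fij 0 0 a b))) <= 8 * X + 4 * A.
Proof.
  intros H. eapply Rle_trans; [eapply hn_cons_bound; auto|].
  - eapply Rle_trans; [apply (consistency_B m Hm s K a b X HKm HX); apply H|].
    fold N. instantiate (1 := 4 * X). nra.
  - pose proof (hn_gF a b 3 0 H ltac:(lia)). pose proof (hn_gF a b 1 2 H ltac:(lia)).
    eapply Rle_trans; [apply hn_triang; auto|]. fold N. instantiate (1 := 2 * A). lra.
  - lra.
Qed.

Lemma bound_L a b : well_truncated a b -> hn N (opL N (gridval N (Fij 0 0 a b))) <= 8 * X + 4 * A.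
Proof.
  intros H. eapply Rle_trans; [eapply hn_cons_bound; auto|].
  - eapply Rle_trans; [apply (consistency_L m Hm s K a b X HKm HX); apply H|].
    fold N. instantiate (1 := 4 * X). nra.
  - pose proof (hn_gF a b 1 0 H ltac:(lia)). pose proof (hn_gF a b 0 1 H ltac:(lia)).
    eapply Rle_trans; [apply hn_triang; auto|]. fold N. instantiate (1 := 2 * A). lra.
  - lra.
Qed.

Lemma bound_prod a b a' b' : well_truncated a b -> well_truncated a' b' ->
  hn N (opL N (gmul (gpow (gridval N (Fij 0 0 a b)) p) (gridval N (Fij 0 0 a' b'))))
  <= Qc * (16 * X + 1).
Proof.
  intros (H1 & H2 & H3) (I1 & I2 & I3). assert (Q1 : 1 <= Qc) by apply Qc_ge.
  assert (Q2 : (INR p + 1) * (2 * A) ^ (p + 2) <= Qc) by apply Qc_ge.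
  eapply Rle_trans; [eapply hn_cons_bound; auto|].
  - eapply Rle_trans; [apply (consistency_product m s p K a b a' b' X A Hm Hp HpK HX HA1 H1 I1 H2 I2 H3 I3)|].
    fold N. instantiate (1 := Qc * (16 * X)).
    change ((INR p + 1) ^ 2 * ((2 * A) ^ (p + 2)) ^ 3) with Qc.
    replace (16 * Qc * X * Rpower (INR N) (- s)) with (Qc * (16 * X) * Rpower (INR N) (- s)) by ring.
    assert (0 <= Qc * (16 * X)) by (apply Rmult_le_pos; lra). nra.
  - eapply Rle_trans; [|apply Q2]. apply hn_sup; auto.
    + pose proof (pos_INR p). apply Rmult_le_pos; [lra|apply pow_le; lra].
    + intros j1 j2 _ _. unfold gridval, pgF.
      assert (B0 : forall i j x y, (i + j <= 4)%nat -> Rabs (Fij i j a b x y) <= A) by (intros; eapply Fij_bound; eauto).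
      assert (B1 : forall i j x y, (i + j <= 4)%nat -> Rabs (Fij i j a' b' x y) <= A) by (intros; eapply Fij_bound; eauto).
      assert (Htri : forall x y, Rabs x <= A -> Rabs y <= A -> Rabs (x + y) <= 2 * A).
      { intros x y E1 E2. eapply Rle_trans; [apply Rabs_triang|]. lra. }
      apply prodgrad_bound; auto; try lra;
        first [apply Htri | match goal with |- Rabs _ <= _ => apply Rle_trans with A; [|lra] end];
        first [apply B0 | apply B1]; lia.
  - lra.
Qed.

(** With [eta = u_t(0) + tau * remainder] the residual splits as [E1 + tau * E2]. The equation at
    time 0 removes the exact terms, so [E1] is a combination of consistency errors; [E2] need only
    be bounded. *)
Lemma residual_fixed a0 b0 a1 b1 ar br tau T :
  well_truncated a0 b0 -> well_truncated a1 b1 -> well_truncated ar br -> 0 <= tau <= T ->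
  (forall x y, Fij 0 0 a1 b1 x y
     + (Fij 4 0 a1 b1 x y + (Fij 2 2 a1 b1 x y + (Fij 2 2 a1 b1 x y + Fij 0 4 a1 b1 x y)))
     + (Fij 3 0 a0 b0 x y + Fij 1 2 a0 b0 x y)
     + (1 + Fij 0 0 a0 b0 x y ^ p) * (Fij 1 0 a0 b0 x y + Fij 0 1 a0 b0 x y) = 0) ->
  let g0 := gridval N (Fij 0 0 a0 b0) in
  let eta := gadd (gridval N (Fij 0 0 a1 b1)) (gscal tau (gridval N (Fij 0 0 ar br))) in
  hn N (gadd (opIA2 N eta) (opD N p g0 (gadd g0 (gscal (tau / 2) eta))))
  <= (Qc * (8 * X + 4 * X + (4 * X + 4 * X) + 16 * Qc * X) +
      Qc * (1 + T) * (A + 5 * (8 * X + 4 * A) + 2 * (Qc * (16 * X + 1)))) *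
     (Rpower (INR N) (- s) + tau).
Proof.
  intros H0 H1 Hr Htau PDE g0 eta.
  set (g1 := gridval N (Fij 0 0 a1 b1)) in *. set (gr := gridval N (Fij 0 0 ar br)) in *.
  assert (Q1 : 1 <= Qc) by apply Qc_ge.
  assert (QA : A ^ p <= Qc) by apply Qc_ge. set (Q := Qc) in *.
  set (kap := / (INR p + 2)).
  assert (Hkap : 0 < kap <= 1).
  { unfold kap. pose proof (pos_INR p). split; [apply Rinv_0_lt_compat; lra|].
    rewrite <- Rinv_1. apply Rinv_le_contravar; lra. }
  set (gF := fun i j a b => gridval N (Fij i j a b)).
  (* The four consistency errors: [A^2] on the time derivative, then [B], [L] and the product on
     [u], all at time 0. *)
  set (v1 := gsub (opA N (opA N g1)) (gadd (gF 4 0 a1 b1) (gadd (gF 2 2 a1 b1) (gadd (gF 2 2 a1 b1) (gF 0 4 a1 b1))))%nat).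
  set (v2 := gsub (opB N g0) (gadd (gF 3 0 a0 b0) (gF 1 2 a0 b0))%nat).
  set (v3 := gsub (opL N g0) (gadd (gF 1 0 a0 b0) (gF 0 1 a0 b0))%nat).
  set (v4 := gsub (opL N (gmul (gpow g0 p) g0)) (gridval N (pgF p a0 b0 a0 b0))).
  set (E1 := fun j1 j2 => v1 j1 j2 + v2 j1 j2 + v3 j1 j2 + kap * (g0 j1 j2 ^ p * v3 j1 j2) + kap * v4 j1 j2).
  set (Lp1 := opL N (gmul (gpow g0 p) g1)). set (Lpr := opL N (gmul (gpow g0 p) gr)).
  set (E2 := fun j1 j2 => gr j1 j2 + opA N (opA N gr) j1 j2
     + / 2 * (opB N g1 j1 j2 + tau * opB N gr j1 j2 + opL N g1 j1 j2 + tau * opL N gr j1 j2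
       + kap * (g0 j1 j2 ^ p * (opL N g1 j1 j2 + tau * opL N gr j1 j2) + Lp1 j1 j2 + tau * Lpr j1 j2))).
  assert (ED : gadd (opIA2 N eta) (opD N p g0 (gadd g0 (gscal (tau / 2) eta))) = gadd E1 (gscal tau E2)).
  { unfold eta. rewrite (glinear_opIA2 N HN), !(glinear_opD N p g0 HN).
    apply fun2_ext; intros j1 j2. unfold opIA2, opD, gmul, gadd, gscal, gpow, E1, E2.
    fold (gadd g1 (gscal tau gr)).
    change (fun j3 j4 => g0 j3 j4 ^ p * g0 j3 j4) with (gmul (gpow g0 p) g0).
    change (fun j3 j4 => g0 j3 j4 ^ p * g1 j3 j4) with (gmul (gpow g0 p) g1).
    change (fun j3 j4 => g0 j3 j4 ^ p * gr j3 j4) with (gmul (gpow g0 p) gr).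
    fold Lp1 Lpr kap. unfold v1, v2, v3, v4, gsub, gadd, gF, gridval, pgF, prodgrad.
    specialize (PDE (xg N j1) (xg N j2)).
    set (x := xg N j1) in *. set (y := xg N j2) in *.
    assert (G0 : g0 j1 j2 = Fij 0 0 a0 b0 x y) by reflexivity.
    assert (G1 : g1 j1 j2 = Fij 0 0 a1 b1 x y) by reflexivity.
    rewrite G0, G1.
    assert (Ep : Fij 0 0 a0 b0 x y ^ p = Fij 0 0 a0 b0 x y ^ (p - 1) * Fij 0 0 a0 b0 x y).
    { replace p with (S (p - 1)) at 1 by lia. simpl. ring. }
    (* The split form is consistent because [f^p df] and the gradient [(p + 1) f^p df] of [f^(p+1)]
       add up to [(p + 2) f^p df]. *)
    assert (Ek : kap * (INR p + 2) = 1).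
    { unfold kap. apply Rinv_l. pose proof (pos_INR p). lra. }
    set (f := Fij 0 0 a0 b0 x y) in *. set (fp := f ^ (p - 1)) in *.
    set (df := Fij 1 0 a0 b0 x y + Fij 0 1 a0 b0 x y) in *.
    rewrite Ep in PDE |- *.
    assert (P1 : Fij 0 0 a1 b1 x y = - (Fij 4 0 a1 b1 x y
       + (Fij 2 2 a1 b1 x y + (Fij 2 2 a1 b1 x y + Fij 0 4 a1 b1 x y))
     + (Fij 3 0 a0 b0 x y + Fij 1 2 a0 b0 x y)
     + (1 + kap * (INR p + 2) * (fp * f)) * df)) by (rewrite Ek; lra).
    rewrite P1. field. }
  rewrite ED.
  assert (BD0 : forall x y, Rabs (Fij 0 0 a0 b0 x y ^ p) <= Q).
  { intros x y. eapply Rle_trans; [|apply QA]. rewrite <- RPow_abs. apply pow_incr.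
    split; [apply Rabs_pos|]. eapply Fij_bound; [apply H0|lia]. }
  (* [v3] is listed twice because it enters [E1] both on its own and multiplied by the nonlinear
     coefficient. *)
  assert (HE1 : hn N E1 <= Q * sumL [v1; v2; v3; v3; v4] (fun V => hn N V)).
  { apply (hn_dominated N E1 [v1; v2; v3; v3; v4] (fun V => V)); auto; [lra|].
    intros j1 j2. cbn [sumL]. unfold E1.
    specialize (BD0 (xg N j1) (xg N j2)). fold (gridval N (Fij 0 0 a0 b0) j1 j2) in BD0. fold g0 in BD0.
    set (W := g0 j1 j2 ^ p) in *.
    eapply Rle_trans; [apply Rabs_triang|]. eapply Rle_trans; [apply Rplus_le_compat_r, Rabs_triang|].
    eapply Rle_trans; [do 2 apply Rplus_le_compat_r; apply Rabs_triang|].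
    eapply Rle_trans; [do 3 apply Rplus_le_compat_r; apply Rabs_triang|].
    rewrite !Rabs_mult, !(Rabs_pos_eq kap) by lra.
    pose proof (Rabs_pos (v1 j1 j2)). pose proof (Rabs_pos (v2 j1 j2)). pose proof (Rabs_pos (v3 j1 j2)).
    pose proof (Rabs_pos (v4 j1 j2)). pose proof (Rabs_pos W).
    assert (Rabs W * Rabs (v3 j1 j2) <= Q * Rabs (v3 j1 j2)) by (apply Rmult_le_compat_r; auto).
    assert (0 <= Rabs W * Rabs (v3 j1 j2)) by (apply Rmult_le_pos; auto).
    assert (kap * (Rabs W * Rabs (v3 j1 j2)) <= Q * Rabs (v3 j1 j2)) by nra.
    assert (kap * Rabs (v4 j1 j2) <= Q * Rabs (v4 j1 j2)) by (apply Rmult_le_compat_r; lra).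
    nra. }
  (* The factor [1 + T] covers the terms of [E2] that still carry a [tau]. *)
  assert (HE2 : hn N E2 <= Q * (1 + T) * sumL [gr; opA N (opA N gr); opB N g1; opB N gr; opL N g1; opL N gr; Lp1; Lpr]
     (fun V => hn N V)).
  { assert (HQT : 1 <= Q * (1 + T)) by nra.
    apply (hn_dominated N E2 [gr; opA N (opA N gr); opB N g1; opB N gr; opL N g1; opL N gr; Lp1; Lpr] (fun V => V));
      auto; [lra|].
    intros j1 j2. cbn [sumL]. unfold E2.
    specialize (BD0 (xg N j1) (xg N j2)). fold (gridval N (Fij 0 0 a0 b0) j1 j2) in BD0. fold g0 in BD0.
    set (W := g0 j1 j2 ^ p) in *.
    generalize (gr j1 j2) (opA N (opA N gr) j1 j2) (opB N g1 j1 j2) (opB N gr j1 j2)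
      (opL N g1 j1 j2) (opL N gr j1 j2) (Lp1 j1 j2) (Lpr j1 j2).
    intros w1 w2 w3 w4 w5 w6 w7 w8.
    assert (Hc : forall c w, Rabs c <= Q * (1 + T) -> Rabs (c * w) <= Q * (1 + T) * Rabs w).
    { intros c w Hcw. rewrite Rabs_mult. apply Rmult_le_compat_r; auto. apply Rabs_pos. }
    replace (w1 + w2 + / 2 * (w3 + tau * w4 + w5 + tau * w6 + kap * (W * (w5 + tau * w6) + w7 + tau * w8)))
      with (1 * w1 + 1 * w2 + / 2 * w3 + (/ 2 * tau) * w4 + (/ 2 * (1 + kap * W)) * w5 +
        (/ 2 * (tau * (1 + kap * W))) * w6 + (/ 2 * kap) * w7 + (/ 2 * (kap * tau)) * w8) by ring.
    assert (HkW : Rabs (1 + kap * W) <= 2 * Q).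
    { eapply Rle_trans; [apply Rabs_triang|]. rewrite Rabs_R1, Rabs_mult, (Rabs_pos_eq kap) by lra.
      pose proof (Rabs_pos W). nra. }
    assert (B1 : Rabs (1 * w1) <= Q * (1 + T) * Rabs w1) by (apply Hc; rewrite Rabs_R1; lra).
    assert (B2 : Rabs (1 * w2) <= Q * (1 + T) * Rabs w2) by (apply Hc; rewrite Rabs_R1; lra).
    assert (B3 : Rabs (/ 2 * w3) <= Q * (1 + T) * Rabs w3) by (apply Hc; rewrite Rabs_pos_eq; lra).
    assert (B4 : Rabs (/ 2 * tau * w4) <= Q * (1 + T) * Rabs w4) by (apply Hc; rewrite Rabs_pos_eq; nra).
    assert (B5 : Rabs (/ 2 * (1 + kap * W) * w5) <= Q * (1 + T) * Rabs w5).
    { apply Hc. rewrite Rabs_mult, (Rabs_pos_eq (/ 2)) by lra. nra. }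
    assert (B6 : Rabs (/ 2 * (tau * (1 + kap * W)) * w6) <= Q * (1 + T) * Rabs w6).
    { apply Hc. rewrite !Rabs_mult, (Rabs_pos_eq (/ 2)), (Rabs_pos_eq tau) by lra.
      pose proof (Rabs_pos (1 + kap * W)).
      apply Rle_trans with (/ 2 * (T * (2 * Q))); [|nra].
      apply Rmult_le_compat_l; [lra|]. apply Rmult_le_compat; lra. }
    assert (B7 : Rabs (/ 2 * kap * w7) <= Q * (1 + T) * Rabs w7) by (apply Hc; rewrite Rabs_pos_eq; nra).
    assert (B8 : Rabs (/ 2 * (kap * tau) * w8) <= Q * (1 + T) * Rabs w8).
    { apply Hc. rewrite Rabs_pos_eq by nra. assert (kap * tau <= 1 * T) by (apply Rmult_le_compat; lra). nra. }
    apply Rabs_le_between in B1, B2, B3, B4, B5, B6, B7, B8.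
    apply Rabs_le. rewrite !Rmult_plus_distr_l, Rmult_0_r. lra. }
  eapply Rle_trans; [apply hn_triang; auto|]. rewrite hn_scal, Rabs_pos_eq by lra.
  set (W := Rpower (INR N) (- s)) in *.
  assert (S1 : sumL [v1; v2; v3; v3; v4] (fun V => hn N V)
     <= (8 * X + 4 * X + (4 * X + 4 * X) + 16 * Q * X) * W).
  { cbn [sumL].
    pose proof (consistency_A2 m Hm s K a1 b1 X HKm HX (proj1 (proj2 H1)) (proj2 (proj2 H1))) as C1.
    pose proof (consistency_B m Hm s K a0 b0 X HKm HX (proj1 (proj2 H0)) (proj2 (proj2 H0))) as C2.
    pose proof (consistency_L m Hm s K a0 b0 X HKm HX (proj1 (proj2 H0)) (proj2 (proj2 H0))) as C3.
    pose proof (consistency_product m s p K a0 b0 a0 b0 X A Hm Hp HpK HX HA1 (proj1 H0) (proj1 H0)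
      (proj1 (proj2 H0)) (proj1 (proj2 H0)) (proj2 (proj2 H0)) (proj2 (proj2 H0))) as C4.
    assert (C1' : hn N v1 <= 8 * X * W) by exact C1.
    assert (C2' : hn N v2 <= 4 * X * W) by exact C2.
    assert (C3' : hn N v3 <= 4 * X * W) by exact C3.
    assert (C4' : hn N v4 <= 16 * Q * X * W) by exact C4. lra. }
  assert (S2 : sumL [gr; opA N (opA N gr); opB N g1; opB N gr; opL N g1; opL N gr; Lp1; Lpr] (fun V => hn N V)
     <= A + 5 * (8 * X + 4 * A) + 2 * (Q * (16 * X + 1))).
  { cbn [sumL].
    assert (hn N gr <= A) by (apply (hn_gF ar br 0 0 Hr); lia).
    assert (hn N (opA N (opA N gr)) <= 8 * X + 4 * A) by (apply (bound_A2 ar br Hr)).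
    assert (hn N (opB N g1) <= 8 * X + 4 * A) by (apply (bound_B a1 b1 H1)).
    assert (hn N (opB N gr) <= 8 * X + 4 * A) by (apply (bound_B ar br Hr)).
    assert (hn N (opL N g1) <= 8 * X + 4 * A) by (apply (bound_L a1 b1 H1)).
    assert (hn N (opL N gr) <= 8 * X + 4 * A) by (apply (bound_L ar br Hr)).
    assert (hn N Lp1 <= Q * (16 * X + 1)) by (apply (bound_prod a0 b0 a1 b1 H0 H1)).
    assert (hn N Lpr <= Q * (16 * X + 1)) by (apply (bound_prod a0 b0 ar br H0 Hr)). lra. }
  set (c1 := 8 * X + 4 * X + (4 * X + 4 * X) + 16 * Q * X) in *.
  set (c2 := A + 5 * (8 * X + 4 * A) + 2 * (Q * (16 * X + 1))) in *.
  assert (0 <= c1) by (unfold c1; nra).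
  assert (0 <= c2) by (unfold c2; nra).
  assert (F1 : hn N E1 <= Q * c1 * W).
  { eapply Rle_trans; [apply HE1|]. rewrite Rmult_assoc. apply Rmult_le_compat_l; lra. }
  assert (F2 : hn N E2 <= Q * (1 + T) * c2).
  { eapply Rle_trans; [apply HE2|]. apply Rmult_le_compat_l; auto. nra. }
  assert (F3 : tau * hn N E2 <= Q * (1 + T) * c2 * tau).
  { rewrite (Rmult_comm tau). apply Rmult_le_compat_r; lra. }
  assert (0 <= Q * c1) by nra. assert (0 <= Q * (1 + T) * c2) by (apply Rmult_le_pos; auto; nra).
  assert (0 <= W) by lra.
  apply Rle_trans with (Q * c1 * W + Q * (1 + T) * c2 * tau); [lra|].
  replace (8 * X + 4 * X + (4 * X + 4 * X) + 16 * Q * X) with c1 by reflexivity.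
  assert (0 <= Q * c1 * tau) by (apply Rmult_le_pos; lra).
  assert (0 <= Q * (1 + T) * c2 * W) by (apply Rmult_le_pos; lra).
  lra.
Qed.

End Residual.

Lemma residual_bound s p B T : 1 < s -> (1 <= p)%nat -> 0 <= T -> exists C, 0 < C /\
  forall m a0 b0 a1 b1 ar br tau, (1 <= m)%nat ->
  HB s a0 b0 B -> HB s a1 b1 B -> HB s ar br B -> 0 <= tau <= T ->
  (forall x y, Fij 0 0 a1 b1 x y
     + (Fij 4 0 a1 b1 x y + (Fij 2 2 a1 b1 x y + (Fij 2 2 a1 b1 x y + Fij 0 4 a1 b1 x y)))
     + (Fij 3 0 a0 b0 x y + Fij 1 2 a0 b0 x y)
     + (1 + Fij 0 0 a0 b0 x y ^ p) * (Fij 1 0 a0 b0 x y + Fij 0 1 a0 b0 x y) = 0) ->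
  let N := (2 * m)%nat in
  let g0 := gridval N (Fij 0 0 a0 b0) in
  let eta := gadd (gridval N (Fij 0 0 a1 b1)) (gscal tau (gridval N (Fij 0 0 ar br))) in
  hn N (gadd (opIA2 N eta) (opD N p g0 (gadd g0 (gscal (tau / 2) eta))))
  <= C * (Rpower (INR N) (- s) + tau).
Proof.
  intros Hs Hp HT. destruct (tail_bound s p Hs) as (Ct & HCt & Htail).
  destruct (HB_abs_sum s Hs) as (Ca & HCa & Habs).
  pose proof (sqrt_pos B) as HB0.
  set (X := Ct * sqrt B). set (A := 1 + Ca * sqrt B).
  assert (HX : 0 <= X) by (apply Rmult_le_pos; lra).
  assert (HA : 1 <= A) by (unfold A; assert (0 <= Ca * sqrt B) by (apply Rmult_le_pos; lra); lra).
  destruct (prodconst_ge p A Hp HA) as (Q1 & _ & _). set (Q := prodconst p A) in *.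
  exists (Q * (8 * X + 4 * X + (4 * X + 4 * X) + 16 * Q * X) +
      Q * (1 + T) * (A + 5 * (8 * X + 4 * A) + 2 * (Q * (16 * X + 1)))).
  split.
  { assert (0 <= Q * X) by nra.
    apply Rplus_le_lt_0_compat.
    - apply Rmult_le_pos; nra.
    - apply Rmult_lt_0_compat; nra. }
  intros m a0 b0 a1 b1 ar br tau Hm H0 H1 Hr Htau PDE N g0 eta.
  (* The largest [K] with [(p + 1) K < m]: below the aliasing threshold of the product, yet with
     [(p + 1) (K + 1) >= m] as the tail estimate requires. *)
  set (K := ((m - 1) / (p + 1))%nat).
  assert (HK1 : ((p + 1) * K < m)%nat).
  { pose proof (Nat.Div0.mul_div_le (m - 1) (p + 1)). unfold K. lia. }
  assert (HK2 : (m <= (p + 1) * (K + 1))%nat).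
  { pose proof (Nat.mul_succ_div_gt (m - 1) (p + 1) ltac:(lia)). unfold K. lia. }
  assert (Hwt : forall a b, HB s a b B -> well_truncated m s K X A a b).
  { intros a b Hab. destruct (Htail m K a b B Hm HK2 Hab) as [T1 T2].
    split; [|split; [exact T1|exact T2]].
    apply (abs_sum_mono a b (Ca * sqrt B)); [apply Habs; auto|unfold A; lra]. }
  apply (residual_fixed m s p K X A Hm Hs Hp HK1 HX HA a0 b0 a1 b1 ar br tau T); auto.
Qed.

(** * Energy estimate and discrete Sobolev inequality *)

Lemma ip_geq N U U' V V' : geq N U U' -> geq N V V' -> ip N U V = ip N U' V'.
Proof.
  intros H H'. apply sumL_ext. intros j Hj. apply in_G in Hj. rewrite H, H' by tauto. auto.
Qed.

Lemma ip_sym N U V : ip N U V = ip N V U.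
Proof. apply sumL_ext. intros; ring. Qed.

Lemma ip_gadd_l N U U' V : ip N (gadd U U') V = ip N U V + ip N U' V.
Proof. unfold ip. rewrite <- sumL_plus. apply sumL_ext. intros; unfold gadd; ring. Qed.

Lemma ip_gscal_l N c U V : ip N (gscal c U) V = c * ip N U V.
Proof. unfold ip. rewrite <- sumL_scal. apply sumL_ext. intros; unfold gscal; ring. Qed.

Lemma ip_gadd_r N U V V' : ip N U (gadd V V') = ip N U V + ip N U V'.
Proof. rewrite !(ip_sym N U). apply ip_gadd_l. Qed.

Lemma ip_gmul N W U V : ip N (gmul W U) V = ip N U (gmul W V).
Proof. apply sumL_ext. intros; unfold gmul; ring. Qed.

Lemma ip_self N U : (0 < N)%nat -> ip N U U = INR N ^ 2 * hn N U ^ 2.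
Proof. intros HN. rewrite hn_sqr by auto. apply sumL_ext. intros; ring. Qed.

Lemma ip_CS N U V : (0 < N)%nat -> ip N U V <= INR N ^ 2 * (hn N U * hn N V).
Proof.
  intros HN. assert (0 < INR N) by (apply lt_0_INR; auto).
  eapply Rle_trans; [apply Rle_abs|].
  eapply Rle_trans; [apply (l2_CS (G N) (fun j => U (fst j) (snd j)) (fun j => V (fst j) (snd j)))|].
  unfold hn. right. field. lra.
Qed.

Lemma sumL_lap {I} (l : list I) (f0 f1 f2 f3 f4 : I -> R) d :
  sumL l (fun k => (f1 k - 2 * f0 k + f2 k) / d + (f3 k - 2 * f0 k + f4 k) / d)
  = (sumL l f1 - 2 * sumL l f0 + sumL l f2) / d + (sumL l f3 - 2 * sumL l f0 + sumL l f4) / d.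
Proof. induction l as [|k l IH]; simpl; [unfold Rdiv; ring|]. rewrite IH. unfold Rdiv. ring. Qed.

Section Energy.
Variable m : nat.
Hypothesis Hm : (1 <= m)%nat.
Let N := (2 * m)%nat.
Let HN : (0 < N)%nat.
Proof. unfold N; lia. Qed.

Lemma ip_opA' U V : ip N (opA' m U) V = ip N U (opA' m V).
Proof.
  unfold opA'. rewrite ip_gadd_l, ip_gadd_r. unfold N. rewrite ip_ax, ip_ay by auto. ring.
Qed.

Lemma ip_opL' U V : ip N (opL' m U) V = - ip N U (opL' m V).
Proof.
  unfold opL'. rewrite ip_gadd_l, ip_gadd_r. unfold N. rewrite ip_ax, ip_ay by auto. ring.
Qed.

(** The third-order matrix is antisymmetric, and the mixed term is a product of a symmetric and an
    antisymmetric matrix acting along different axes, which commute. *)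
Lemma ip_opB'_self U : ip N (opB' m U) U = 0.
Proof.
  unfold opB'. rewrite ip_gadd_l. unfold N.
  assert (H1 := ip_ax m 3 U U Hm). rewrite (ip_sym _ U) in H1.
  assert (H2 := ip_ay m 2 (ax (2 * m) (Dmat (2 * m) 1) U) U Hm).
  assert (H3 := ip_ax m 1 U (ay (2 * m) (Dmat (2 * m) 2) U) Hm).
  rewrite ax_ay_comm, (ip_sym _ U) in H3. lra.
Qed.

(** The transpose of [L diag(W^p)] is [- diag(W^p) L], so the two halves of the split nonlinear term
    cancel in the pairing, for any [W]. *)
Lemma ip_opD_self p W U : ip N (opD N p W U) U = 0.
Proof.
  set (Wp := gpow W p).
  rewrite (ip_geq N _ (gadd (gadd (opB' m U) (opL' m U))
       (gscal (/ (INR p + 2)) (gadd (gmul Wp (opL' m U)) (opL' m (gmul Wp U))))) U U).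
  - rewrite !ip_gadd_l, ip_gscal_l, ip_gadd_l, ip_opB'_self, ip_gmul, (ip_opL' (gmul Wp U)).
    assert (H := ip_opL' U U). rewrite (ip_sym N U) in H.
    rewrite (ip_sym N (gmul Wp U)).
    replace (ip N (opL' m U) U) with 0 by lra. ring.
  - intros j1 j2 H1 H2. unfold opD. fold Wp. unfold gadd, gscal, gmul at 1 3.
    rewrite (opB_geq m Hm _ j1 j2 H1 H2), !(opL_geq m Hm _ j1 j2 H1 H2). auto.
  - intros j1 j2 _ _. auto.
Qed.

Lemma energy_estimate p W tau e r : 0 < tau ->
  geq N (gadd (opIA2 N (gscal (/ tau) e)) (opD N p W (gscal (/ 2) e))) r ->
  hn N e <= tau * hn N r /\ hn N (opA' m e) <= tau * hn N r.
Proof.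
  intros Ht H.
  assert (HNr : 0 < INR N) by (apply lt_0_INR; auto).
  assert (Hgs : forall c U, gscal c U = gadd (gscal 0 U) (gscal c U)).
  { intros. apply fun2_ext; intros. unfold gadd, gscal. ring. }
  (* Homogeneity from [glinear]: the image of the null grid vanishes, being equal to its difference
     with itself. *)
  assert (Hlin : forall T c U, glinear T -> T (gscal c U) = gscal c (T U)).
  { intros T c U HT.
    assert (T0 : T (gscal 0 U) = gscal 0 (T U)).
    { pose proof (HT (gscal 0 U) (gscal 0 U) (-1)) as E.
      replace (gadd (gscal 0 U) (gscal (-1) (gscal 0 U))) with (gscal 0 U) in E
        by (apply fun2_ext; intros; unfold gadd, gscal; ring).
      rewrite E. apply fun2_ext; intros; unfold gadd, gscal; ring. }
    rewrite Hgs, HT, T0, <- Hgs. auto. }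
  assert (E : ip N (gadd (opIA2 N (gscal (/ tau) e)) (opD N p W (gscal (/ 2) e))) e = ip N r e).
  { apply ip_geq; auto. intros j1 j2 _ _; auto. }
  rewrite (Hlin _ _ _ (glinear_opIA2 N HN)), (Hlin _ _ _ (glinear_opD N p W HN)) in E.
  rewrite ip_gadd_l, !ip_gscal_l, ip_opD_self in E. unfold opIA2 in E. rewrite ip_gadd_l in E.
  rewrite (ip_geq N (opA N (opA N e)) (opA' m (opA' m e)) e e) in E;
    [|apply opAA_geq; auto|intros j1 j2 _ _; auto].
  rewrite ip_opA', !ip_self in E by auto.
  pose proof (ip_CS N r e HN) as HCS. rewrite <- E in HCS.
  pose proof (hn_nonneg N e). pose proof (hn_nonneg N r). pose proof (hn_nonneg N (opA' m e)).
  set (x := hn N e) in *. set (y := hn N (opA' m e)) in *. set (z := hn N r) in *.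
  (* This controls both norms: dropping [y^2] gives [x <= tau * z], and reinserting that gives
     [y^2 <= (tau * z)^2]. *)
  assert (Hk : x ^ 2 + y ^ 2 <= tau * z * x).
  { apply (Rmult_le_reg_l (INR N ^ 2 * / tau)).
    - apply Rmult_lt_0_compat; [nra|apply Rinv_0_lt_compat; auto].
    - replace (INR N ^ 2 * / tau * (tau * z * x)) with (INR N ^ 2 * (z * x)) by (field; lra). nra. }
  assert (Hx : x <= tau * z).
  { destruct (Req_dec x 0) as [->|]; [apply Rmult_le_pos; lra|].
    apply (Rmult_le_reg_r x); [lra|]. nra. }
  split; auto.
  assert (0 <= tau * z) by (apply Rmult_le_pos; lra).
  assert (y ^ 2 <= (tau * z) ^ 2) by nra.
  apply Rsqr_incr_0_var; [unfold Rsqr; nra|auto].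
Qed.

(** * Discrete Fourier transform of the grid operators *)

Let Q0 := rng2 (- Z.of_nat m) (- Z.of_nat m) N.

Definition mode (k : Z * Z) (q : R) : grid :=
  fun j1 j2 => cos (th2 N k (j1, j2) + q).

(** The window contains frequencies with a coordinate [-m], where the matrix of order 2 is still
    exact; hence every mode of the window is an eigenvector of [A]. *)
Lemma opA'_mode k q : In k Q0 -> opA' m (mode k q) = gscal (- (kx k ^ 2 + ky k ^ 2)) (mode k q).
Proof.
  intros Hk. apply in_rng2 in Hk. apply fun2_ext; intros j1 j2.
  unfold opA', gadd, ax, ay, gscal, mode, th2. cbn [fst snd]. fold N.
  rewrite (sumL_ext _ _ (fun r => Dmat N 2 j1 r * cos (IZR (fst k) * xg N r + (ky k * xg N j2 + q))))
    by (intros r _; unfold kx; do 2 f_equal; ring).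
  rewrite (sumL_ext _ (fun r => Dmat N 2 j2 r * _)
    (fun r => Dmat N 2 j2 r * cos (IZR (snd k) * xg N r + (kx k * xg N j1 + q))))
    by (intros r _; unfold ky; do 2 f_equal; ring).
  unfold N. unfold N in Hk. rewrite !Dmat_mode by (auto; lia). fold N.
  assert (E : forall t, cos (t + INR 2 * (PI / 2)) = - cos t).
  { intros t. replace (INR 2 * (PI / 2)) with PI by (simpl; field). apply neg_cos. }
  rewrite !E. fold (kx k) (ky k).
  replace (kx k * xg N j1 + (ky k * xg N j2 + q)) with (kx k * xg N j1 + ky k * xg N j2 + q) by ring.
  replace (ky k * xg N j2 + (kx k * xg N j1 + q)) with (kx k * xg N j1 + ky k * xg N j2 + q) by ring.
  ring.
Qed.

Let gf (U : grid) : nat * nat -> R := fun j => U (fst j) (snd j).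
Let C U k := Cc (G N) (th2 N) 0 (gf U) k.
Let S U k := Sc (G N) (th2 N) 0 (gf U) k.

Lemma Cc_ip U q k : Cc (G N) (th2 N) q (gf U) k = ip N U (mode k q).
Proof. unfold Cc, ip. apply sumL_ext. intros [j1 j2] _. reflexivity. Qed.

Lemma Sc_ip U k : S U k = ip N U (mode k (- (PI / 2))).
Proof.
  unfold S, Sc, ip. apply sumL_ext. intros [j1 j2] _. unfold mode, gf. cbn [fst snd].
  rewrite sin_cos_shift. rewrite Rplus_0_r. auto.
Qed.

(** By symmetry [A] moves onto the mode in the pairing, and the mode is an eigenvector. *)
Lemma coef_opA' U k : In k Q0 ->
  C (opA' m U) k = - (kx k ^ 2 + ky k ^ 2) * C U k /\ S (opA' m U) k = - (kx k ^ 2 + ky k ^ 2) * S U k.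
Proof.
  intros Hk. unfold C. rewrite !Cc_ip, !Sc_ip, !ip_opA', !opA'_mode by auto.
  split; rewrite ip_sym, ip_gscal_l, (ip_sym N U); auto.
Qed.

Lemma parseval_grid U : sumL Q0 (fun k => C U k ^ 2 + S U k ^ 2) = INR N ^ 4 * hn N U ^ 2.
Proof.
  unfold C, S. rewrite (trig_parseval (G N) Q0 (th2 N) (INR N ^ 2)) by (apply ker2; auto).
  unfold gf. rewrite <- hn_sqr by auto. ring.
Qed.

Lemma parseval_opA' U :
  sumL Q0 (fun k => (kx k ^ 2 + ky k ^ 2) ^ 2 * (C U k ^ 2 + S U k ^ 2)) = INR N ^ 4 * hn N (opA' m U) ^ 2.
Proof.
  rewrite <- parseval_grid. apply sumL_ext. intros k Hk.
  destruct (coef_opA' U k Hk) as [-> ->]. ring.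
Qed.

Lemma grid_inversion U j1 j2 : (j1 < N)%nat -> (j2 < N)%nat ->
  U j1 j2 = / INR N ^ 2 * sumL Q0 (fun k => C U k * mode k 0 j1 j2 + S U k * mode k (- (PI / 2)) j1 j2).
Proof.
  intros H1 H2. assert (HNr : 0 < INR N) by (apply lt_0_INR; auto).
  pose proof (trig_inversion (G N) Q0 (th2 N) (INR N ^ 2) (ker2 N _ _ HN) (gf U) (j1, j2)) as H.
  rewrite in_G in H. specialize (H (conj H1 H2)).
  apply (Rmult_eq_reg_l (INR N ^ 2)); [|nra]. rewrite <- Rmult_assoc, Rinv_r, Rmult_1_l by nra.
  unfold gf at 1 in H. cbn [fst snd] in H. rewrite H. apply sumL_ext. intros k _.
  unfold mode, C, S. rewrite Rplus_0_r, <- sin_cos_shift. auto.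
Qed.

(** The inverse transform bounds a grid value by the moduli of the coefficients. Cauchy-Schwarz
    against [/ wgt k] leaves the square sum of [wgt] times the coefficients, which Parseval
    expresses through [U] and [A U] because [wgt k = 1 + |k|^2] and [A] has eigenvalue [- |k|^2]. *)
Lemma sobolev_grid D : (forall n, sumL (box n) (fun k => Rpower (wgt k) (Ropp 2)) <= D) ->
  forall U j1 j2, (j1 < N)%nat -> (j2 < N)%nat ->
  Rabs (U j1 j2) <= 2 * sqrt D * (hn N U + hn N (opA' m U)).
Proof.
  intros HD U j1 j2 H1 H2. assert (HNr : 0 < INR N) by (apply lt_0_INR; auto).
  rewrite (grid_inversion U j1 j2 H1 H2), Rabs_mult.
  assert (HN2 : 0 < INR N ^ 2) by nra.
  rewrite (Rabs_pos_eq (/ INR N ^ 2)) by (left; apply Rinv_0_lt_compat; auto).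
  apply (Rmult_le_reg_l (INR N ^ 2)); auto. rewrite <- Rmult_assoc, Rinv_r, Rmult_1_l by lra.
  eapply Rle_trans; [apply sumL_abs|].
  apply Rle_trans with (sumL Q0 (fun k => / wgt k * (wgt k * (Rabs (C U k) + Rabs (S U k))))).
  { apply sumL_le. intros k _. pose proof (wgt_ge1 k).
    rewrite <- Rmult_assoc, Rinv_l, Rmult_1_l by lra.
    unfold mode. rewrite Rplus_0_r, <- sin_cos_shift. apply Rabs_trig_le. }
  eapply Rle_trans; [apply Rle_abs|]. eapply Rle_trans; [apply l2_CS|].
  replace (INR N ^ 2 * (2 * sqrt D * (hn N U + hn N (opA' m U))))
    with (sqrt D * (2 * INR N ^ 2 * (hn N U + hn N (opA' m U)))) by ring.
  pose proof (hn_nonneg N U). pose proof (hn_nonneg N (opA' m U)).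
  apply Rmult_le_compat; try apply l2_nonneg.
  - apply sqrt_le_1_alt. eapply Rle_trans; [|apply (HD m)].
    rewrite (sumL_ext _ _ (fun k => Rpower (wgt k) (Ropp 2))).
    + apply sumL_incl_le.
      * apply NoDup_rng2.
      * intros k. unfold Q0. rewrite in_rng2, in_box. unfold N. lia.
      * intros; left; apply Rpower_pos.
    + intros k _. pose proof (wgt_ge1 k). rewrite Rpower_Ropp, pow_inv.
      f_equal. replace 2 with (INR 2) by reflexivity. rewrite Rpower_pow by lra. auto.
  - apply l2_le_of_sqr; [repeat apply Rmult_le_pos; lra|].
    (* The factor 4 is a 2 from [(u + v)^2] times a 2 from [(1 + l)^2]. *)
    apply Rle_trans with (4 * (sumL Q0 (fun k => C U k ^ 2 + S U k ^ 2) +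
       sumL Q0 (fun k => (kx k ^ 2 + ky k ^ 2) ^ 2 * (C U k ^ 2 + S U k ^ 2)))).
    + rewrite <- sumL_plus, <- sumL_scal. apply sumL_le. intros k _.
      rewrite Rpow_mult_distr. unfold wgt.
      set (l := kx k ^ 2 + ky k ^ 2). replace (1 + kx k ^ 2 + ky k ^ 2) with (1 + l) by (unfold l; ring).
      rewrite <- (pow2_abs (C U k)), <- (pow2_abs (S U k)).
      set (u := Rabs (C U k)). set (v := Rabs (S U k)).
      assert (A1 : (u + v) ^ 2 <= 2 * (u ^ 2 + v ^ 2)) by (pose proof (pow2_ge_0 (u - v)); nra).
      assert (A2 : (1 + l) ^ 2 <= 2 * (1 + l ^ 2)) by (pose proof (pow2_ge_0 (1 - l)); nra).
      replace (4 * (u ^ 2 + v ^ 2 + l ^ 2 * (u ^ 2 + v ^ 2))) with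
        ((2 * (1 + l ^ 2)) * (2 * (u ^ 2 + v ^ 2))) by ring.
      apply Rmult_le_compat; auto; apply pow2_ge_0.
    + rewrite parseval_grid, parseval_opA'.
      replace ((2 * INR N ^ 2 * (hn N U + hn N (opA' m U))) ^ 2)
        with (4 * (INR N ^ 4 * (hn N U + hn N (opA' m U)) ^ 2)) by ring.
      assert (0 <= INR N ^ 4) by (apply pow_le; lra).
      rewrite <- Rmult_plus_distr_l. apply Rmult_le_compat_l; [lra|]. apply Rmult_le_compat_l; auto. nra.
Qed.

(** Wrapping the index around changes the point by a whole number of periods, which modes with
    integer frequencies do not see. *)
Lemma xg_next j : (j < N)%nat -> exists z : Z, xg N ((j + 1) mod N) = xg N j + hstep N + IZR z * (2 * PI).
Proof.
  intros Hj. assert (HNr : 0 < INR N) by (apply lt_0_INR; auto).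
  destruct (Nat.eq_dec (j + 1) N) as [E|Hne].
  - exists (-1)%Z. rewrite E, Nat.Div0.mod_same. unfold xg, hstep.
    replace (INR j) with (INR N - 1) by (rewrite <- E, plus_INR; simpl; ring).
    simpl (INR 0). field. lra.
  - exists 0%Z. rewrite Nat.mod_small by lia. unfold xg. rewrite plus_INR. simpl. ring.
Qed.

Lemma xg_prev j : (j < N)%nat -> exists z : Z, xg N ((j + N - 1) mod N) = xg N j - hstep N + IZR z * (2 * PI).
Proof.
  intros Hj. assert (HNr : 0 < INR N) by (apply lt_0_INR; auto).
  destruct (Nat.eq_dec j 0) as [->|Hne].
  - exists 1%Z. rewrite Nat.mod_small by lia. unfold xg, hstep.
    replace (0 + N - 1)%nat with (N - 1)%nat by lia. rewrite minus_INR by lia. simpl. field. lra.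
  - exists 0%Z. replace (j + N - 1)%nat with ((j - 1) + 1 * N)%nat by lia.
    rewrite Nat.Div0.mod_add, Nat.mod_small by lia. unfold xg. rewrite minus_INR by lia. simpl. ring.
Qed.

(** The eigenvalue of the five-point Laplacian on the mode [k], that is [- 4 / h^2] times
    [sin^2 (k1 h / 2) + sin^2 (k2 h / 2)]. *)
Definition lapsym (k : Z * Z) : R :=
  (2 * cos (kx k * hstep N) - 2) / hstep N ^ 2 + (2 * cos (ky k * hstep N) - 2) / hstep N ^ 2.

Lemma lap_h_mode k q j1 j2 : (j1 < N)%nat -> (j2 < N)%nat ->
  lap_h N (mode k q) j1 j2 = lapsym k * mode k q j1 j2.
Proof.
  intros H1 H2. assert (HNr : 0 < INR N) by (apply lt_0_INR; auto).
  assert (Hh : hstep N <> 0).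
  { unfold hstep. pose proof PI_RGT_0. apply Rgt_not_eq. apply Rdiv_lt_0_compat; lra. }
  unfold lap_h, mode, th2, lapsym. cbn [fst snd].
  destruct (xg_next j1 H1) as [z1 ->]. destruct (xg_prev j1 H1) as [z2 ->].
  destruct (xg_next j2 H2) as [z3 ->]. destruct (xg_prev j2 H2) as [z4 ->].
  set (t := kx k * xg N j1 + ky k * xg N j2 + q). set (h := hstep N) in *.
  replace (kx k * (xg N j1 + h + IZR z1 * (2 * PI)) + ky k * xg N j2 + q)
    with ((t + kx k * h) + IZR (fst k * z1) * (2 * PI)) by (rewrite mult_IZR; unfold t, kx; ring).
  replace (kx k * (xg N j1 - h + IZR z2 * (2 * PI)) + ky k * xg N j2 + q)
    with ((t - kx k * h) + IZR (fst k * z2) * (2 * PI)) by (rewrite mult_IZR; unfold t, kx; ring).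
  replace (kx k * xg N j1 + ky k * (xg N j2 + h + IZR z3 * (2 * PI)) + q)
    with ((t + ky k * h) + IZR (snd k * z3) * (2 * PI)) by (rewrite mult_IZR; unfold t, ky; ring).
  replace (kx k * xg N j1 + ky k * (xg N j2 - h + IZR z4 * (2 * PI)) + q)
    with ((t - ky k * h) + IZR (snd k * z4) * (2 * PI)) by (rewrite mult_IZR; unfold t, ky; ring).
  rewrite !cos_add_2PI_Z, !cos_plus, !cos_minus. field. auto.
Qed.

Lemma sin_abs_le x : Rabs (sin x) <= Rabs x.
Proof.
  assert (H : forall x, 0 < x -> Rabs (sin x) <= x).
  { intros y Hy. destruct (Rle_or_lt 1 y).
    - eapply Rle_trans; [apply Rabs_le, SIN_bound|auto].
    - pose proof PI_RGT_0. pose proof PI2_1. pose proof (sin_lt_x y Hy).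
      rewrite Rabs_pos_eq; [lra|]. apply sin_ge_0; lra. }
  destruct (Rtotal_order x 0) as [Hx|[->|Hx]].
  - pose proof (H (- x) ltac:(lra)) as Hn. rewrite sin_neg, Rabs_Ropp in Hn.
    rewrite (Rabs_left x) by auto. auto.
  - rewrite sin_0. apply Rle_refl.
  - rewrite (Rabs_pos_eq x) by lra. auto.
Qed.

Lemma lapsym_bound k : Rabs (lapsym k) <= kx k ^ 2 + ky k ^ 2.
Proof.
  assert (HNr : 0 < INR N) by (apply lt_0_INR; auto).
  assert (Hh : 0 < hstep N) by (unfold hstep; pose proof PI_RGT_0; apply Rdiv_lt_0_compat; lra).
  unfold lapsym. set (h := hstep N) in *.
  assert (H : forall c, - c ^ 2 <= (2 * cos (c * h) - 2) / h ^ 2 <= 0).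
  { intros c. replace (c * h) with (2 * (c * h / 2)) by field. rewrite cos_2a_sin.
    set (w := c * h / 2). pose proof (sin_abs_le w) as Hs.
    assert (Hs2 : sin w ^ 2 <= w ^ 2).
    { rewrite <- (pow2_abs (sin w)), <- (pow2_abs w). apply pow_incr. split; [apply Rabs_pos|auto]. }
    replace ((2 * (1 - 2 * sin w * sin w) - 2) / h ^ 2) with (- (4 * sin w ^ 2 / h ^ 2)) by (field; lra).
    replace (c ^ 2) with (4 * w ^ 2 / h ^ 2) by (unfold w; field; lra).
    assert (Hi : 0 < / h ^ 2) by (apply Rinv_0_lt_compat; nra). unfold Rdiv.
    pose proof (pow2_ge_0 (sin w)). split; nra. }
  pose proof (H (kx k)). pose proof (H (ky k)). apply Rabs_le. lra.
Qed.

(** Both operators are diagonal in the same modes, and [|sin w| <= |w|] makes each eigenvalue of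
    [lap_h] at most that of [A] in modulus; synthesis and Parseval carry this over to the norms. *)
Lemma hn_lap_h U : hn N (lap_h N U) <= hn N (opA' m U).
Proof.
  assert (HNr : 0 < INR N) by (apply lt_0_INR; auto).
  set (al := fun k => / INR N ^ 2 * (lapsym k * C U k)).
  set (be := fun k => / INR N ^ 2 * (lapsym k * S U k)).
  rewrite (hn_geq N _ (fun j1 j2 => sumL Q0 (fun k =>
     al k * cos (th2 N k (j1, j2) + 0) + be k * sin (th2 N k (j1, j2) + 0)))).
  - apply hn_of_sqr; auto; [apply hn_nonneg|].
    rewrite (sumL_ext (G N) _ (fun j => (sumL Q0 (fun k =>
     al k * cos (th2 N k j + 0) + be k * sin (th2 N k j + 0))) ^ 2))
      by (intros [j1 j2] _; reflexivity).
    eapply Rle_trans; [apply (trig_synthesis (G N) Q0 (th2 N) (INR N ^ 2) (ker2 N _ _ HN)); nra|].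
    apply Rle_trans with (INR N ^ 2 * (/ INR N ^ 4 *
      sumL Q0 (fun k => (kx k ^ 2 + ky k ^ 2) ^ 2 * (C U k ^ 2 + S U k ^ 2)))).
    + apply Rmult_le_compat_l; [nra|]. rewrite <- sumL_scal. apply sumL_le. intros k _. unfold al, be.
      replace (_ + _) with (/ INR N ^ 4 * (lapsym k ^ 2 * (C U k ^ 2 + S U k ^ 2))) by (field; lra).
      apply Rmult_le_compat_l; [left; apply Rinv_0_lt_compat, pow_lt; auto|].
      apply Rmult_le_compat_r; [pose proof (pow2_ge_0 (C U k)); pose proof (pow2_ge_0 (S U k)); lra|].
      rewrite <- (pow2_abs (lapsym k)). apply pow_incr. split; [apply Rabs_pos|apply lapsym_bound].
    + rewrite parseval_opA'. right. field. lra.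
  - intros j1 j2 H1 H2.
    (* The stencil acts on the inversion formula term by term; the reduced neighbouring indices are
       below [N], so the formula is available at each of them. *)
    assert (E : lap_h N U j1 j2 = / INR N ^ 2 * sumL Q0 (fun k =>
       C U k * lap_h N (mode k 0) j1 j2 + S U k * lap_h N (mode k (- (PI / 2))) j1 j2)).
    { unfold lap_h.
      assert (M1 : ((j1 + 1) mod N < N)%nat) by (apply Nat.mod_upper_bound; lia).
      assert (M2 : ((j1 + N - 1) mod N < N)%nat) by (apply Nat.mod_upper_bound; lia).
      assert (M3 : ((j2 + 1) mod N < N)%nat) by (apply Nat.mod_upper_bound; lia).
      assert (M4 : ((j2 + N - 1) mod N < N)%nat) by (apply Nat.mod_upper_bound; lia).
      rewrite (grid_inversion U _ j2 M1 H2), (grid_inversion U _ j2 M2 H2),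
        (grid_inversion U j1 _ H1 M3), (grid_inversion U j1 _ H1 M4), (grid_inversion U j1 j2 H1 H2).
      set (f := fun i1 i2 k => C U k * mode k 0 i1 i2 + S U k * mode k (- (PI / 2)) i1 i2).
      symmetry. rewrite (sumL_ext Q0 _ (fun k =>
        (f ((j1 + 1) mod N)%nat j2 k - 2 * f j1 j2 k + f ((j1 + N - 1) mod N)%nat j2 k) / hstep N ^ 2
      + (f j1 ((j2 + 1) mod N)%nat k - 2 * f j1 j2 k + f j1 ((j2 + N - 1) mod N)%nat k) / hstep N ^ 2))
        by (intros k _; unfold f, Rdiv; ring).
      rewrite (sumL_lap Q0 (f j1 j2)). unfold f, Rdiv. ring. }
    rewrite E, <- sumL_scal. apply sumL_ext. intros k _. rewrite !lap_h_mode by auto.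
    unfold al, be, mode. rewrite <- sin_cos_shift, Rplus_0_r. ring.
Qed.

End Energy.

(** * Regularity in time *)

Lemma hnorm_hn N U : (0 < N)%nat -> hnorm N U = 2 * PI * hn N U.
Proof.
  intros HN. assert (HNr : 0 < INR N) by (apply lt_0_INR; auto). pose proof PI_RGT_0.
  unfold hnorm. rewrite sum_n_sumL. replace (S (N - 1)) with N by lia.
  rewrite (sumL_ext _ _ (fun j2 => sumL (seq 0 N) (fun j1 => U j1 j2 ^ 2)))
    by (intros; rewrite sum_n_sumL; replace (S (N - 1)) with N by lia; auto).
  rewrite sumL_swap. rewrite sqrt_mult_alt by apply pow2_ge_0.
  rewrite sqrt_pow2 by (unfold hstep; left; apply Rdiv_lt_0_compat; lra).
  unfold hn, l2, G. rewrite sumL_prod. cbn [fst snd]. unfold hstep, Rdiv. ring.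
Qed.

Lemma maxupto_le f n c : (forall i, (i <= n)%nat -> f i <= c) -> maxupto f n <= c.
Proof.
  induction n as [|n IH]; intros H; simpl; auto. apply Rmax_lub; auto.
Qed.

Lemma hinfnorm_le N U c : (0 < N)%nat ->
  (forall j1 j2, (j1 < N)%nat -> (j2 < N)%nat -> Rabs (U j1 j2) <= c) -> hinfnorm N U <= c.
Proof.
  intros HN H. apply maxupto_le. intros j2 H2. apply maxupto_le. intros j1 H1. apply H; lia.
Qed.

Lemma cont2_fsub f g : cont2 f -> cont2 g -> cont2 (fsub f g).
Proof. apply cont2_minus. Qed.
Lemma cont2_fscal c f : cont2 f -> cont2 (fscal c f).
Proof. apply cont2_scal. Qed.
Lemma periodic2_fsub f g : periodic2 f -> periodic2 g -> periodic2 (fsub f g).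
Proof.
  intros Hf Hg x y. unfold fsub. destruct (Hf x y) as [-> ->]. destruct (Hg x y) as [-> ->]. auto.
Qed.
Lemma periodic2_fscal c f : periodic2 f -> periodic2 (fscal c f).
Proof. intros Hf x y. unfold fscal. destruct (Hf x y) as [-> ->]. auto. Qed.

Lemma coef_fsub f g k : cont2 f -> cont2 g ->
  are (fsub f g) k = are f k - are g k /\ bim (fsub f g) k = bim f k - bim g k.
Proof.
  intros Hf Hg. destruct (coef_lin f g 1 (-1) k Hf Hg) as [E1 E2].
  replace (fsub f g) with (fun x y => 1 * f x y + -1 * g x y)
    by (apply fun2_ext; intros; unfold fsub; ring).
  rewrite E1, E2. split; ring.
Qed.

Lemma coef_fscal c f k : cont2 f ->
  are (fscal c f) k = c * are f k /\ bim (fscal c f) k = c * bim f k.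
Proof.
  intros Hf. destruct (coef_lin f f c 0 k Hf Hf) as [E1 E2].
  replace (fscal c f) with (fun x y => c * f x y + 0 * f x y)
    by (apply fun2_ext; intros; unfold fscal; ring).
  rewrite E1, E2. split; ring.
Qed.

(** Two-sided time derivatives and the equation are available only for [0 < t < T], so time 0 is
    approached along such a sequence. *)
Lemma zero_seq (t0 : R) : 0 < t0 -> exists tn : nat -> R, (forall n, 0 < tn n < t0) /\ is_lim_seq tn 0.
Proof.
  intros Ht. exists (fun n => t0 * / INR (S (S n))). split.
  - intros n. assert (1 < INR (S (S n))) by (apply (lt_INR 1); lia).
    assert (0 < / INR (S (S n)) < 1).
    { split; [apply Rinv_0_lt_compat; lra|]. rewrite <- Rinv_1. apply Rinv_lt_contravar; lra. }
    nra.
  - replace 0 with (t0 * 0) by ring.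
    apply (is_lim_seq_scal_l (fun n => / INR (S (S n))) t0 0).
    apply (is_lim_seq_ext (fun n => / INR (n + 2))); [intros n; f_equal; f_equal; lia|].
    apply (proj1 (is_lim_seq_incr_n (fun n => / INR n) 2 0)).
    apply (is_lim_seq_inv INR p_infty); [apply is_lim_seq_INR|discriminate].
Qed.

Section Evolution.
Variables (s T : R).
Hypothesis Hs : 1 < s.

Lemma Hle_HB f e : Hle (s + 4) f e -> HB s (are f) (bim f) (e ^ 2).
Proof. intros H n. rewrite <- Hsum_sumL. apply H. Qed.

Lemma InHp_HB f : InHp (s + 4) f -> exists B, HB s (are f) (bim f) B.
Proof. intros (_ & _ & B & H). exists B. intros n. rewrite <- Hsum_sumL. apply H. Qed.

Lemma HB_repr f B : cont2 f -> periodic2 f -> HB s (are f) (bim f) B -> f = Fij 0 0 (are f) (bim f).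
Proof.
  intros Hc Hp HBf. destruct (HB_abs_sum s Hs) as (C & HC & H). eapply fourier_inversion; eauto.
Qed.

Lemma Hle_sup : exists C, 0 < C /\ forall f e, 0 <= e -> Hle (s + 4) f e ->
  forall i j x y, (i + j <= 4)%nat -> Rabs (Fij i j (are f) (bim f) x y) <= C * e.
Proof.
  destruct (HB_abs_sum s Hs) as (C & HC & H). exists C. split; auto.
  intros f e He Hf i j x y Hij. eapply Fij_bound; auto.
  pose proof (H _ _ _ (Hle_HB f e Hf)) as HA. rewrite sqrt_pow2 in HA by auto. auto.
Qed.

Lemma Hle_coef f e k : 0 <= e -> Hle (s + 4) f e -> Rabs (are f k) <= e /\ Rabs (bim f k) <= e.
Proof.
  intros He Hf.
  set (n := (Z.to_nat (Z.abs (fst k)) + Z.to_nat (Z.abs (snd k)))%nat).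
  assert (Hk : In k (box n)) by (rewrite in_box; unfold n; lia).
  assert (H : are f k ^ 2 + bim f k ^ 2 <= e ^ 2).
  { eapply Rle_trans; [|apply (Hle_HB f e Hf n)].
    eapply Rle_trans; [|apply (sumL_term_le (box n) k (fun k => Rpower (wgt k) (s + 4) * (are f k ^ 2 + bim f k ^ 2)) Hk)].
    - pose proof (Rpower_ge1 (wgt k) (s + 4) (wgt_ge1 k) ltac:(lra)).
      pose proof (pow2_ge_0 (are f k)). pose proof (pow2_ge_0 (bim f k)). nra.
    - intros l _. apply Rmult_le_pos; [left; apply Rpower_pos|].
      pose proof (pow2_ge_0 (are f l)). pose proof (pow2_ge_0 (bim f l)). lra. }
  pose proof (pow2_ge_0 (are f k)). pose proof (pow2_ge_0 (bim f k)).
  split; apply Rsqr_incr_0_var; auto; rewrite <- Rsqr_abs; rewrite !Rsqr_pow2; lra.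
Qed.

Variables (w w1 w2 : R -> R -> R -> R).
Hypothesis HT : 0 < T.
Hypothesis Hin : forall t, 0 <= t <= T ->
  InHp (s + 4) (w t) /\ InHp (s + 4) (w1 t) /\ InHp (s + 4) (w2 t).
Hypothesis Hcw : ContH (s + 4) T w.
Hypothesis Hcw1 : ContH (s + 4) T w1.
Hypothesis Hd1 : DerivH (s + 4) T w w1.
Hypothesis Hd2 : DerivH (s + 4) T w1 w2.

Let Cw t (H : 0 <= t <= T) : cont2 (w t) := proj1 (proj2 (proj1 (Hin t H))).
Let Cw1 t (H : 0 <= t <= T) : cont2 (w1 t) := proj1 (proj2 (proj1 (proj2 (Hin t H)))).
Let Cw2 t (H : 0 <= t <= T) : cont2 (w2 t) := proj1 (proj2 (proj2 (proj2 (Hin t H)))).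
Let Pw t (H : 0 <= t <= T) : periodic2 (w t) := proj1 (proj1 (Hin t H)).
Let Pw1 t (H : 0 <= t <= T) : periodic2 (w1 t) := proj1 (proj1 (proj2 (Hin t H))).

(** The difference quotient minus [w1 t] is continuous and periodic, hence equal to its Fourier
    series, whose supremum is controlled by the [H^{s+4}] norm. A derivative in norm is thus a
    pointwise one. *)
Lemma time_derivative x y t : 0 < t < T -> is_derive (fun z => w z x y) t (w1 t x y).
Proof.
  intros Ht. destruct Hle_sup as (C & HC & Hsup). apply is_derive_Reals.
  intros eps Heps.
  assert (He : 0 < eps / (2 * C)) by (apply Rdiv_lt_0_compat; lra).
  destruct (Hd1 t ltac:(lra) _ He) as (d & Hd & H).
  assert (Hmin : 0 < Rmin d (Rmin t (T - t))) by (repeat apply Rmin_pos; lra).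
  exists (mkposreal _ Hmin). intros h Hh Hlt. simpl in Hlt.
  pose proof (Rmin_l d (Rmin t (T - t))). pose proof (Rmin_r d (Rmin t (T - t))).
  pose proof (Rmin_l t (T - t)). pose proof (Rmin_r t (T - t)).
  assert (Hb : - Rmin t (T - t) < h < Rmin t (T - t)) by (split; apply Rabs_def2 in Hlt; lra).
  assert (Hth : 0 <= t + h <= T) by lra.
  specialize (H h Hh ltac:(lra) Hth).
  set (f := fsub (fscal (/ h) (fsub (w (t + h)) (w t))) (w1 t)) in *.
  assert (Cf : cont2 f).
  { apply cont2_fsub; [apply cont2_fscal, cont2_fsub|]; [apply Cw|apply Cw|apply Cw1]; lra. }
  assert (Pf : periodic2 f).
  { apply periodic2_fsub; [apply periodic2_fscal, periodic2_fsub|]; [apply Pw|apply Pw|apply Pw1]; lra. }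
  assert (Ef := HB_repr f _ Cf Pf (Hle_HB _ _ H)).
  replace ((w (t + h) x y - w t x y) / h - w1 t x y) with (f x y)
    by (unfold f, fsub, fscal, Rdiv; ring).
  rewrite Ef. eapply Rle_lt_trans; [apply (Hsup f _ (Rlt_le _ _ He) H); lia|].
  replace (C * (eps / (2 * C))) with (eps / 2) by (field; lra). lra.
Qed.

(** A Fourier coefficient is bounded by the norm, so differentiation in norm differentiates each
    coefficient. *)
Lemma coef_derivative k t : 0 < t < T ->
  derivable_pt_lim (fun z => are (w z) k) t (are (w1 t) k) /\
  derivable_pt_lim (fun z => bim (w z) k) t (bim (w1 t) k).
Proof.
  intros Ht.
  assert (Key : forall eps, 0 < eps -> exists d : posreal, forall h, h <> 0 -> Rabs h < d ->
     Rabs ((are (w (t + h)) k - are (w t) k) / h - are (w1 t) k) < eps /\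
     Rabs ((bim (w (t + h)) k - bim (w t) k) / h - bim (w1 t) k) < eps).
  { intros eps Heps.
    destruct (Hd1 t ltac:(lra) (eps / 2) ltac:(lra)) as (d & Hd & H).
    assert (Hmin : 0 < Rmin d (Rmin t (T - t))) by (repeat apply Rmin_pos; lra).
    exists (mkposreal _ Hmin). intros h Hh Hlt. simpl in Hlt.
    pose proof (Rmin_l d (Rmin t (T - t))). pose proof (Rmin_r d (Rmin t (T - t))).
    pose proof (Rmin_l t (T - t)). pose proof (Rmin_r t (T - t)).
    assert (Hb : - Rmin t (T - t) < h < Rmin t (T - t)) by (split; apply Rabs_def2 in Hlt; lra).
    assert (Hth : 0 <= t + h <= T) by lra.
    specialize (H h Hh ltac:(lra) Hth). apply (Hle_coef _ _ k) in H; [|lra].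
    assert (C1 := Cw (t + h) Hth). assert (C2 := Cw t ltac:(lra)). assert (C3 := Cw1 t ltac:(lra)).
    assert (C4 := cont2_fsub _ _ C1 C2). assert (C5 := cont2_fscal (/ h) _ C4).
    destruct (coef_fsub _ _ k C5 C3) as [E1 E2]. destruct (coef_fscal (/ h) _ k C4) as [E3 E4].
    destruct (coef_fsub _ _ k C1 C2) as [E5 E6].
    rewrite E1, E2, E3, E4, E5, E6 in H. destruct H as [J1 J2].
    replace (/ h * (are (w (t + h)) k - are (w t) k)) with ((are (w (t + h)) k - are (w t) k) / h) in J1
      by (unfold Rdiv; ring).
    replace (/ h * (bim (w (t + h)) k - bim (w t) k)) with ((bim (w (t + h)) k - bim (w t) k) / h) in J2
      by (unfold Rdiv; ring).
    split; lra. }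
  split; intros eps Heps; destruct (Key eps Heps) as [d Hd]; exists d; intros h Hh Hlt;
    destruct (Hd h Hh Hlt); auto.
Qed.

Lemma coef_limit0 (tn : nat -> R) k : (forall n, 0 < tn n < T) -> is_lim_seq tn 0 ->
  is_lim_seq (fun n => are (w (tn n)) k) (are (w 0) k) /\
  is_lim_seq (fun n => bim (w (tn n)) k) (bim (w 0) k).
Proof.
  intros Htn Hl.
  assert (Key : forall eps : posreal, exists n0, forall n, (n0 <= n)%nat ->
     Rabs (are (w (tn n)) k - are (w 0) k) < eps /\ Rabs (bim (w (tn n)) k - bim (w 0) k) < eps).
  { intros eps. pose proof (cond_pos eps).
    destruct (Hcw 0 ltac:(lra) (eps / 2) ltac:(lra)) as (d & Hd & H1).
    apply is_lim_seq_spec in Hl. destruct (Hl (mkposreal _ Hd)) as [n0 Hn0]. exists n0.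
    intros n Hn. specialize (Hn0 n Hn). simpl in Hn0. specialize (Htn n).
    specialize (H1 (tn n) ltac:(lra) Hn0). apply (Hle_coef _ _ k) in H1; [|lra].
    destruct (coef_fsub (w (tn n)) (w 0) k (Cw (tn n) ltac:(lra)) (Cw 0 ltac:(lra))) as [E1 E2].
    rewrite E1, E2 in H1. split; lra. }
  split; apply is_lim_seq_spec; intros eps; destruct (Key eps) as [n0 Hn0]; exists n0; intros n Hn;
    destruct (Hn0 n Hn); auto.
Qed.

(** Continuity in [H^{s+4}] controls the space derivatives up to order 4 uniformly, so each of them
    is continuous at the initial time. *)
Lemma Fij_limit0 v (tn : nat -> R) i j x y : ContH (s + 4) T v ->
  (forall t, 0 <= t <= T -> InHp (s + 4) (v t)) ->
  (forall n, 0 < tn n < T) -> is_lim_seq tn 0 -> (i + j <= 4)%nat ->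
  is_lim_seq (fun n => Fij i j (are (v (tn n))) (bim (v (tn n))) x y) (Fij i j (are (v 0)) (bim (v 0)) x y).
Proof.
  intros Hcv Hv Htn Hl Hij. destruct Hle_sup as (C & HC & Hsup).
  destruct (HB_abs_sum s Hs) as (Ca & HCa & Habs).
  apply is_lim_seq_spec. intros eps. pose proof (cond_pos eps).
  assert (He : 0 < eps / (2 * C)) by (apply Rdiv_lt_0_compat; lra).
  destruct (Hcv 0 ltac:(lra) _ He) as (d & Hd & H1).
  apply is_lim_seq_spec in Hl. destruct (Hl (mkposreal _ Hd)) as [n0 Hn0]. exists n0.
  intros n Hn. specialize (Hn0 n Hn). simpl in Hn0. specialize (Htn n).
  specialize (H1 (tn n) ltac:(lra) Hn0).
  pose proof (Hv (tn n) ltac:(lra)) as (P1 & C1 & _). pose proof (Hv 0 ltac:(lra)) as (P0 & C0 & _).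
  pose proof (Hsup _ _ (Rlt_le _ _ He) H1 i j x y Hij) as Hb.
  destruct (InHp_HB (v (tn n)) (Hv (tn n) ltac:(lra))) as [B1 HB1].
  destruct (InHp_HB (v 0) (Hv 0 ltac:(lra))) as [B0 HB0].
  assert (E : Fij i j (are (fsub (v (tn n)) (v 0))) (bim (fsub (v (tn n)) (v 0))) x y
     = 1 * Fij i j (are (v (tn n))) (bim (v (tn n))) x y + (-1) * Fij i j (are (v 0)) (bim (v 0)) x y).
  { rewrite <- (Fij_linear _ _ _ _ _ _ 1 (-1) i j x y (Habs _ _ _ HB1) (Habs _ _ _ HB0) Hij).
    f_equal; apply functional_extensionality; intros k;
      destruct (coef_fsub (v (tn n)) (v 0) k C1 C0) as [E1 E2]; [rewrite E1|rewrite E2]; ring. }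
  rewrite E in Hb.
  replace (Fij i j (are (v (tn n))) (bim (v (tn n))) x y - Fij i j (are (v 0)) (bim (v 0)) x y)
    with (1 * Fij i j (are (v (tn n))) (bim (v (tn n))) x y + (-1) * Fij i j (are (v 0)) (bim (v 0)) x y) by ring.
  eapply Rle_lt_trans; [apply Hb|]. replace (C * (eps / (2 * C))) with (eps / 2) by (field; lra). lra.
Qed.

(* Taylor remainder in [H^{s+4}]: pairing the partial sums with the remainder itself reduces
   it to the scalar mean value theorem. *)
Lemma taylor_remainder : exists t0 B, 0 < t0 /\ t0 < T /\ forall tau, 0 < tau <= t0 ->
  HB s (fun k => / tau ^ 2 * (are (w tau) k - are (w 0) k - tau * are (w1 0) k))
       (fun k => / tau ^ 2 * (bim (w tau) k - bim (w 0) k - tau * bim (w1 0) k)) B.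
Proof.
  (* Tolerance 1 suffices: in norm, [w1 c - w1 0] is at most [c] times [1 + sqrt B2] for small [c],
     and [V] dominates the square of that factor. *)
  destruct (Hd2 0 ltac:(lra) 1 ltac:(lra)) as (d & Hd & H2).
  destruct (InHp_HB (w2 0) (proj2 (proj2 (Hin 0 ltac:(lra))))) as [B2 HB2].
  set (r := s + 4).
  set (V := 2 * (1 + B2)).
  exists (Rmin (d / 2) (T / 2)), V.
  pose proof (Rmin_l (d / 2) (T / 2)) as Hm1. pose proof (Rmin_r (d / 2) (T / 2)) as Hm2.
  split; [apply Rmin_pos; lra|]. split; [lra|]. intros tau Htau n.
  assert (Hw1 : forall c, 0 < c <= tau -> sumL (box n) (fun k => Rpower (wgt k) r *
     ((are (w1 c) k - are (w1 0) k) ^ 2 + (bim (w1 c) k - bim (w1 0) k) ^ 2)) <= c ^ 2 * V).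
  { intros c Hc.
    assert (H := H2 c ltac:(lra) ltac:(rewrite Rabs_pos_eq; lra) ltac:(lra)).
    rewrite Rplus_0_l in H.
    apply Hle_HB in H. specialize (H n). specialize (HB2 n). fold r in H, HB2.
    assert (C1 := Cw1 c ltac:(lra)). assert (C2 := Cw1 0 ltac:(lra)). assert (C3 := Cw2 0 ltac:(lra)).
    assert (C4 := cont2_fsub _ _ C1 C2). assert (C5 := cont2_fscal (/ c) _ C4).
    apply Rle_trans with (c ^ 2 * (2 * (sumL (box n) (fun k => Rpower (wgt k) r *
       (are (fsub (fscal (/ c) (fsub (w1 c) (w1 0))) (w2 0)) k ^ 2 +
        bim (fsub (fscal (/ c) (fsub (w1 c) (w1 0))) (w2 0)) k ^ 2))
       + sumL (box n) (fun k => Rpower (wgt k) r * (are (w2 0) k ^ 2 + bim (w2 0) k ^ 2))))).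
    - rewrite <- sumL_plus, <- !sumL_scal. apply sumL_le. intros k _.
      destruct (coef_fsub _ _ k C5 C3) as [-> ->]. destruct (coef_fscal (/ c) _ k C4) as [-> ->].
      destruct (coef_fsub _ _ k C1 C2) as [-> ->].
      set (u := are (w1 c) k - are (w1 0) k). set (v := bim (w1 c) k - bim (w1 0) k).
      set (p := are (w2 0) k). set (q := bim (w2 0) k).
      assert (Hsq : forall z y, z ^ 2 <= c ^ 2 * (2 * ((/ c * z - y) ^ 2 + y ^ 2))).
      { intros z y. replace z with (c * (/ c * z)) at 1 by (field; lra).
        rewrite Rpow_mult_distr. apply Rmult_le_compat_l; [apply pow2_ge_0|].
        set (z' := / c * z). pose proof (pow2_ge_0 (z' - 2 * y)). nra. }
      pose proof (Hsq u p). pose proof (Hsq v q). pose proof (Rpower_pos (wgt k) r).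
      replace (c ^ 2 * (2 * (Rpower (wgt k) r * ((/ c * u - p) ^ 2 + (/ c * v - q) ^ 2)
          + Rpower (wgt k) r * (p ^ 2 + q ^ 2))))
        with (Rpower (wgt k) r * (c ^ 2 * (2 * ((/ c * u - p) ^ 2 + p ^ 2)) + c ^ 2 * (2 * ((/ c * v - q) ^ 2 + q ^ 2)))) by ring.
      apply Rmult_le_compat_l; lra.
    - apply Rmult_le_compat_l; [apply pow2_ge_0|]. unfold V. lra. }
  set (ga := fun k => are (w tau) k - are (w 0) k - tau * are (w1 0) k).
  set (gb := fun k => bim (w tau) k - bim (w 0) k - tau * bim (w1 0) k).
  set (S := sumL (box n) (fun k => Rpower (wgt k) r * (ga k ^ 2 + gb k ^ 2))).
  (* [ga] and [gb] are the remainder at the fixed time [tau]; [phi t] pairs it with the remainder at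
     time [t], so that [phi tau = S] and [phi 0 = 0]. *)
  set (phi := fun t => sumL (box n) (fun k => Rpower (wgt k) r *
     (ga k * (are (w t) k - are (w 0) k - t * are (w1 0) k) + gb k * (bim (w t) k - bim (w 0) k - t * bim (w1 0) k)))).
  set (dphi := fun t => sumL (box n) (fun k => Rpower (wgt k) r *
     (ga k * (are (w1 t) k - are (w1 0) k) + gb k * (bim (w1 t) k - bim (w1 0) k)))).
  assert (HS0 : 0 <= S).
  { apply sumL_nonneg. intros k _. apply Rmult_le_pos; [left; apply Rpower_pos|].
    pose proof (pow2_ge_0 (ga k)). pose proof (pow2_ge_0 (gb k)). lra. }
  assert (HV0 : 0 <= V).
  { assert (H := Hw1 tau ltac:(lra)). assert (Hp : 0 <= tau ^ 2 * V).
    { eapply Rle_trans; [|apply H]. apply sumL_nonneg. intros k _.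
      apply Rmult_le_pos; [left; apply Rpower_pos|].
      pose proof (pow2_ge_0 (are (w1 tau) k - are (w1 0) k)).
      pose proof (pow2_ge_0 (bim (w1 tau) k - bim (w1 0) k)). lra. }
    apply (Rmult_le_reg_l (tau ^ 2)); [nra|]. lra. }
  assert (Hdphi : forall c, 0 < c <= tau -> dphi c <= sqrt S * (tau * sqrt V)).
  { intros c Hc. set (rt := fun k => Rpower (wgt k) (r / 2)).
    assert (Hrt : forall k, rt k * rt k = Rpower (wgt k) r).
    { intros k. unfold rt. rewrite <- Rpower_plus. f_equal. field. }
    pose proof (sumL_CS_pair (box n) (fun k => rt k * ga k) (fun k => rt k * gb k)
      (fun k => rt k * (are (w1 c) k - are (w1 0) k)) (fun k => rt k * (bim (w1 c) k - bim (w1 0) k))) as HCS.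
    rewrite (sumL_ext _ (fun k => (rt k * ga k) ^ 2 + _) (fun k => Rpower (wgt k) r * (ga k ^ 2 + gb k ^ 2))) in HCS
      by (intros k _; rewrite <- Hrt; ring).
    rewrite (sumL_ext _ (fun k => (rt k * (are (w1 c) k - are (w1 0) k)) ^ 2 + _) (fun k => Rpower (wgt k) r *
     ((are (w1 c) k - are (w1 0) k) ^ 2 + (bim (w1 c) k - bim (w1 0) k) ^ 2))) in HCS
      by (intros k _; rewrite <- Hrt; ring).
    rewrite (sumL_ext _ (fun k => rt k * ga k * _ + _) (fun k => Rpower (wgt k) r *
     (ga k * (are (w1 c) k - are (w1 0) k) + gb k * (bim (w1 c) k - bim (w1 0) k)))) in HCS
      by (intros k _; rewrite <- Hrt; ring).
    fold (dphi c) in HCS. fold S in HCS.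
    apply Rsqr_incr_0_var; [|repeat apply Rmult_le_pos; try apply sqrt_pos; lra].
    rewrite !Rsqr_pow2, !Rpow_mult_distr, !pow2_sqrt by auto.
    eapply Rle_trans; [apply HCS|]. apply Rmult_le_compat_l; auto.
    eapply Rle_trans; [apply (Hw1 c Hc)|]. apply Rmult_le_compat_r; auto. apply pow_incr; lra. }
  assert (Hder : forall t, 0 < t < T -> derivable_pt_lim phi t (dphi t)).
  { intros t Ht. apply is_derive_Reals. unfold phi, dphi.
    apply (is_derive_sumL (box n) (fun k t => Rpower (wgt k) r *
     (ga k * (are (w t) k - are (w 0) k - t * are (w1 0) k) + gb k * (bim (w t) k - bim (w 0) k - t * bim (w1 0) k)))
     (fun k t => Rpower (wgt k) r *
     (ga k * (are (w1 t) k - are (w1 0) k) + gb k * (bim (w1 t) k - bim (w1 0) k)))).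
    intros k. destruct (coef_derivative k t Ht) as [D1 D2].
    apply is_derive_Reals in D1. apply is_derive_Reals in D2.
    apply is_derive_scal.
    assert (L : forall c f (f' : R) e, is_derive f t f' -> is_derive (fun t => c * (f t - f 0 - t * e)) t (c * (f' - e))).
    { intros c f f' e Hf. apply is_derive_scal.
      apply (is_derive_minus (V := R_NormedModule) (fun t => f t - f 0) (fun t => t * e)).
      - replace f' with (minus f' zero) by (unfold minus, plus, opp, zero; simpl; ring).
        apply (is_derive_minus (V := R_NormedModule) f (fun _ => f 0)); auto.
        apply (is_derive_const (V := R_NormedModule)).
      - auto_derive; auto. ring. }
    apply (is_derive_plus (V := R_NormedModule) (fun t => ga k * (are (w t) k - are (w 0) k - t * are (w1 0) k))).
    - apply (L (ga k) (fun t => are (w t) k)); auto.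
    - apply (L (gb k) (fun t => bim (w t) k)); auto. }
  destruct (zero_seq tau ltac:(lra)) as (tn & Htn & Hlim).
  (* The derivative of [phi] is known at interior times only, so the mean value theorem is used on
     [[tn i, tau]] and the left end is sent to 0 afterwards. *)
  assert (Hstep : forall i, phi tau - phi (tn i) <= sqrt S * (tau * sqrt V) * tau).
  { intros i. specialize (Htn i).
    destruct (MVT_cor2 phi dphi (tn i) tau) as (c & E & Hc); [lra| |].
    - intros c Hc. apply Hder. lra.
    - rewrite E. pose proof (Hdphi c ltac:(lra)).
      assert (0 <= sqrt S * (tau * sqrt V)) by (repeat apply Rmult_le_pos; try apply sqrt_pos; lra).
      apply Rle_trans with (sqrt S * (tau * sqrt V) * (tau - tn i)).
      + apply Rmult_le_compat_r; lra.
      + apply Rmult_le_compat_l; lra. }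
  assert (Lphi : is_lim_seq (fun i => phi (tn i)) 0).
  { replace 0 with (sumL (box n) (fun k => Rpower (wgt k) r *
     (ga k * (are (w 0) k - are (w 0) k - 0 * are (w1 0) k) + gb k * (bim (w 0) k - bim (w 0) k - 0 * bim (w1 0) k))))
      by (apply sumL_zero; intros; ring).
    apply (sumL_lim (box n) (fun i k => Rpower (wgt k) r *
     (ga k * (are (w (tn i)) k - are (w 0) k - tn i * are (w1 0) k) + gb k * (bim (w (tn i)) k - bim (w 0) k - tn i * bim (w1 0) k)))).
    intros k _. destruct (coef_limit0 tn k ltac:(intros i; specialize (Htn i); lra) Hlim) as [L1 L2].
    apply (is_lim_seq_scal_l _ _ (Finite _)).
    apply is_lim_seq_plus'; apply (is_lim_seq_scal_l _ _ (Finite _));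
      (apply is_lim_seq_minus'; [apply is_lim_seq_minus'; [auto|apply is_lim_seq_const]|]);
      apply (is_lim_seq_scal_r tn _ (Finite 0)); auto. }
  assert (HSphi : phi tau = S) by (apply sumL_ext; intros k _; unfold ga, gb; ring).
  assert (Hfin : S <= sqrt S * (tau * sqrt V) * tau).
  { rewrite <- HSphi at 1.
    assert (L : is_lim_seq (fun i => phi tau - phi (tn i)) (phi tau - 0))
      by (apply is_lim_seq_minus'; [apply is_lim_seq_const|auto]).
    assert (Hle := is_lim_seq_le _ _ _ _ Hstep L (is_lim_seq_const _)). simpl in Hle. lra. }
  (* One factor [sqrt S] is divided out of [S <= sqrt S * tau^2 * sqrt V]. *)
  assert (HSV : S <= tau ^ 4 * V).
  { destruct (Req_dec S 0) as [->|Hn]; [apply Rmult_le_pos; [apply pow_le; lra|auto]|].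
    assert (Hq : 0 < sqrt S) by (apply sqrt_lt_R0; lra).
    assert (HqS : sqrt S * sqrt S = S) by (apply sqrt_sqrt; auto).
    assert (Hqle : sqrt S <= tau ^ 2 * sqrt V).
    { apply (Rmult_le_reg_l (sqrt S)); auto. rewrite HqS. lra. }
    replace (tau ^ 4 * V) with ((tau ^ 2 * sqrt V) ^ 2)
      by (rewrite Rpow_mult_distr, pow2_sqrt by auto; ring).
    rewrite <- (pow2_sqrt S) by auto. apply pow_incr. split; lra. }
  apply Rle_trans with (/ tau ^ 4 * S).
  - unfold S. rewrite <- sumL_scal. right. apply sumL_ext. intros k _. unfold ga, gb. fold r. field. lra.
  - apply (Rmult_le_reg_l (tau ^ 4)); [apply pow_lt; lra|].
    rewrite <- Rmult_assoc, Rinv_r, Rmult_1_l by (apply Rgt_not_eq, pow_lt; lra). auto.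
Qed.

End Evolution.

(** * The equation at the initial time and the error bound *)

Section Slices.
Variables (a b : Z * Z -> R) (A : R).
Hypothesis HA : abs_sum a b A.

(** One Laplacian turns a single series into a sum of two, so this two-term shape, with [c = 0]
    before and [c = 1] after it, suffices for the bi-Laplacian. A space derivative involves only the
    slice at time [t]. *)
Lemma slice_dx v t i j i' j' c : (S i + j <= 4)%nat -> (S i' + j' <= 4)%nat ->
  (forall x y, v x y t = Fij i j a b x y + c * Fij i' j' a b x y) ->
  forall x y, dx v x y t = Fij (S i) j a b x y + c * Fij (S i') j' a b x y.
Proof.
  intros H1 H2 Hv x y. unfold dx.
  rewrite (Derive_ext _ (fun z => Fij i j a b z y + c * Fij i' j' a b z y)) by (intros; apply Hv).
  apply is_derive_unique.
  apply (is_derive_plus (V := R_NormedModule) (fun z => Fij i j a b z y)).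
  - eapply Fij_derive_x; eauto.
  - apply is_derive_scal. eapply Fij_derive_x; eauto.
Qed.

Lemma slice_dy v t i j i' j' c : (i + S j <= 4)%nat -> (i' + S j' <= 4)%nat ->
  (forall x y, v x y t = Fij i j a b x y + c * Fij i' j' a b x y) ->
  forall x y, dy v x y t = Fij i (S j) a b x y + c * Fij i' (S j') a b x y.
Proof.
  intros H1 H2 Hv x y. unfold dy.
  rewrite (Derive_ext _ (fun z => Fij i j a b x z + c * Fij i' j' a b x z)) by (intros; apply Hv).
  apply is_derive_unique.
  apply (is_derive_plus (V := R_NormedModule) (fun z => Fij i j a b x z)).
  - eapply Fij_derive_y; eauto.
  - apply is_derive_scal. eapply Fij_derive_y; eauto.
Qed.

Lemma slice_lap v t i j i' j' c : (i + j <= 2)%nat -> (i' + j' <= 2)%nat ->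
  (forall x y, v x y t = Fij i j a b x y + c * Fij i' j' a b x y) ->
  forall x y, lap v x y t = Fij (S (S i)) j a b x y + c * Fij (S (S i')) j' a b x y
     + (Fij i (S (S j)) a b x y + c * Fij i' (S (S j')) a b x y).
Proof.
  intros H1 H2 Hv x y. unfold lap. f_equal.
  - apply slice_dx; [lia|lia|]. apply slice_dx; [lia|lia|]. auto.
  - apply slice_dy; [lia|lia|]. apply slice_dy; [lia|lia|]. auto.
Qed.

End Slices.

(** The equation at one time, in terms of the coefficients of [u] and of its time derivative. Unlike
    [dt u x y 0], a two-sided derivative, this expression is meaningful at time 0. *)
Definition pde_sum (p : nat) (a0 b0 a1 b1 : Z * Z -> R) (x y : R) : R :=
  Fij 0 0 a1 b1 x y
     + (Fij 4 0 a1 b1 x y + (Fij 2 2 a1 b1 x y + (Fij 2 2 a1 b1 x y + Fij 0 4 a1 b1 x y)))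
     + (Fij 3 0 a0 b0 x y + Fij 1 2 a0 b0 x y)
     + (1 + Fij 0 0 a0 b0 x y ^ p) * (Fij 1 0 a0 b0 x y + Fij 0 1 a0 b0 x y).

Lemma pde_slice p u t a0 b0 A0 a1 b1 A1 x y : abs_sum a0 b0 A0 -> abs_sum a1 b1 A1 ->
  (forall x y, u x y t = Fij 0 0 a0 b0 x y) -> (forall x y, dt u x y t = Fij 0 0 a1 b1 x y) ->
  dt u x y t + lap (lap (dt u)) x y t + lap (dx u) x y t
    + (1 + u x y t ^ p) * (dx u x y t + dy u x y t) = pde_sum p a0 b0 a1 b1 x y.
Proof.
  intros H0 H1 Hu Hdt.
  assert (Hu' : forall x y, u x y t = Fij 0 0 a0 b0 x y + 0 * Fij 0 0 a0 b0 x y) by (intros; rewrite Hu; ring).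
  assert (Hdt' : forall x y, dt u x y t = Fij 0 0 a1 b1 x y + 0 * Fij 0 0 a1 b1 x y) by (intros; rewrite Hdt; ring).
  assert (L1 : forall x y, lap (dt u) x y t = Fij 2 0 a1 b1 x y + 1 * Fij 0 2 a1 b1 x y).
  { intros. rewrite (slice_lap a1 b1 A1 H1 (dt u) t 0 0 0 0 0 ltac:(lia) ltac:(lia) Hdt'). ring. }
  rewrite (slice_lap a1 b1 A1 H1 (lap (dt u)) t 2 0 0 2 1 ltac:(lia) ltac:(lia) L1).
  rewrite (slice_lap a0 b0 A0 H0 (dx u) t 1 0 1 0 0 ltac:(lia) ltac:(lia)
     (slice_dx a0 b0 A0 H0 u t 0 0 0 0 0 ltac:(lia) ltac:(lia) Hu')).
  rewrite (slice_dx a0 b0 A0 H0 u t 0 0 0 0 0 ltac:(lia) ltac:(lia) Hu').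
  rewrite (slice_dy a0 b0 A0 H0 u t 0 0 0 0 0 ltac:(lia) ltac:(lia) Hu').
  rewrite Hu, Hdt. unfold pde_sum. ring.
Qed.

Section PDE0.
Variables (s T : R) (p : nat) (u : R -> R -> R -> R) (w1 w2 : R -> R -> R -> R).
Let w := fun t x y => u x y t.
Hypothesis Hs : 1 < s.
Hypothesis HT : 0 < T.
Hypothesis Hin : forall t, 0 <= t <= T ->
  InHp (s + 4) (w t) /\ InHp (s + 4) (w1 t) /\ InHp (s + 4) (w2 t).
Hypothesis Hcw : ContH (s + 4) T w.
Hypothesis Hcw1 : ContH (s + 4) T w1.
Hypothesis Hd1 : DerivH (s + 4) T w w1.
Hypothesis Hpde : RosenauKdV p T u.

Lemma InHp_repr f : InHp (s + 4) f -> f = Fij 0 0 (are f) (bim f).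
Proof.
  intros H. destruct (InHp_HB s f H) as [B HBf]. destruct H as (P & C & _).
  eapply HB_repr; eauto.
Qed.

Lemma pde_positive t x y : 0 < t < T ->
  pde_sum p (are (w t)) (bim (w t)) (are (w1 t)) (bim (w1 t)) x y = 0.
Proof.
  intros Ht. destruct (HB_abs_sum s Hs) as (Ca & HCa & Habs).
  destruct (Hin t ltac:(lra)) as (I0 & I1 & _).
  destruct (InHp_HB s _ I0) as [B0 HB0]. destruct (InHp_HB s _ I1) as [B1 HB1].
  rewrite <- (Hpde x y t Ht). symmetry. eapply pde_slice; eauto.
  - intros x' y'. change (w t x' y' = Fij 0 0 (are (w t)) (bim (w t)) x' y').
    rewrite <- (InHp_repr _ I0). auto.
  - intros x' y'. rewrite <- (InHp_repr _ I1). apply is_derive_unique.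
    apply (time_derivative s T Hs w w1 w2 Hin Hd1 x' y' t Ht).
Qed.

(** Every term is continuous at time 0 because [w] and [w1] are continuous in [H^{s+4}], so the
    equation extends from positive times. *)
Lemma pde_initial x y : pde_sum p (are (w 0)) (bim (w 0)) (are (w1 0)) (bim (w1 0)) x y = 0.
Proof.
  destruct (zero_seq T HT) as (tn & Htn & Hlim).
  assert (L0 : forall i j, (i + j <= 4)%nat -> is_lim_seq (fun n => Fij i j (are (w (tn n))) (bim (w (tn n))) x y)
     (Fij i j (are (w 0)) (bim (w 0)) x y)).
  { intros i j Hij. apply (Fij_limit0 s T Hs HT w tn i j x y); auto. intros; apply Hin; auto. }
  assert (L1 : forall i j, (i + j <= 4)%nat -> is_lim_seq (fun n => Fij i j (are (w1 (tn n))) (bim (w1 (tn n))) x y)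
     (Fij i j (are (w1 0)) (bim (w1 0)) x y)).
  { intros i j Hij. apply (Fij_limit0 s T Hs HT w1 tn i j x y); auto. intros; apply Hin; auto. }
  assert (L : is_lim_seq (fun n => pde_sum p (are (w (tn n))) (bim (w (tn n))) (are (w1 (tn n))) (bim (w1 (tn n))) x y)
    (pde_sum p (are (w 0)) (bim (w 0)) (are (w1 0)) (bim (w1 0)) x y)).
  { assert (Lp : is_lim_seq (fun n => Fij 0 0 (are (w (tn n))) (bim (w (tn n))) x y ^ p)
      (Fij 0 0 (are (w 0)) (bim (w 0)) x y ^ p)).
    { apply (is_lim_seq_continuous (fun z => z ^ p)); [|apply (L0 0 0)%nat; lia].
      apply derivable_continuous_pt, derivable_pt_pow. }
    exact (is_lim_seq_plus' _ _ _ _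
      (is_lim_seq_plus' _ _ _ _
        (is_lim_seq_plus' _ _ _ _ (L1 0 0 ltac:(lia))%nat
          (is_lim_seq_plus' _ _ _ _ (L1 4 0 ltac:(lia))%nat
            (is_lim_seq_plus' _ _ _ _ (L1 2 2 ltac:(lia))%nat
              (is_lim_seq_plus' _ _ _ _ (L1 2 2 ltac:(lia))%nat (L1 0 4 ltac:(lia))%nat))))
        (is_lim_seq_plus' _ _ _ _ (L0 3 0 ltac:(lia))%nat (L0 1 2 ltac:(lia))%nat))
      (is_lim_seq_mult' _ _ _ _
        (is_lim_seq_plus' _ _ _ _ (is_lim_seq_const 1) Lp)
        (is_lim_seq_plus' _ _ _ _ (L0 1 0 ltac:(lia))%nat (L0 0 1 ltac:(lia))%nat))). }
  apply is_lim_seq_unique in L.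
  rewrite (Lim_seq_ext _ (fun _ => 0)) in L by (intros n; apply pde_positive; auto).
  rewrite Lim_seq_const in L. injection L; auto.
Qed.

End PDE0.

Lemma HB_mono s a b B B' : HB s a b B -> B <= B' -> HB s a b B'.
Proof. intros H HBB n. eapply Rle_trans; [apply H|auto]. Qed.

Theorem theorem4p1 (T : R) (p : nat) (s : R) (u : R -> R -> R -> R) :
  0 < T -> (1 <= p)%nat -> 1 < s ->
  C2H (s + 4) T u ->
  RosenauKdV p T u ->
  exists tau0 C : R, 0 < tau0 /\ 0 < C /\
    forall (N M : nat), (0 < N)%nat -> Nat.Even N -> (1 <= M)%nat ->
      let tau := T / INR M in
      tau <= tau0 ->
      let U0 := gridval N (fun x y => u x y 0) in
      let u1 := gridval N (fun x y => u x y tau) in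
      forall U1 : grid, LCNMP_step1 N p tau U0 U1 ->
        hnorm N (gsub u1 U1) + hnorm N (lap_h N (gsub u1 U1))
          <= C * (Rpower (INR N) (- s) + tau ^ 2) /\
        hinfnorm N (gsub u1 U1) <= C * (Rpower (INR N) (- s) + tau ^ 2).
Proof.
  intros HT Hp Hs (w1 & w2 & Hin' & Hcw & Hcw1 & _ & Hd1 & Hd2) Hpde.
  pose (w := fun t x y => u x y t).
  assert (Hin : forall t, 0 <= t <= T ->
    InHp (s + 4) (w t) /\ InHp (s + 4) (w1 t) /\ InHp (s + 4) (w2 t)) by exact Hin'.
  destruct (taylor_remainder s T Hs w w1 w2 HT Hin Hcw Hd1 Hd2) as (t0 & Br & Ht0 & Ht0T & Hrem).
  destruct (Hin 0 ltac:(lra)) as (I0 & I1 & _).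
  destruct (InHp_HB s _ I0) as [B0 HB0]. destruct (InHp_HB s _ I1) as [B1 HB1].
  assert (PDE0 : forall x y, pde_sum p (are (w 0)) (bim (w 0)) (are (w1 0)) (bim (w1 0)) x y = 0)
    by exact (pde_initial s T p u w1 w2 Hs HT Hin Hcw Hcw1 Hd1 Hpde).
  (* [residual_bound] takes a single [B] for [u(0)], [u_t(0)] and the remainder. *)
  set (B := Rmax B0 (Rmax B1 Br)).
  assert (HBB0 : B0 <= B) by apply Rmax_l.
  assert (HBB1 : B1 <= B) by (eapply Rle_trans; [apply Rmax_l|apply Rmax_r]).
  assert (HBBr : Br <= B) by (eapply Rle_trans; [apply Rmax_r|apply Rmax_r]).
  destruct (residual_bound s p B T Hs Hp ltac:(lra)) as (C & HC & Hres).
  destruct (box_series_bound 2 ltac:(lra)) as (D & HD & HDn).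
  destruct (HB_abs_sum s Hs) as (Ca & HCa & Habs).
  pose proof PI_RGT_0 as HPI. pose proof (sqrt_pos D) as HsD.
  set (E := C * (1 + T)). assert (HE : 0 < E) by (apply Rmult_lt_0_compat; lra).
  (* [tau0] is the range of the Taylor remainder. The two grid norms cost [2 PI] each, and the
     maximum norm [2 sqrt D] for each of [e] and [A e]; the sum of the constants serves both
     claims. *)
  exists t0, (4 * PI * E + 4 * sqrt D * E).
  assert (HPE : 0 < PI * E) by (apply Rmult_lt_0_compat; lra).
  assert (HDE : 0 <= sqrt D * E) by (apply Rmult_le_pos; lra).
  split; [auto|]. split; [lra|].
  intros N M HN [m Em] HM tau Htau U0 u1 U1 Hstep.
  assert (HMr : 1 <= INR M) by (apply (le_INR 1); auto).
  assert (Htau0 : 0 < tau) by (apply Rdiv_lt_0_compat; lra).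
  assert (HtauT : tau <= T) by lra.
  assert (Hm : (1 <= m)%nat) by lia. subst N. set (N := (2 * m)%nat) in *.
  set (ar := fun k => / tau ^ 2 * (are (w tau) k - are (w 0) k - tau * are (w1 0) k)) in *.
  set (br := fun k => / tau ^ 2 * (bim (w tau) k - bim (w 0) k - tau * bim (w1 0) k)) in *.
  assert (HBr : HB s ar br Br) by (apply Hrem; lra).
  destruct (Hin tau ltac:(lra)) as (It & _ & _).
  destruct (InHp_HB s _ It) as [Bt HBt].
  assert (R0 := InHp_repr s Hs _ I0). assert (R1 := InHp_repr s Hs _ I1). assert (Rt := InHp_repr s Hs _ It).
  set (g1 := gridval N (Fij 0 0 (are (w1 0)) (bim (w1 0)))).
  set (gr := gridval N (Fij 0 0 ar br)).
  set (eta := gadd g1 (gscal tau gr)).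
  assert (EU0 : U0 = gridval N (Fij 0 0 (are (w 0)) (bim (w 0)))).
  { unfold U0. apply (f_equal (gridval N)). exact R0. }
  (* An exact Taylor formula on the grid: the series of the remainder is evaluated through linearity
     and Fourier inversion. *)
  assert (Eu1 : u1 = gadd U0 (gscal tau eta)).
  { apply fun2_ext; intros j1 j2.
    assert (Er : Fij 0 0 ar br (xg N j1) (xg N j2) =
       / tau ^ 2 * (w tau (xg N j1) (xg N j2) - w 0 (xg N j1) (xg N j2) - tau * w1 0 (xg N j1) (xg N j2))).
    { set (x := xg N j1). set (y := xg N j2).
      assert (A1 := Habs _ _ _ HBt). assert (A2 := Habs _ _ _ HB0). assert (A3 := Habs _ _ _ HB1).
      assert (A4 := Habs _ _ _ HBr).
      pose proof (Fij_linear _ _ _ _ _ _ (tau ^ 2) tau 0 0 x y A4 A3 ltac:(lia)) as F1.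
      pose proof (Fij_linear _ _ _ _ _ _ 1 (-1) 0 0 x y A1 A2 ltac:(lia)) as F2.
      rewrite <- R1 in F1. rewrite <- Rt, <- R0 in F2.
      assert (Eq : Fij 0 0 (fun k => tau ^ 2 * ar k + tau * are (w1 0) k) (fun k => tau ^ 2 * br k + tau * bim (w1 0) k) x y
        = Fij 0 0 (fun k => 1 * are (w tau) k + -1 * are (w 0) k) (fun k => 1 * bim (w tau) k + -1 * bim (w 0) k) x y).
      { f_equal; apply functional_extensionality; intros k; unfold ar, br; field; lra. }
      rewrite F1, F2 in Eq.
      replace (w tau x y - w 0 x y - tau * w1 0 x y) with (tau ^ 2 * Fij 0 0 ar br x y) by lra.
      field; lra. }
    unfold u1, U0, eta, g1, gr, gadd, gscal, gridval. rewrite Er, <- R1. unfold w. field; lra. }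
  pose proof (Hres m _ _ _ _ ar br tau Hm (HB_mono _ _ _ _ _ HB0 HBB0) (HB_mono _ _ _ _ _ HB1 HBB1)
    (HB_mono _ _ _ _ _ HBr HBBr) ltac:(lra) PDE0) as HR.
  cbv zeta in HR. fold N in HR. fold g1 gr in HR. fold eta in HR. rewrite <- EU0 in HR.
  set (r := gadd (opIA2 N eta) (opD N p U0 (gadd U0 (gscal (tau / 2) eta)))) in *.
  set (e := gsub u1 U1).
  (* [(u1 + u0) / 2] is [u0 + tau eta / 2], so subtracting the scheme from the definition of [r]
     leaves the error equation. *)
  assert (Hgeq : geq N (gadd (opIA2 N (gscal (/ tau) e)) (opD N p U0 (gscal (/ 2) e))) r).
  { intros j1 j2 H1 H2. specialize (Hstep j1 j2 H1 H2).
    replace (gscal (/ tau) e) with (gadd eta (gscal (-1) (gscal (/ tau) (gsub U1 U0)))).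
    - replace (gscal (/ 2) e) with (gadd (gadd U0 (gscal (tau / 2) eta)) (gscal (-1) (gscal (/ 2) (gadd U1 U0)))).
      + rewrite glinear_opIA2, glinear_opD by auto. unfold r.
        set (P1 := opIA2 N eta). set (P2 := opIA2 N (gscal (/ tau) (gsub U1 U0))) in *.
        set (P3 := opD N p U0 (gadd U0 (gscal (tau / 2) eta))).
        set (P4 := opD N p U0 (gscal (/ 2) (gadd U1 U0))) in *.
        unfold gadd, gscal in Hstep |- *. lra.
      + apply fun2_ext; intros. unfold e. rewrite Eu1. unfold gadd, gscal, gsub. field.
    - apply fun2_ext; intros. unfold e. rewrite Eu1. unfold gadd, gscal, gsub. field. lra. }
  destruct (energy_estimate m Hm p U0 tau e r Htau0 Hgeq) as [He HAe]. fold N in He, HAe.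
  pose proof (Rpower_pos (INR N) (- s)) as HW. set (W := Rpower (INR N) (- s)) in *.
  (* The spare factor [tau] in [tau * W] is bounded by [T], hence [E = C * (1 + T)]. *)
  assert (Hfin : tau * hn N r <= E * (W + tau ^ 2)).
  { apply Rle_trans with (tau * (C * (W + tau))); [apply Rmult_le_compat_l; lra|].
    unfold E. replace (tau * (C * (W + tau))) with (C * (tau * W + tau ^ 2)) by ring.
    rewrite Rmult_assoc. apply Rmult_le_compat_l; [lra|].
    assert (tau * W <= T * W) by (apply Rmult_le_compat_r; lra).
    assert (0 <= tau ^ 2) by apply pow2_ge_0. nra. }
  set (Z := E * (W + tau ^ 2)) in *.
  assert (HZ : 0 <= Z) by (eapply Rle_trans; [|apply Hfin]; apply Rmult_le_pos; [lra|apply hn_nonneg]).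
  replace ((4 * PI * E + 4 * sqrt D * E) * (W + tau ^ 2)) with (4 * PI * Z + 4 * sqrt D * Z) by (unfold Z; ring).
  assert (P1 : 0 <= PI * Z) by (apply Rmult_le_pos; lra).
  assert (P2 : 0 <= sqrt D * Z) by (apply Rmult_le_pos; lra).
  split.
  - rewrite !hnorm_hn by auto. pose proof (hn_lap_h m Hm e) as Hl. fold N in Hl.
    assert (hn N (lap_h N e) <= Z) by lra. assert (hn N e <= Z) by lra. nra.
  - apply hinfnorm_le; auto. intros j1 j2 H1 H2.
    eapply Rle_trans; [apply (sobolev_grid m Hm D HDn e j1 j2 H1 H2)|]. fold N.
    apply Rle_trans with (2 * sqrt D * (Z + Z)); [|lra].
    apply Rmult_le_compat_l; lra.
Qed.
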